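(* Let $\Lambda$ be a finite-dimensional basic algebra over a field, let $\mathcal W\subseteq\mathrm{mod}\,\Lambda$ be a functorially finite wide subcategory, and let $M\in\mathcal W$ be indecomposable and $\tau$-rigid in $\mathcal W$. Then exactly one of the following holds. (1) $M$ is projective in $\mathcal W$, $\overline{\kappa_{\mathcal W}}^{d}(\mathrm{Gen}_{\mathcal W}M)=M^{\perp_{\mathcal W}}={}^{\perp_{\mathcal W}}(\overline{\tau_{\mathcal W}}M)$, and $\mathrm{pop}_{\uparrow,\mathcal W}(\mathrm{Gen}_{\mathcal W}M)=\mathcal W={}^{\perp_{\mathcal W}}(\tau_{\mathcal W}M)$. (2) $M$ is not projective in $\mathcal W$ and $\mathrm{pop}_{\uparrow,\mathcal W}(\mathrm{Gen}_{\mathcal W}M)=\overline{\kappa_{\mathcal W}}^{d}(\mathrm{Gen}_{\mathcal W}M)={}^{\perp_{\mathcal W}}(\tau_{\mathcal W}M)$.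
   Context: $\mathrm{mod}\,\Lambda$ is the category of finitely generated left modules; subcategories are full and closed under isomorphism. A subcategory is wide if closed under kernels, cokernels and extensions; a wide subcategory is functorially finite if and only if it is equivalent to the category of finitely generated modules over some finite-dimensional algebra. $\tau_{\mathcal W}$ and $\nu_{\mathcal W}$ are the Auslander-Reiten translate and Nakayama functor of $\mathcal W$ (transported along such an equivalence; $\nu_{\mathcal W}$ sends each indecomposable projective $P(i)$ to the corresponding indecomposable injective $I(i)$). For $M$ indecomposable, $\overline{\tau_{\mathcal W}}M=\tau_{\mathcal W}M$ if $M$ is not projective in $\mathcal W$, and $\overline{\tau_{\mathcal W}}M=\nu_{\mathcal W}M$ if it is. $M$ is $\tau$-rigid in $\mathcal W$ if $\mathrm{Hom}_\Lambda(M,\tau_{\mathcal W}M)=0$. $\mathrm{Gen}_{\mathcal W}M$ is the class of modules in $\mathcal W$ that are quotients of finite direct sums of copies of $M$. $N^{\perp_{\mathcal W}}=\{X\in\mathcal W\mid\mathrm{Hom}_\Lambda(N,X)=0\}$ and ${}^{\perp_{\mathcal W}}N=\{X\in\mathcal W\mid\mathrm{Hom}_\Lambda(X,N)=0\}$. A torsion class of $\mathcal W$ is a subcategory $\mathcal T\subseteq\mathcal W$ closed under extensions with $\mathcal T=\mathrm{Gen}_{\mathcal W}\mathcal T$; $\mathrm{tors}(\mathcal W)$ is the complete (completely semidistributive) lattice of torsion classes of $\mathcal W$ under inclusion. $\mathrm{pop}_{\uparrow,\mathcal W}(\mathcal T)$ is the join of $\mathcal T$ with all torsion classes covering $\mathcal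 T$. In a complete lattice $L$, an element $m$ is completely meet-irreducible if $m=\bigwedge X$ implies $m\in X$; then it is covered by a unique element $m^*$. A canonical meet representation of $x$ is an equation $x=\bigwedge A$ with $A\subseteq L$ an antichain such that whenever $x=\bigwedge B$, every $a\in A$ satisfies $a\ge b$ for some $b\in B$; if it exists, $A$ is unique, is denoted $\mathrm{CMR}(x)$, and consists of completely meet-irreducible elements. In a completely semidistributive lattice, for completely meet-irreducible $m$ put $\kappa^d(m)=\min\{y\in L\mid m\vee y=m^*\}$ (which exists), and for $x$ having a canonical meet representation put $\overline\kappa^d(x)=\bigvee\{\kappa^d(m)\mid m\in\mathrm{CMR}(x)\}$. $\overline{\kappa_{\mathcal W}}^d$ is this map for $L=\mathrm{tors}(\mathcal W)$; it is defined on $\mathrm{Gen}_{\mathcal W}M$, which has a canonical meet representation when $M$ is $\tau$-rigid in $\mathcal W$. *)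

(* Defs.v *)
From HB Require Import structures.
From mathcomp Require Import all_boot all_algebra all_field.
From mathcomp Require Import boolp.

Set Implicit Arguments.
Unset Strict Implicit.
Unset Printing Implicit Defensive.

Import GRing.Theory.
Local Open Scope ring_scope.

Section Precomp.
Variables (K : fieldType) (U V W : vectType K) (g : 'Hom(U, V)).

Definition precomp_fun (f : 'Hom(V, W)) : 'Hom(U, W) := (f \o g)%VF.

Fact precomp_is_linear : linear precomp_fun.
Proof.
by move=> k f1 f2; rewrite /precomp_fun comp_lfunDl -comp_lfunZl.
Qed.

HB.instance Definition _ := GRing.isLinear.Build K 'Hom(V, W) 'Hom(U, W) _
  precomp_fun precomp_is_linear.

Definition precomp : 'Hom('Hom(V, W), 'Hom(U, W)) := linfun precomp_fun.

Lemma precompE (f : 'Hom(V, W)) : precomp f = (f \o g)%VF.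
Proof. exact: lfunE. Qed.
End Precomp.

(* Over a finite-dimensional K-algebra A, finitely generated modules are the  *)
(* same as modules of finite K-dimension; [mact M a] is the action of a on M. *)
Record fmod (K : fieldType) (A : falgType K) := Fmod {
  mcarrier :> vectType K;
  mact : A -> 'End(mcarrier);
  mact_linear : linear mact;
  mact1 : mact 1 = \1%VF;
  mactM : forall a b, mact (a * b) = (mact a \o mact b)%VF
}.

(* Right modules: [ract N a x] is x . a. *)
Record rmod (K : fieldType) (A : falgType K) := Rmod {
  rcarrier :> vectType K;
  ract : A -> 'End(rcarrier);
  ract_linear : linear ract;
  ract1 : ract 1 = \1%VF;
  ractM : forall a b, ract (a * b) = (ract b \o ract a)%VF
}.

(* Full subcategories are given by their classes of objects. (The [set] of    *)
(* classical_sets cannot be used: its universe lies below that of [fmod A].)  *)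
Definition subcat (K : fieldType) (A : falgType K) := fmod A -> Prop.

Section Hom.
Variables (K : fieldType) (A : falgType K) (X Y : fmod A).

Definition defect (f : 'Hom(X, Y)) (a : A) : 'Hom(X, Y) :=
  (f \o mact X a)%VF - (mact Y a \o f)%VF.

Lemma defectE f a x : defect f a x = f (mact X a x) - mact Y a (f x).
Proof. by rewrite add_lfunE opp_lfunE !comp_lfunE. Qed.

Fact defect_is_linear f : linear (defect f).
Proof.
move=> k a b; rewrite /defect !mact_linear.
rewrite comp_lfunDl comp_lfunDr -comp_lfunZl -comp_lfunZr.
by rewrite scalerBr opprD addrACA.
Qed.
HB.instance Definition _ f :=
  GRing.isLinear.Build K A 'Hom(X, Y) _ (defect f) (defect_is_linear f).

Definition defect_lfun (f : 'Hom(X, Y)) : 'Hom(A, 'Hom(X, Y)) :=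
  linfun (defect f).

Fact defect_lfun_is_linear : linear defect_lfun.
Proof.
move=> k f g; apply/lfunP=> a; rewrite add_lfunE scale_lfunE !lfunE /= /defect.
rewrite comp_lfunDl comp_lfunDr -comp_lfunZl -comp_lfunZr.
by rewrite scalerBr opprD addrACA.
Qed.
HB.instance Definition _ := GRing.isLinear.Build K 'Hom(X, Y)
  'Hom(A, 'Hom(X, Y)) _ defect_lfun defect_lfun_is_linear.

(* The space Hom_A(X, Y); see [mhomP].                               *)
Definition mhom : {vspace 'Hom(X, Y)} := lker (linfun defect_lfun).

Lemma mhomP (f : 'Hom(X, Y)) :
  f \in mhom <-> forall a x, f (mact X a x) = mact Y a (f x).
Proof.
rewrite memv_ker lfunE /=; split=> [/eqP f0 a x | f_eq].
  have /lfunP/(_ x) : defect_lfun f a = 0 by rewrite f0 lfunE.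
  by rewrite lfunE /= defectE zero_lfunE => /eqP; rewrite subr_eq0 => /eqP.
apply/eqP/lfunP=> a; apply/lfunP=> x.
by rewrite lfunE /= defectE !zero_lfunE f_eq subrr.
Qed.
End Hom.

Section Modules.
Variables (K : fieldType) (A : falgType K).
Implicit Types (X Y Z M N P : fmod A) (S T W : subcat A).

Fact amull_compM (a b : A) : amull (a * b) = (amull a \o amull b)%VF.
Proof. by apply/lfunP=> x; rewrite comp_lfunE !lfunE /= mulrA. Qed.

Definition regular_mod : fmod A :=
  @Fmod K A A (@amull K A) (@amull_is_linear K A) (amull1 A) amull_compM.

Definition injective_hom X Y (f : 'Hom(X, Y)) :=
  f \in mhom X Y /\ lker f = 0%VS.

Definition surjective_hom X Y (f : 'Hom(X, Y)) :=
  f \in mhom X Y /\ limg f = fullv.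

Definition isomorphic X Y :=
  exists f : 'Hom(X, Y), injective_hom f /\ surjective_hom f.

Definition zero_mod X := forall x : X, x = 0.

Definition is_kernel X Y Z (f : 'Hom(X, Y)) (i : 'Hom(Z, X)) :=
  injective_hom i /\ limg i = lker f.

Definition is_cokernel X Y Z (f : 'Hom(X, Y)) (q : 'Hom(Y, Z)) :=
  surjective_hom q /\ lker q = limg f.

Definition short_exact X Y Z (f : 'Hom(X, Y)) (g : 'Hom(Y, Z)) :=
  [/\ injective_hom f, surjective_hom g & limg f = lker g].

Definition is_dirsum (I : finType) (Y : I -> fmod A) X :=
  exists (inj : forall i, 'Hom(Y i, X)) (proj : forall i, 'Hom(X, Y i)),
    [/\ forall i, inj i \in mhom (Y i) X /\ proj i \in mhom X (Y i),
        forall i, (proj i \o inj i)%VF = \1%VF,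
        forall i j, i != j -> (proj j \o inj i)%VF = 0 &
        \sum_i (inj i \o proj i)%VF = \1%VF].

Definition indecomposable M :=
  ~ zero_mod M /\
  forall Y : bool -> fmod A, is_dirsum Y M -> exists b, zero_mod (Y b).

Definition basic_algebra :=
  exists (n : nat) (P : 'I_n -> fmod A),
    [/\ is_dirsum P regular_mod, forall i, indecomposable (P i) &
        forall i j, isomorphic (P i) (P j) -> i = j].

Definition iso_closed S := forall X Y, isomorphic X Y -> S X -> S Y.

Definition extension_closed S :=
  forall X Y Z (f : 'Hom(X, Y)) (g : 'Hom(Y, Z)),
    short_exact f g -> S X -> S Z -> S Y.

Definition wide W :=
  [/\ iso_closed W,
      forall X Y Z (f : 'Hom(X, Y)) (i : 'Hom(Z, X)),
        f \in mhom X Y -> is_kernel f i -> W X -> W Y -> W Z,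
      forall X Y Z (f : 'Hom(X, Y)) (q : 'Hom(Y, Z)),
        f \in mhom X Y -> is_cokernel f q -> W X -> W Y -> W Z &
      extension_closed W].

Definition right_approximation W X Y (f : 'Hom(Y, X)) :=
  [/\ W Y, f \in mhom Y X &
      forall Z (g : 'Hom(Z, X)), W Z -> g \in mhom Z X ->
        exists2 h, h \in mhom Z Y & g = (f \o h)%VF].

Definition left_approximation W X Y (f : 'Hom(X, Y)) :=
  [/\ W Y, f \in mhom X Y &
      forall Z (g : 'Hom(X, Z)), W Z -> g \in mhom X Z ->
        exists2 h, h \in mhom Y Z & g = (h \o f)%VF].

Definition functorially_finite W := forall X,
  (exists Y (f : 'Hom(Y, X)), right_approximation W f) /\
  (exists Y (f : 'Hom(X, Y)), left_approximation W f).

(* Projective objects of W; the epimorphisms of a wide subcategory are its    *)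
(* surjective morphisms.                                                      *)
Definition projective_in W P := W P /\
  forall X Y (g : 'Hom(X, Y)) (f : 'Hom(P, Y)), W X -> W Y ->
    surjective_hom g -> f \in mhom P Y ->
    exists2 h, h \in mhom P X & (g \o h)%VF = f.

(* The finite direct sums include the empty one, so [GenS W S] contains 0 as  *)
(* soon as W does.                                                            *)
Definition GenS W S : subcat A := fun X => W X /\
  exists (n : nat) (Y : 'I_n -> fmod A) (D : fmod A) (f : 'Hom(D, X)),
    [/\ forall i, S (Y i), is_dirsum Y D & surjective_hom f].

Definition Gen W M : subcat A := GenS W (fun X => X = M).

Definition rperp W N : subcat A := fun X => W X /\ mhom N X = 0%VS.

Definition lperp W N : subcat A := fun X => W X /\ mhom X N = 0%VS.

Definition torsion_class W T :=
  [/\ forall X, T X -> W X, iso_closed T, extension_closed T & T = GenS W T].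

Definition tors W : subcat A -> Prop := torsion_class W.

(* Projective covers in mod A, as essential epimorphisms. *)
Definition projective_cover P X (p : 'Hom(P, X)) :=
  [/\ projective_in (fun _ => True) P, surjective_hom p &
      forall Y (g : 'Hom(Y, P)), g \in mhom Y P ->
        surjective_hom (p \o g)%VF -> surjective_hom g].

Definition minimal_presentation (P1 P0 X : fmod A)
    (p1 : 'Hom(P1, P0)) (p0 : 'Hom(P0, X)) :=
  projective_cover p0 /\
  exists Z (i : 'Hom(Z, P0)) (q : 'Hom(P1, Z)),
    [/\ is_kernel p0 i, projective_cover q & p1 = (i \o q)%VF].

End Modules.

Section Duality.
Variables (K : fieldType) (A : falgType K).

(* The duality D = Hom_K(-, K) from right to left modules:                    *)
(* (a . phi)(x) = phi(x . a).                                                 *)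
Section Dual.
Variable N : rmod A.
Let dact (a : A) : 'End('Hom(N, K^o)) := precomp K^o (ract N a).

Fact dact_linear : linear dact.
Proof.
move=> k a b; apply/lfunP=> f; rewrite add_lfunE scale_lfunE !precompE.
by rewrite ract_linear comp_lfunDr -comp_lfunZr.
Qed.

Fact dact1 : dact 1 = \1%VF.
Proof. by apply/lfunP=> f; rewrite precompE ract1 comp_lfun1r lfunE. Qed.

Fact dactM a b : dact (a * b) = (dact a \o dact b)%VF.
Proof. by apply/lfunP=> f; rewrite comp_lfunE !precompE ractM comp_lfunA. Qed.

Definition dual : fmod A := Fmod dact_linear dact1 dactM.
End Dual.

(* The right module X^t = Hom_A(X, A): (f . a)(x) = f(x) a.                   *)
Section Star.
Variable X : fmod A.
Local Notation H := (mhom X (regular_mod A)).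

Definition sact_fun (a : A) (f : subvs_of H) : subvs_of H :=
  vsproj H (amulr a \o vsval f)%VF.

Let sact (a : A) : 'End(subvs_of H) := linfun (sact_fun a).

Fact mhom_amulr (a : A) (f : subvs_of H) : (amulr a \o vsval f)%VF \in H.
Proof.
apply/mhomP=> b x; rewrite !comp_lfunE.
have /mhomP -> := subvsP f.
by rewrite /= !lfunE /= mulrA.
Qed.

Fact sact_fun_linear a : linear (sact_fun a).
Proof.
move=> k f g; rewrite /sact_fun -linearP; congr (vsproj _ _).
by rewrite linearP comp_lfunDr -comp_lfunZr.
Qed.
HB.instance Definition _ a := GRing.isLinear.Build K (subvs_of H)
  (subvs_of H) _ (sact_fun a) (sact_fun_linear a).

Fact sactE a (f : subvs_of H) : vsval (sact a f) = (amulr a \o vsval f)%VF.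
Proof. by rewrite /sact lfunE /= /sact_fun vsprojK ?mhom_amulr. Qed.

Fact sact_linear : linear sact.
Proof.
move=> k a b; apply/lfunP=> f; apply/val_inj; rewrite /= sactE.
rewrite add_lfunE scale_lfunE linearP /= !sactE.
by rewrite comp_lfunDl -comp_lfunZl.
Qed.

Fact sact1 : sact 1 = \1%VF.
Proof.
apply/lfunP=> f; apply/val_inj; rewrite /= sactE lfunE /=.
by apply/lfunP=> x; rewrite comp_lfunE lfunE /= mulr1.
Qed.

Fact sactM a b : sact (a * b) = (sact b \o sact a)%VF.
Proof.
apply/lfunP=> f; apply/val_inj; rewrite /= comp_lfunE !sactE.
by apply/lfunP=> x; rewrite !comp_lfunE !lfunE /= mulrA.
Qed.

Definition star : rmod A := Rmod sact_linear sact1 sactM.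

Lemma star_actE a (f : star) (x : X) :
  vsval (ract star a f) x = vsval f x * a.
Proof. by rewrite [ract _ _ _]/(sact a f) sactE comp_lfunE lfunE. Qed.
End Star.

(* The map g^t : Y^t -> X^t, f |-> f \o g; [vsproj] only restricts the        *)
(* codomain when g is a morphism of modules.                                  *)
Section StarMap.
Variables (X Y : fmod A) (g : 'Hom(X, Y)).

Definition star_map_fun (f : star Y) : star X :=
  vsproj (mhom X (regular_mod A)) (vsval f \o g)%VF.

Fact star_map_fun_linear : linear star_map_fun.
Proof.
move=> k f1 f2; rewrite /star_map_fun -linearP; congr (vsproj _ _).
by rewrite linearP comp_lfunDl -comp_lfunZl.
Qed.
HB.instance Definition _ := GRing.isLinear.Build K (star Y) (star X) _
  star_map_fun star_map_fun_linear.

Definition star_map : 'Hom(star Y, star X) := linfun star_map_fun.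

Lemma star_mapE (f : star Y) (x : X) :
  g \in mhom X Y -> vsval (star_map f) x = vsval f (g x).
Proof.
move=> /mhomP g_hom.
have fP : vsval f \in mhom Y (regular_mod A) := subvsP _.
have fgP : (vsval f \o g)%VF \in mhom X (regular_mod A).
  by apply/mhomP=> a y; rewrite !comp_lfunE g_hom; move/mhomP: fP => ->.
by rewrite lfunE /= /star_map_fun vsprojK // comp_lfunE.
Qed.
End StarMap.

Definition right_hom (N N' : rmod A) (f : 'Hom(N, N')) :=
  forall a x, f (ract N a x) = ract N' a (f x).

(* T = Tr X = Coker(P0^t -> P1^t), for a minimal projective presentation      *)
(* P1 -> P0 -> X -> 0.                                                        *)
Definition is_transpose (X : fmod A) (T : rmod A) :=
  exists (P1 P0 : fmod A) (p1 : 'Hom(P1, P0)) (p0 : 'Hom(P0, X))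
         (q : 'Hom(star P1, T)),
    [/\ minimal_presentation p1 p0, right_hom q, limg q = fullv &
        lker q = limg (star_map p1)].

Definition is_AR_translate (X T : fmod A) :=
  exists2 N : rmod A, is_transpose X N & isomorphic T (dual N).

Definition nakayama (X : fmod A) : fmod A := dual (star X).
End Duality.

(* K-linear equivalences from the full subcategory W of mod A to mod B; the   *)
(* values of the functor outside W are irrelevant.                            *)
Record mod_equivalence (K : fieldType) (A B : falgType K)
    (W : subcat A) := ModEquivalence {
  eob :> fmod A -> fmod B;
  emor : forall X Y : fmod A, 'Hom(X, Y) -> 'Hom(eob X, eob Y);
  emor_hom : forall (X Y : fmod A) (f : 'Hom(X, Y)), W X -> W Y ->
    f \in mhom X Y -> emor f \in mhom (eob X) (eob Y);
  emor_linear : forall (X Y : fmod A) k (f g : 'Hom(X, Y)), W X -> W Y ->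
    f \in mhom X Y -> g \in mhom X Y ->
    emor (k *: f + g) = k *: emor f + emor g;
  emor_id : forall X, W X -> emor (\1%VF : 'Hom(X, X)) = \1%VF;
  emor_comp : forall (X Y Z : fmod A) (f : 'Hom(X, Y)) (g : 'Hom(Y, Z)),
    W X -> W Y -> W Z -> f \in mhom X Y -> g \in mhom Y Z ->
    emor (g \o f)%VF = (emor g \o emor f)%VF;
  emor_faithful : forall (X Y : fmod A) (f g : 'Hom(X, Y)), W X -> W Y ->
    f \in mhom X Y -> g \in mhom X Y -> emor f = emor g -> f = g;
  emor_full : forall (X Y : fmod A) (h : 'Hom(eob X, eob Y)), W X -> W Y ->
    h \in mhom (eob X) (eob Y) -> exists2 f, f \in mhom X Y & emor f = h;
  eob_dense : forall N : fmod B, exists2 X, W X & isomorphic (eob X) N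
}.

Section RelativeTranslates.
Variables (K : fieldType) (A : falgType K) (W : subcat A).

Definition is_tau (M T : fmod A) := W T /\
  exists (B : falgType K) (E : mod_equivalence B W),
    is_AR_translate (E M) (E T).

Definition is_nu (M N : fmod A) := W N /\
  exists (B : falgType K) (E : mod_equivalence B W),
    isomorphic (E N) (nakayama (E M)).

(* Some module satisfying P, or the junk value M if there is none. *)
Definition pick_mod (M : fmod A) (P : subcat A) : fmod A :=
  if pselect (exists X, P X) is left e then projT1 (cid e) else M.

(* tau_W M and nu_W M are defined up to isomorphism; a representative is      *)
(* chosen. They exist when W is wide and functorially finite, and M is in W   *)
(* and nonzero.                                                               *)
Definition tau (M : fmod A) : fmod A := pick_mod M (is_tau M).

Definition nu (M : fmod A) : fmod A := pick_mod M (is_nu M).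

Definition taubar (M : fmod A) : fmod A :=
  if `[< projective_in W M >] then nu M else tau M.

Definition tau_rigid (M : fmod A) := mhom M (tau M) = 0%VS.
End RelativeTranslates.

(* A family L of subsets of U, ordered by inclusion. The partial operations   *)
(* on L are given by their graphs, so that e.g. [is_kappabar_d L x z] means   *)
(* that the value at x is defined and equal to z.                             *)
Section Lattice.
Variables (U : Type) (L : (U -> Prop) -> Prop).
Implicit Types (X A B : (U -> Prop) -> Prop) (x y z m k : U -> Prop).

Definition incl x y := forall u, x u -> y u.
Local Notation "x <=< y" := (incl x y) (at level 70).

Definition is_join X z :=
  [/\ L z, forall x, X x -> x <=< z &
      forall y, L y -> (forall x, X x -> x <=< y) -> z <=< y].

Definition is_meet X z :=
  [/\ L z, forall x, X x -> z <=< x &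
      forall y, L y -> (forall x, X x -> y <=< x) -> y <=< z].

Definition covered_by x y :=
  [/\ L x, L y, x <=< y /\ x <> y &
      forall z, L z -> x <=< z -> z <=< y -> z = x \/ z = y].

Definition is_pop_up x z := is_join (fun y => y = x \/ covered_by x y) z.

Definition completely_meet_irreducible m :=
  L m /\ forall X, (forall x, X x -> L x) -> is_meet X m -> X m.

Definition antichain A := forall x y, A x -> A y -> x <=< y -> x = y.

Definition is_CMR x A :=
  [/\ forall a, A a -> L a, antichain A, is_meet A x &
      forall B, (forall b, B b -> L b) -> is_meet B x ->
        forall a, A a -> exists2 b, B b & b <=< a].

(* The element covering m is unique since m is completely meet-irreducible.   *)
Definition is_kappa_d m k :=
  completely_meet_irreducible m /\
  exists m', [/\ covered_by m m', L k, is_join (fun x => x = m \/ x = k) m' &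
    forall y, L y -> is_join (fun x => x = m \/ x = y) m' -> k <=< y].

Definition is_kappabar_d x z :=
  exists (A : (U -> Prop) -> Prop) (kd : (U -> Prop) -> (U -> Prop)),
    [/\ is_CMR x A, forall m, A m -> is_kappa_d m (kd m) &
        is_join (fun k => exists2 m, A m & k = kd m) z].
End Lattice.

Definition exactly_one (P Q : Prop) := (P /\ ~ Q) \/ (~ P /\ Q).

(* Main.v *)
(* Let q1 : Q1 -> Q0 -> M -> 0 be a minimal projective presentation of M in W.
   By the Auslander-Reiten formulas a module X of W is in lperp (tau M) iff every
   map Q1 -> X factors through q1, so lperp (tau M) =: TT is a torsion class, M is
   Ext-projective in it, and T0 := Gen M <= TT is a torsion class as well. The
   heart J := TT n rperp M of the interval [T0, TT] is a wide subcategory.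

   For Y in W, the pushout of a power of the presentation along a minimal set of
   generators of Hom(Q1, Y) modulo maps through q1 is an exact sequence
   Y -> U -> M^k -> 0 with U in TT such that all maps M -> U -> M are radical. It
   shows that every torsion class T > T0 contains a nonzero object of J, hence a
   simple object S of J. Since proper quotients of S are in T0, it follows that
   the lperp S form the canonical meet representation of T0, that kappa^d of
   lperp S is the torsion class T(S), and that the covers of T0 are the joins of
   T0 and T(S). So the join of the covers is TT, and kappabar^d(T0) = T(J).

   If M is projective then TT = W, J = rperp M is a torsion class, and
   Hom(X, nu M) is dual to Hom(M, X). If not, the sequence for Y = Q0 yields a
   non-split surjection U -> M with U in TT. Modulo the trace of M, U is in J, and
   this puts M itself in T(J), so that T(J) = TT.

   That tau and nu exist in W requires an equivalence W = mod B: a minimal left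
   W-approximation P of A is a reflection of A, and Hom(P, -) is an equivalence
   from W to modules over the opposite algebra of End(P). *)
From HB Require Import structures.
Require Import Defs.
From mathcomp Require Import all_boot all_algebra all_field.
From mathcomp Require Import boolp.

Set Implicit Arguments.
Unset Strict Implicit.
Unset Printing Implicit Defensive.

Import GRing.Theory.
Local Open Scope ring_scope.

(** * Modules and their homomorphisms *)

(** Neither Ext groups nor Auslander-Reiten sequences are constructed. Hom(X, D Tr M) is dual to the
    cokernel of Hom(P0, X) -> Hom(P1, X), so it vanishes iff all maps P1 -> X factor through the
    presentation. This condition makes sense inside W. Once it has been transported along an
    equivalence with some mod B, the lattice argument uses only a [rigid_presentation] of M in W,
    and the choices hidden in tau no longer matter.

    That M is indecomposable enters through Fitting's lemma: an endomorphism of M is injective or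
    nilpotent. Hence there is a nonzero e in the socle of Hom(M, Y) that kills the image of every
    non-injective endomorphism of M, and therefore any sum of such images. In particular, if U -> M
    is onto and all composites M -> U -> M with it are radical, then U is not generated by M. This
    takes the place of a theory of radicals and of the Krull-Schmidt theorem. *)

Section LinearMaps.
Variables (K : fieldType) (U V : vectType K).
Implicit Types f : 'Hom(U, V).

Lemma limgP f y : reflect (exists x, y = f x) (y \in limg f).
Proof.
apply: (iffP memv_imgP) => [[x _ ->]|[x ->]]; first by exists x.
by exists x; rewrite ?memvf.
Qed.

Lemma mem_limg f x : f x \in limg f.
Proof. by apply/limgP; exists x. Qed.

Lemma lkerP f x : reflect (f x = 0) (x \in lker f).
Proof. by rewrite memv_ker; apply: eqP. Qed.

Lemma limg_fullP f : limg f = fullv <-> forall y, exists x, f x = y.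
Proof.
split=> [ff y|ff].
  by have /limgP[x ->] : y \in limg f by [rewrite ff memvf]; exists x.
by apply/vspaceP=> y; rewrite memvf; apply/limgP; have [x <-] := ff y; exists x.
Qed.

Lemma lker0_eqP f : lker f = 0%VS <-> forall x, f x = 0 -> x = 0.
Proof.
split=> [f0 x /lkerP|f0]; first by rewrite f0 memv0 => /eqP.
apply/eqP; rewrite -subv0; apply/subvP=> x /lkerP /f0 ->; exact: mem0v.
Qed.

Lemma lker_sub_inj f x y : lker f = 0%VS -> f x = f y -> x = y.
Proof. by move/eqP/lker0P; apply. Qed.
End LinearMaps.

Lemma end_surj_inj (K : fieldType) (U : vectType K) (f : 'End(U)) :
  limg f = fullv <-> lker f = 0%VS.
Proof.
have := limg_ker_dim f fullv; rewrite capfv => d.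
split=> [ff|f0]; last by apply: lker0_limgf; apply/eqP.
by apply/eqP; rewrite -dimv_eq0 -(eqn_add2r (\dim (limg f))) add0n d ff.
Qed.

(** The complement of V carries the quotient, with the projection along V as q. *)
Lemma quotient_space (K : fieldType) (U : vectType K) (V : {vspace U}) :
  exists (Z : vectType K) (q : 'Hom(U, Z)), limg q = fullv /\ lker q = V.
Proof.
have CV : (V^C :&: V = 0)%VS by rewrite capvC capv_compl.
pose q : 'Hom(U, subvs_of (V^C)) := linfun (vsproj (V^C) \o daddv_pi (V^C) V).
have qE x : vsval (q x) = daddv_pi (V^C) V x.
  by rewrite lfunE /= vsprojK ?memv_pi.
exists (subvs_of (V^C)), q; split.
  apply/limg_fullP=> v; exists (vsval v); apply: val_inj.
  by rewrite /= qE daddv_pi_id ?subvsP.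
have dec x : daddv_pi (V^C) V x + daddv_pi V (V^C) x = x.
  by apply: daddv_pi_add => //; rewrite addvC addv_complf memvf.
apply/vspaceP=> x; apply/lkerP/idP=> [qx|xV].
  by rewrite -[x]dec -qE qx add0r memv_pi.
apply: val_inj; rewrite /= qE; apply: (addIr (daddv_pi V (V^C) x)).
by rewrite dec add0r daddv_pi_id ?capv_compl.
Qed.

Section Modules.
Variables (K : fieldType) (A : falgType K).
Implicit Types X Y Z : fmod A.

Lemma mactA X a b (x : X) : mact X (a * b) x = mact X a (mact X b x).
Proof. by rewrite mactM comp_lfunE. Qed.

Lemma mact1E X (x : X) : mact X 1 x = x.
Proof. by rewrite mact1 id_lfunE. Qed.

Lemma mactP X k a b (x : X) :
  mact X (k *: a + b) x = k *: mact X a x + mact X b x.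
Proof. by rewrite mact_linear add_lfunE scale_lfunE. Qed.

Lemma mactD X a b (x : X) : mact X (a + b) x = mact X a x + mact X b x.
Proof. by rewrite -(scale1r a) mactP !scale1r. Qed.

Lemma mact0 X (x : X) : mact X 0 x = 0.
Proof. by apply: (addIr (mact X 0 x)); rewrite -mactD !add0r. Qed.

Lemma mactZ X k a (x : X) : mact X (k *: a) x = k *: mact X a x.
Proof. by rewrite -[k *: a]addr0 mactP mact0 addr0. Qed.

Lemma mhomE X Y (f : 'Hom(X, Y)) a x :
  f \in mhom X Y -> f (mact X a x) = mact Y a (f x).
Proof. by move/mhomP->. Qed.

Lemma mhom_linfun X Y (f : {linear X -> Y}) :
  (forall a x, f (mact X a x) = mact Y a (f x)) -> linfun f \in mhom X Y.
Proof. by move=> fP; apply/mhomP=> a x; rewrite !lfunE. Qed.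

Lemma mhom1 X : \1%VF \in mhom X X.
Proof. by apply/mhomP=> a x; rewrite !id_lfunE. Qed.

Lemma mhom_comp X Y Z (f : 'Hom(X, Y)) (g : 'Hom(Y, Z)) :
  f \in mhom X Y -> g \in mhom Y Z -> (g \o f)%VF \in mhom X Z.
Proof.
by move=> fP gP; apply/mhomP=> a x; rewrite !comp_lfunE mhomE // mhomE.
Qed.

Lemma inj_homP X Y (f : 'Hom(X, Y)) :
  injective_hom f <-> f \in mhom X Y /\ forall x, f x = 0 -> x = 0.
Proof. by rewrite /injective_hom lker0_eqP. Qed.

Lemma surj_homP X Y (f : 'Hom(X, Y)) :
  surjective_hom f <-> f \in mhom X Y /\ forall y, exists x, f x = y.
Proof. by rewrite /surjective_hom limg_fullP. Qed.

(** The section [q^-1] is only K-linear. Composing it with f gives a module map because f agrees on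
    elements with the same image under q. *)
Lemma factor_surj X Y Z (q : 'Hom(X, Y)) (f : 'Hom(X, Z)) :
  surjective_hom q -> f \in mhom X Z -> (forall x, q x = 0 -> f x = 0) ->
  exists2 h, h \in mhom Y Z & forall x, f x = h (q x).
Proof.
move=> [qP qf] fP f0.
have qK y : q (q^-1%VF y) = y by apply: limg_lfunVK; rewrite qf memvf.
have fq x y : q x = q y -> f x = f y.
  move=> qxy; apply/eqP; rewrite -subr_eq0 -linearB; apply/eqP/f0.
  by rewrite linearB /= qxy subrr.
exists (f \o q^-1)%VF => [|x]; last by rewrite comp_lfunE; apply: fq; rewrite qK.
apply/mhomP=> a y; rewrite !comp_lfunE -mhomE //; apply: fq.
by rewrite (mhomE _ _ qP) !qK.
Qed.

Lemma factor_inj X Y Z (i : 'Hom(Z, X)) (f : 'Hom(Y, X)) :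
  injective_hom i -> f \in mhom Y X -> (forall y, exists z, f y = i z) ->
  exists2 h, h \in mhom Y Z & forall y, f y = i (h y).
Proof.
move=> [iP i0] fP fi.
have fK y : i (i^-1%VF (f y)) = f y.
  by apply: limg_lfunVK; apply/limgP; have [z ->] := fi y; exists z.
exists (i^-1 \o f)%VF => [|y]; last by rewrite comp_lfunE fK.
apply/mhomP=> a y; rewrite !comp_lfunE; apply: (lker_sub_inj i0).
by rewrite fK (mhomE _ _ iP) (mhomE _ _ fP) fK.
Qed.

Lemma bij_inv X Y (f : 'Hom(X, Y)) : injective_hom f -> surjective_hom f ->
  exists g : 'Hom(Y, X), [/\ g \in mhom Y X, cancel f g & cancel g f].
Proof.
move=> /[dup] fi [_ f0] /surj_homP[fP ff].
have [y|g gP fg] := factor_inj fi (mhom1 Y).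
  by have [x fx] := ff y; exists x; rewrite id_lfunE.
have fK y : f (g y) = y by rewrite -fg id_lfunE.
by exists g; split=> // x; apply: (lker_sub_inj f0); rewrite fK.
Qed.

Lemma isoP X Y : isomorphic X Y <-> exists (f : 'Hom(X, Y)) (g : 'Hom(Y, X)),
  [/\ f \in mhom X Y, g \in mhom Y X, cancel f g & cancel g f].
Proof.
split=> [[f [fi fs]]|[f [g [fP gP fK gK]]]].
  by have [g [gP fK gK]] := bij_inv fi fs; exists f, g; split=> //; case: fi.
exists f; split; first by apply/inj_homP; split=> // x fx; rewrite -(fK x) fx linear0.
by apply/surj_homP; split=> // y; exists (g y); rewrite gK.
Qed.

Lemma iso_sym X Y : isomorphic X Y -> isomorphic Y X.
Proof. by move/isoP=> [f [g [? ? ? ?]]]; apply/isoP; exists g, f. Qed.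

(** * Submodules and quotient modules *)

Section Sub.
Variables (X : fmod A) (V : {vspace X}).
Hypothesis V_stable : forall a x, x \in V -> mact X a x \in V.

Let sub_fun a (v : subvs_of V) : subvs_of V := vsproj V (mact X a (vsval v)).

Let sub_fun_linear a : linear (sub_fun a).
Proof. by move=> k u v; rewrite /sub_fun !linearP. Qed.
HB.instance Definition _ a := GRing.isLinear.Build K _ _ _ (sub_fun a)
  (sub_fun_linear a).

Let sub_act a : 'End(subvs_of V) := linfun (sub_fun a).

Let sub_actE a v : vsval (sub_act a v) = mact X a (vsval v).
Proof. by rewrite lfunE /= /sub_fun vsprojK // V_stable // subvsP. Qed.

Let sub_act_linear : linear sub_act.
Proof.
move=> k a b; apply/lfunP=> v; apply/val_inj; rewrite /= sub_actE.
by rewrite add_lfunE scale_lfunE linearP /= !sub_actE mactP.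
Qed.

Let sub_act1 : sub_act 1 = \1%VF.
Proof. by apply/lfunP=> v; apply/val_inj; rewrite /= sub_actE id_lfunE mact1E. Qed.

Let sub_actM a b : sub_act (a * b) = (sub_act a \o sub_act b)%VF.
Proof.
by apply/lfunP=> v; apply/val_inj; rewrite /= comp_lfunE !sub_actE mactA.
Qed.

Lemma submodule_exists : exists (Z : fmod A) (i : 'Hom(Z, X)),
  injective_hom i /\ limg i = V.
Proof.
exists (Fmod sub_act_linear sub_act1 sub_actM), (linfun vsval).
split.
  apply/inj_homP; split.
    by apply/mhomP=> a v; rewrite [LHS]lfunE [in RHS]lfunE; apply: sub_actE.
  by move=> v; rewrite lfunE /= => v0; apply/val_inj.
apply/vspaceP=> x; apply/limgP/idP=> [[v ->]|xV].
  by rewrite lfunE subvsP.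
by exists (vsproj V x); rewrite lfunE /= vsprojK.
Qed.

Lemma quotient_exists : exists (Z : fmod A) (q : 'Hom(X, Z)),
  surjective_hom q /\ lker q = V.
Proof.
have [Z [q [qf qV]]] := quotient_space V.
have qK z : q (q^-1%VF z) = z by apply: limg_lfunVK; rewrite qf memvf.
pose act a : 'End(Z) := (q \o (mact X a \o q^-1))%VF.
have qact a x : act a (q x) = q (mact X a x).
  rewrite !comp_lfunE; apply/eqP; rewrite -subr_eq0 -!linearB; apply/eqP/lkerP.
  by rewrite qV V_stable // -qV; apply/lkerP; rewrite linearB /= qK subrr.
have act_linear : linear act.
  move=> k a b; apply/lfunP=> z; rewrite -[z]qK.
  by rewrite add_lfunE scale_lfunE !qact mactP linearP.
have act1 : act 1 = \1%VF.
  by apply/lfunP=> z; rewrite -[z]qK qact mact1E id_lfunE.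
have actM a b : act (a * b) = (act a \o act b)%VF.
  by apply/lfunP=> z; rewrite -[z]qK comp_lfunE !qact mactA.
exists (Fmod act_linear act1 actM), q; split=> //; split=> //.
by apply/mhomP=> a x; rewrite -qact.
Qed.
End Sub.

Lemma kernel_exists X Y (f : 'Hom(X, Y)) : f \in mhom X Y ->
  exists (Z : fmod A) (i : 'Hom(Z, X)), is_kernel f i.
Proof.
move=> fP; apply: submodule_exists => a x /lkerP fx.
by apply/lkerP; rewrite mhomE // fx linear0.
Qed.

Lemma limg_stable X Y (f : 'Hom(X, Y)) a y : f \in mhom X Y ->
  y \in limg f -> mact Y a y \in limg f.
Proof. by move=> fP /limgP[x ->]; rewrite -mhomE // mem_limg. Qed.

Lemma cokernel_exists X Y (f : 'Hom(X, Y)) : f \in mhom X Y ->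
  exists (Z : fmod A) (q : 'Hom(Y, Z)), is_cokernel f q.
Proof.
by move=> fP; apply: quotient_exists => a y; apply: limg_stable.
Qed.

Lemma zero_mod_exists : exists Z : fmod A, zero_mod Z.
Proof.
have [a x|Z [i [/inj_homP[_ i0] iV]]] := @submodule_exists (regular_mod A) 0%VS.
  by rewrite !memv0 => /eqP ->; rewrite linear0.
by exists Z => z; apply: i0; apply/eqP; rewrite -memv0 -iV mem_limg.
Qed.

(** * Finite powers of a module *)

Section Power.
Variables (M : fmod A) (n : nat).

Let pow_fun a (v : {ffun 'I_n -> M}) := [ffun i => mact M a (v i)].
Let pow_fun_linear a : linear (pow_fun a).
Proof. by move=> k u v; apply/ffunP=> i; rewrite !ffunE linearP. Qed.
HB.instance Definition _ a := GRing.isLinear.Build K _ _ _ (pow_fun a)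
  (pow_fun_linear a).
Let pow_act a : 'End({ffun 'I_n -> M}) := linfun (pow_fun a).
Let pow_actE a v i : pow_act a v i = mact M a (v i).
Proof. by rewrite lfunE /= ffunE. Qed.

Let pow_act_linear : linear pow_act.
Proof.
move=> k a b; apply/lfunP=> v; apply/ffunP=> i.
by rewrite add_lfunE scale_lfunE pow_actE !ffunE !pow_actE mactP.
Qed.
Let pow_act1 : pow_act 1 = \1%VF.
Proof. by apply/lfunP=> v; apply/ffunP=> i; rewrite pow_actE id_lfunE mact1E. Qed.
Let pow_actM a b : pow_act (a * b) = (pow_act a \o pow_act b)%VF.
Proof. by apply/lfunP=> v; apply/ffunP=> i; rewrite comp_lfunE !pow_actE mactA. Qed.

Let pow_proj i (v : {ffun 'I_n -> M}) : M := v i.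
Let pow_proj_linear i : linear (pow_proj i).
Proof. by move=> k u v; rewrite /pow_proj !ffunE. Qed.
HB.instance Definition _ i := GRing.isLinear.Build K _ _ _ (pow_proj i)
  (pow_proj_linear i).

Let pow_inj i (x : M) : {ffun 'I_n -> M} := [ffun j => if i == j then x else 0].
Let pow_inj_linear i : linear (pow_inj i).
Proof.
move=> k u v; apply/ffunP=> j; rewrite !ffunE.
by case: eqP => // _; rewrite scaler0 addr0.
Qed.
HB.instance Definition _ i := GRing.isLinear.Build K _ _ _ (pow_inj i)
  (pow_inj_linear i).

Lemma power_exists : exists N : fmod A, is_dirsum (fun _ : 'I_n => M) N.
Proof.
exists (Fmod pow_act_linear pow_act1 pow_actM).
exists (fun i => linfun (pow_inj i)), (fun i => linfun (pow_proj i)).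
have pE i v : linfun (pow_proj i) v = v i by rewrite lfunE.
have iE i x j : linfun (pow_inj i) x j = if i == j then x else 0.
  by rewrite lfunE /= ffunE.
split=> [i|i|i j|].
- split; apply/mhomP=> a x; last by rewrite !pE; apply: pow_actE.
  apply/ffunP=> j; rewrite iE [RHS]pow_actE iE.
  by case: eqP; rewrite // linear0.
- by apply/lfunP=> x; rewrite comp_lfunE pE iE eqxx id_lfunE.
- by move=> /negPf ij; apply/lfunP=> x; rewrite comp_lfunE pE iE ij zero_lfunE.
apply/lfunP=> v; rewrite sum_lfunE id_lfunE.
apply/ffunP=> j; rewrite sum_ffunE (bigD1 j) //= big1 ?addr0.
  by rewrite comp_lfunE iE eqxx pE.
by move=> i /negPf ij; rewrite comp_lfunE iE ij.
Qed.
End Power.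

(** * Direct sums of two modules *)

Section Pair.
Variables (X Y : fmod A).

Let pair_fun a (v : X * Y) : X * Y := (mact X a v.1, mact Y a v.2).
Let pair_fun_linear a : linear (pair_fun a).
Proof. by move=> k u v; rewrite /pair_fun /= !linearP. Qed.
HB.instance Definition _ a := GRing.isLinear.Build K _ _ _ (pair_fun a)
  (pair_fun_linear a).
Let pair_act a : 'End((X * Y)%type) := linfun (pair_fun a).

Let pair_act_linear : linear pair_act.
Proof.
move=> k a b; apply/lfunP=> -[x y].
by rewrite add_lfunE scale_lfunE !lfunE /= /pair_fun /= !mactP.
Qed.
Let pair_act1 : pair_act 1 = \1%VF.
Proof. by apply/lfunP=> -[x y]; rewrite id_lfunE lfunE /= /pair_fun /= !mact1E. Qed.
Let pair_actM a b : pair_act (a * b) = (pair_act a \o pair_act b)%VF.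
Proof. by apply/lfunP=> -[x y]; rewrite comp_lfunE !lfunE /= /pair_fun /= !mactA. Qed.

Let inl (x : X) : X * Y := (x, 0).
Let inl_linear : linear inl.
Proof. by move=> k u v; rewrite -[RHS]/(_, _) /= scaler0 addr0. Qed.
HB.instance Definition _ := GRing.isLinear.Build K _ _ _ inl inl_linear.
Let inr (y : Y) : X * Y := (0, y).
Let inr_linear : linear inr.
Proof. by move=> k u v; rewrite -[RHS]/(_, _) /= scaler0 addr0. Qed.
HB.instance Definition _ := GRing.isLinear.Build K _ _ _ inr inr_linear.
Let prl (v : X * Y) : X := v.1.
Let prl_linear : linear prl. Proof. by []. Qed.
HB.instance Definition _ := GRing.isLinear.Build K _ _ _ prl prl_linear.
Let prr (v : X * Y) : Y := v.2.
Let prr_linear : linear prr. Proof. by []. Qed.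
HB.instance Definition _ := GRing.isLinear.Build K _ _ _ prr prr_linear.

Lemma pair_exists : exists (D : fmod A) (i1 : 'Hom(X, D)) (i2 : 'Hom(Y, D))
    (p1 : 'Hom(D, X)) (p2 : 'Hom(D, Y)),
  [/\ [/\ i1 \in mhom X D, i2 \in mhom Y D, p1 \in mhom D X & p2 \in mhom D Y],
      forall x, p1 (i1 x) = x /\ p2 (i1 x) = 0,
      forall y, p1 (i2 y) = 0 /\ p2 (i2 y) = y &
      forall d, d = i1 (p1 d) + i2 (p2 d)].
Proof.
exists (Fmod pair_act_linear pair_act1 pair_actM).
exists (linfun inl), (linfun inr), (linfun prl), (linfun prr).
have lE x : linfun inl x = (x, 0) by rewrite lfunE.
have rE x : linfun inr x = (0, x) by rewrite lfunE.
have plE v : linfun prl v = v.1 by rewrite lfunE.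
have prE v : linfun prr v = v.2 by rewrite lfunE.
have aE a v : pair_act a v = (mact X a v.1, mact Y a v.2) by rewrite lfunE.
split=> [|x|y|[x y]]; rewrite ?lE ?rE ?plE ?prE //.
  split; apply/mhomP=> a v; rewrite ?lE ?rE ?plE ?prE.
  - by rewrite [RHS]aE linear0.
  - by rewrite [RHS]aE linear0.
  - by rewrite [mact _ a v]aE.
  - by rewrite [mact _ a v]aE.
by congr (_, _); rewrite /= ?addr0 ?add0r.
Qed.
End Pair.
End Modules.

(** * Torsion classes of a wide subcategory *)

Lemma subcat_ext (K : fieldType) (A : falgType K) (S T : subcat A) :
  (forall X, S X <-> T X) -> S = T.
Proof. by move=> ST; apply/funext=> X; apply/propext. Qed.

Section Trace.
Variables (K : fieldType) (A : falgType K) (M X : fmod A).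

(** Summing over a basis of Hom(M, X) keeps the sum finite; [mem_trace] and [trace_sub] show that it
    is the least subspace containing the images of all homomorphisms. *)
Definition trace : {vspace X} :=
  (\sum_(i < \dim (mhom M X)) limg (vbasis (mhom M X))`_i)%VS.

Lemma mem_trace f m : f \in mhom M X -> f m \in trace.
Proof.
move=> /coord_vbasis ->; rewrite sum_lfunE; apply: memv_suml => i _.
rewrite scale_lfunE memvZ //.
have /subvP -> // : (limg (vbasis (mhom M X))`_i <= trace)%VS.
  exact: (sumv_sup i).
exact: mem_limg.
Qed.

Lemma vbasis_mhom (i : 'I_(\dim (mhom M X))) :
  (vbasis (mhom M X))`_i \in mhom M X.
Proof. by rewrite vbasis_mem // mem_nth // size_tuple. Qed.

Lemma trace_sub (V : {vspace X}) :
  (forall f m, f \in mhom M X -> f m \in V) -> (trace <= V)%VS.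
Proof.
move=> fV; apply/subv_sumP => i _; apply/subvP=> _ /limgP[m ->].
exact/fV/vbasis_mhom.
Qed.
End Trace.

Section Closure.
Variables (K : fieldType) (A : falgType K).
Implicit Types (X Y Z D M : fmod A) (S T W : subcat A).

Definition quotient_closed W T := forall X Y (f : 'Hom(X, Y)),
  surjective_hom f -> T X -> W Y -> T Y.

(** Induction on n: the kernel of the projection to the first summand is a direct sum of the others,
    so D is an extension of two modules in S. *)
Lemma dirsum_closed S n (Y : 'I_n -> fmod A) D : extension_closed S ->
  (forall Z, zero_mod Z -> S Z) -> (forall i, S (Y i)) -> is_dirsum Y D -> S D.
Proof.
move=> Sext S0; elim: n => [|n IHn] in Y D *.
  move=> _ [inj [proj [_ _ _]]]; rewrite big_ord0 => id0; apply: S0 => x.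
  by rewrite -[x]id_lfunE -id0 zero_lfunE.
move=> SY [inj [proj [homs pi1 pi0 sum1]]].
have pi1E i x : proj i (inj i x) = x by rewrite -comp_lfunE pi1 id_lfunE.
have pi0E i j x : i != j -> proj j (inj i x) = 0.
  by move=> ij; rewrite -comp_lfunE pi0 // zero_lfunE.
have p0P : proj ord0 \in mhom D (Y ord0) by case: (homs ord0).
have [Z [i [[iP i0] iV]]] := kernel_exists p0P.
have iI x y : i x = i y -> x = y by apply: lker_sub_inj.
have exinj (j : 'I_n) : exists h : 'Hom(Y (lift ord0 j), Z),
    h \in mhom _ Z /\ forall y, inj (lift ord0 j) y = i (h y).
  have [ijP _] := homs (lift ord0 j).
  have [y|h] := factor_inj (conj iP i0) ijP; last by move=> hP hq; exists h.
  apply/limgP; rewrite iV; apply/lkerP.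
  by rewrite pi0E // eq_sym neq_lift.
pose inj' j := projT1 (cid (exinj j)).
have inj'P j : inj' j \in mhom _ Z /\ forall y, inj (lift ord0 j) y = i (inj' j y).
  exact: (projT2 (cid (exinj j))).
apply: (Sext _ _ _ i (proj ord0)); last exact: SY.
  split=> //; apply/surj_homP; split=> // y.
  by exists (inj ord0 y); rewrite pi1E.
apply: (IHn (fun j => Y (lift ord0 j))) => [j|]; first exact: SY.
exists inj', (fun j => (proj (lift ord0 j) \o i)%VF); split=> [j|j|j k|].
- have [h1 h2] := inj'P j; split=> //; apply: mhom_comp => //.
  by case: (homs (lift ord0 j)).
- apply/lfunP=> x; rewrite !comp_lfunE id_lfunE.
  by have [_ <-] := inj'P j; rewrite pi1E.
- move=> jk; apply/lfunP=> x; rewrite !comp_lfunE zero_lfunE.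
  have [_ <-] := inj'P j; rewrite pi0E //.
apply/lfunP=> z; apply: iI; rewrite id_lfunE sum_lfunE linear_sum /=.
rewrite -[RHS]id_lfunE -sum1 sum_lfunE big_ord_recl comp_lfunE.
have -> : proj ord0 (i z) = 0 by apply/lkerP; rewrite -iV mem_limg.
rewrite linear0 add0r; apply: eq_bigr => j _.
by rewrite !comp_lfunE; have [_ <-] := inj'P j.
Qed.

Section Wide.
Variable W : subcat A.
Hypothesis wideW : wide W.

Lemma wide_iso X Y : isomorphic X Y -> W X -> W Y.
Proof. by case: wideW => iso _ _ _; apply: iso. Qed.

Lemma wide_kernel X Y Z (f : 'Hom(X, Y)) (i : 'Hom(Z, X)) :
  f \in mhom X Y -> is_kernel f i -> W X -> W Y -> W Z.
Proof. by case: wideW => _ ker _ _; apply: ker. Qed.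

Lemma wide_cokernel X Y Z (f : 'Hom(X, Y)) (q : 'Hom(Y, Z)) :
  f \in mhom X Y -> is_cokernel f q -> W X -> W Y -> W Z.
Proof. by case: wideW => _ _ coker _; apply: coker. Qed.

Lemma wide_ext : extension_closed W.
Proof. by case: wideW. Qed.

(** A zero module is a kernel of the identity of X. *)
Lemma wide_zero X Z : W X -> zero_mod Z -> W Z.
Proof.
move=> WX Z0; apply: (@wide_kernel X X Z \1%VF 0) => //; first exact: mhom1.
split; first by apply/inj_homP; split=> [|x _]; [apply: mem0v | apply: Z0].
apply/vspaceP=> x; apply/limgP/lkerP => [[z ->]|].
  by rewrite zero_lfunE linear0.
by rewrite id_lfunE => ->; exists 0; rewrite linear0.
Qed.

(** The image is the kernel of the cokernel. *)
Lemma wide_image X Y Z (f : 'Hom(X, Y)) (i : 'Hom(Z, Y)) :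
  f \in mhom X Y -> injective_hom i -> limg i = limg f -> W X -> W Y -> W Z.
Proof.
move=> fP iP iV WX WY; have [C [q [qs qk]]] := cokernel_exists fP.
have WC : W C by apply: (wide_cokernel fP _ WX WY); split; [exact: qs | exact: qk].
by apply: (@wide_kernel Y C Z q i); rewrite // /is_kernel ?iV ?qk //; case: qs.
Qed.

Lemma wide_dirsum n (Y : 'I_n -> fmod A) D X :
  W X -> (forall i, W (Y i)) -> is_dirsum Y D -> W D.
Proof.
move=> WX; apply: dirsum_closed; first exact: wide_ext.
by move=> Z; apply: wide_zero WX.
Qed.

Lemma tors_sub T X : tors W T -> T X -> W X.
Proof. by case=> TW _ _ _; apply: TW. Qed.

Lemma tors_ext T : tors W T -> extension_closed T.
Proof. by case. Qed.

Lemma dirsum1 Y : is_dirsum (fun _ : 'I_1 => Y) Y.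
Proof.
exists (fun _ => \1%VF), (fun _ => \1%VF).
split=> [i|i|i j|]; rewrite ?comp_lfun1l ?big_ord1 //.
  by split; apply: mhom1.
by rewrite !ord1 eqxx.
Qed.

Lemma tors_quotient T : tors W T -> quotient_closed W T.
Proof.
move=> [_ _ _ TE] X Y f fs TX WY; rewrite TE; split=> //.
by exists 1, (fun _ => X), X, f; split=> //; apply: dirsum1.
Qed.

Lemma dirsum0 (Y : 'I_0 -> fmod A) Z : zero_mod Z -> is_dirsum Y Z.
Proof.
move=> Z0; exists (fun i => 0), (fun i => 0); split=> [[]|[]|[]|] //.
by apply/lfunP=> z; rewrite [z]Z0 !linear0.
Qed.

Lemma tors_zero T X Z : tors W T -> W X -> zero_mod Z -> T Z.
Proof.
move=> [_ _ _ ->] WX Z0; split; first exact: wide_zero WX Z0.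
have Y : 'I_0 -> fmod A by case.
exists 0, Y, Z, \1%VF; split; [by case | exact: dirsum0 | ].
by apply/surj_homP; split=> [|z]; [apply: mhom1 | exists z; rewrite id_lfunE].
Qed.

Lemma tors_iso T X Y : tors W T -> isomorphic X Y -> T X -> T Y.
Proof. by case=> _ iso _ _; apply: iso. Qed.

(** A finite direct sum is an iterated extension, so closure under extensions and quotients already
    absorbs [GenS W T]. *)
Lemma tors_intro T : (forall X, T X -> W X) -> extension_closed T ->
  quotient_closed W T -> (forall Z, zero_mod Z -> T Z) -> tors W T.
Proof.
move=> TW Text Tq T0; split=> //.
  move=> X Y XY TX; have [f [fi fs]] := XY.
  by apply: (Tq _ _ f fs TX); apply: wide_iso XY (TW _ TX).
apply: subcat_ext => X; split=> [TX|[WX [n [Y [D [f [TY DY fs]]]]]]].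
  split; first exact: TW.
  exists 1, (fun _ => X), X, \1%VF; split=> //; first exact: dirsum1.
  by apply/surj_homP; split=> [|x]; [apply: mhom1 | exists x; rewrite id_lfunE].
exact: (Tq _ _ f fs (dirsum_closed Text T0 TY DY) WX).
Qed.

Lemma mhom0P X Y : mhom X Y = 0%VS <->
  forall f : 'Hom(X, Y), f \in mhom X Y -> forall x, f x = 0.
Proof.
split=> [h0 f|h0]; first by rewrite h0 memv0 => /eqP -> x; rewrite zero_lfunE.
apply/eqP; rewrite -subv0; apply/subvP=> f /h0 f0; rewrite memv0.
by apply/eqP/lfunP=> x; rewrite f0 zero_lfunE.
Qed.

Lemma lperp_tors N X0 : W X0 -> tors W (lperp W N).
Proof.
move=> WX0; apply: tors_intro => [X []//|X Y Z f g [fi gs fg] [WX HX] [WZ HZ]||Z Z0].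
- split; first by apply: (wide_ext _ WX WZ); split; [exact: fi | exact: gs | exact: fg].
  apply/mhom0P=> h hP; have /mhom0P{}HX := HX; have /mhom0P{}HZ := HZ.
  have [fP _] := fi; have [y|k kP hk] := factor_surj gs hP.
    move/lkerP; rewrite -fg => /limgP[x ->]; rewrite -comp_lfunE HX //.
    exact: mhom_comp.
  by move=> x; rewrite hk HZ.
- move=> X Y f fs [WX HX] WY; split=> //; apply/mhom0P=> h hP y.
  have /mhom0P{}HX := HX; have /surj_homP[fP ff] := fs.
  by have [x <-] := ff y; rewrite -comp_lfunE HX //; apply: mhom_comp.
split; first exact: wide_zero WX0 Z0.
by apply/mhom0P=> h hP x; rewrite [x]Z0 linear0.
Qed.

(** The torsion class generated by S. The conjunct [W X] keeps it inside W even if no torsion class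
    contains S. *)
Definition Tgen S : subcat A := fun X =>
  W X /\ forall T, tors W T -> (forall Y, S Y -> T Y) -> T X.

Lemma Tgen_tors S X0 : W X0 -> tors W (Tgen S).
Proof.
move=> WX0; apply: tors_intro => [Y []//|X1 Y Z f g fg [WX1 X1S] [WZ ZS]||Z Z0].
- split; first exact: wide_ext fg WX1 WZ.
  by move=> T tT ST; apply: (tors_ext tT fg); [apply: X1S | apply: ZS].
- move=> X1 Y f fs [WX1 X1S] WY; split=> // T tT ST.
  exact: (tors_quotient tT fs (X1S _ tT ST)).
split; first exact: wide_zero WX0 Z0.
by move=> T tT _; apply: tors_zero WX0 Z0.
Qed.

Lemma Tgen_min S T : tors W T -> (forall Y, S Y -> T Y) -> incl (Tgen S) T.
Proof. by move=> tT ST X [_]; apply. Qed.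

Lemma Tgen_sub S Y : (forall X, S X -> W X) -> S Y -> Tgen S Y.
Proof. by move=> SW SY; split=> [|T _]; [apply: SW | apply]. Qed.

Lemma Tgen_join (X : subcat A -> Prop) X0 : W X0 -> (forall T, X T -> tors W T) ->
  is_join (tors W) X (Tgen (fun Y => exists2 T, X T & T Y)).
Proof.
move=> WX0 tX; split=> [|T XT Y TY|T tT XT]; first exact: Tgen_tors WX0.
  apply: Tgen_sub => [Z [T' XT']|]; last by exists T.
  exact/tors_sub/tX.
by apply: Tgen_min => // Y [T' XT' T'Y]; apply: (XT T').
Qed.

(** A basis of Hom(M, X) assembles into a map from a power of M onto the trace. *)
Lemma GenP M X : Gen W M X <-> W X /\ trace M X = fullv.
Proof.
split=> [[WX [n [Y [D [f [YM [inj [proj [homs _ _ sum1]]] fs]]]]]]|[WX tX]].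
  split=> //; apply/vspaceP=> x; rewrite memvf.
  have /surj_homP[fP /(_ x)[d <-]] := fs.
  rewrite -[d]id_lfunE -sum1 sum_lfunE linear_sum /=; apply: memv_suml => i _.
  rewrite comp_lfunE -comp_lfunE; have [ijP _] := homs i.
  have : (f \o inj i)%VF \in mhom (Y i) X by apply: mhom_comp.
  by move: (proj i d) (f \o inj i)%VF; rewrite YM => m h; apply: mem_trace.
split=> //; have [D DM] := power_exists M (\dim (mhom M X)).
have [inj [proj [homs p1 p0 sum1]]] := DM.
pose b (i : 'I_(\dim (mhom M X))) := (vbasis (mhom M X))`_i.
pose f := \sum_i (b i \o proj i)%VF.
exists (\dim (mhom M X)), (fun _ => M), D, f; split=> //.
apply/surj_homP; split.
  apply: memv_suml => i _; apply: mhom_comp; last exact: vbasis_mhom.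
  by case: (homs i).
move=> x; have : x \in trace M X by rewrite tX memvf.
case/memv_sumP=> xs xsP ->.
have /choice[m mP] : forall i : 'I_(\dim (mhom M X)), exists m, xs i = b i m.
  by move=> i; apply/limgP; apply: xsP.
exists (\sum_i inj i (m i)); rewrite sum_lfunE; apply: eq_bigr => i _.
rewrite mP comp_lfunE linear_sum (bigD1 i) //= big1 ?addr0.
  by rewrite -[proj i _]comp_lfunE p1 id_lfunE.
by move=> j ji; rewrite -comp_lfunE p0 // zero_lfunE.
Qed.

Lemma Gen_sub M T : W M -> tors W T -> T M -> incl (Gen W M) T.
Proof.
move=> WM tT TM X [WX [n [Y [D [f [YM DY fs]]]]]].
apply: (tors_quotient tT fs _ WX).
apply: dirsum_closed DY; [exact: tors_ext tT | | by move=> i; rewrite YM].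
by move=> Z; apply: tors_zero WM.
Qed.

Lemma Gen_quotient M : quotient_closed W (Gen W M).
Proof.
move=> X Y f fs /GenP[WX tX] WY; apply/GenP; split=> //.
apply/vspaceP=> y; rewrite memvf; have /surj_homP[fP /(_ y)[x <-]] := fs.
have : x \in trace M X by rewrite tX memvf.
rewrite memv_preim; move: x; apply/subvP/trace_sub => g m gP.
by rewrite -memv_preim -comp_lfunE mem_trace //; apply: mhom_comp.
Qed.

Lemma Gen_rperp M X : Gen W M X -> rperp W M X -> zero_mod X.
Proof.
move=> /GenP[_ tX] [_ /mhom0P M0] x; apply/eqP; rewrite -memv0.
have : x \in trace M X by rewrite tX memvf.
by apply/subvP: x; apply: trace_sub => f m fP; rewrite M0 ?mem0v.
Qed.

End Wide.
End Closure.

(** * Endomorphisms of an indecomposable module *)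

Section Postcomposition.
Variables (K : fieldType) (U V W : vectType K) (e : 'Hom(V, W)).

Fact comp_lfun_is_linear : linear (comp_lfun e : 'Hom(U, V) -> 'Hom(U, W)).
Proof. by move=> k f g; rewrite comp_lfunDr -comp_lfunZr. Qed.
HB.instance Definition _ := GRing.isLinear.Build K 'Hom(U, V) 'Hom(U, W) _
  (comp_lfun e) comp_lfun_is_linear.
End Postcomposition.

Section Endomorphisms.
Variables (K : fieldType) (A : falgType K).
Implicit Types (X Y Z M : fmod A).

Lemma dirsumE (I : finType) (Y : I -> fmod A) X : is_dirsum Y X ->
  exists (inj : forall i, 'Hom(Y i, X)) (proj : forall i, 'Hom(X, Y i)),
    [/\ forall i, inj i \in mhom (Y i) X /\ proj i \in mhom X (Y i),
        forall i y, proj i (inj i y) = y,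
        forall i j y, i != j -> proj j (inj i y) = 0 &
        forall x, x = \sum_i inj i (proj i x)].
Proof.
move=> [inj [proj [homs pi1 pi0 sum1]]]; exists inj, proj; split=> //.
- by move=> i y; rewrite -comp_lfunE pi1 id_lfunE.
- by move=> i j y ij; rewrite -comp_lfunE pi0 // zero_lfunE.
move=> x; rewrite -{1}[x]id_lfunE -sum1 sum_lfunE.
by apply: eq_bigr => i _; rewrite comp_lfunE.
Qed.

(** Choose n so that h^(n+1) has least rank. Then g and g o g have the same image, and X is the
    direct sum of the image and the kernel of g, which is what the last two clauses encode. The
    exponent is positive so that g factors through h on either side. *)
Lemma fitting X (h : 'End(X)) : h \in mhom X X -> exists n (g : 'End(X)),
  [/\ g \in mhom X X, forall x, g x = iter n.+1 h x,
      forall x, g (g x) = 0 -> g x = 0 & forall x, exists y, g x = g (g y)].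
Proof.
move=> hP; pose p n := iter n (comp_lfun h) \1%VF.
have pE n x : p n x = iter n h x.
  by elim: n => [|n IHn] /=; rewrite ?id_lfunE // comp_lfunE IHn.
have pP n : p n \in mhom X X.
  by elim: n => [|n IHn] /=; [apply: mhom1 | apply: mhom_comp].
have [n nmin] : exists n, forall m,
    (\dim (limg (p n.+1)) <= \dim (limg (p m.+1)))%N.
  have ex : exists d, `[< exists n, \dim (limg (p n.+1)) = d >].
    by exists (\dim (limg (p 1))); apply/asboolP; exists 0.
  case: (ex_minnP ex) => d /asboolP[n <-] dmin; exists n => m.
  by apply: dmin; apply/asboolP; exists m.
pose g := p n.+1; have gE x : g x = iter n.+1 h x by apply: pE.
have gg x : g (g x) = p (n.+1 + n).+1%N x by rewrite !gE pE -iterD addnS.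
have sub : (limg (g \o g) <= limg g)%VS.
  by apply/subvP=> _ /limgP[x ->]; rewrite comp_lfunE mem_limg.
have ggE : limg (g \o g)%VF = limg g.
  apply/eqP; rewrite eqEdim sub /=.
  have -> : (g \o g)%VF = p (n.+1 + n).+1%N by apply/lfunP=> x; rewrite comp_lfunE gg.
  exact: nmin.
exists n, g; split=> //; first exact: pP.
  have := limg_ker_dim g (limg g); rewrite -limg_comp ggE.
  move=> /eqP; rewrite -[X in _ == X]add0n eqn_add2r dimv_eq0 => /eqP c0 x ggx.
  by apply/eqP; rewrite -memv0 -c0 memv_cap mem_limg; apply/lkerP.
move=> x; have /limgP[y ->] : g x \in limg (g \o g)%VF by rewrite ggE mem_limg.
by exists y; rewrite comp_lfunE.
Qed.

(** The bridge from decompositions into stable subspaces to the external direct sums over [bool] in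
    [indecomposable]; the projections come from [daddv_pi]. *)
Lemma indec_split M (V1 V2 : {vspace M}) : indecomposable M ->
  (forall a x, x \in V1 -> mact M a x \in V1) ->
  (forall a x, x \in V2 -> mact M a x \in V2) ->
  (V1 :&: V2 = 0)%VS -> (V1 + V2 = fullv)%VS -> V1 = 0%VS \/ V2 = 0%VS.
Proof.
move=> [M0 Mdec] st1 st2 cap sum.
have [Z1 [i1 [[i1P i10] iV1]]] := submodule_exists st1.
have [Z2 [i2 [[i2P i20] iV2]]] := submodule_exists st2.
have dec x : exists z1 z2, x = i1 z1 + i2 z2.
  have /memv_addP[v1 v1P [v2 v2P ->]] : x \in (V1 + V2)%VS by rewrite sum memvf.
  move: v1P v2P; rewrite -iV1 -iV2 => /limgP[z1 ->] /limgP[z2 ->].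
  by exists z1, z2.
have uniq z1 z2 : i1 z1 + i2 z2 = 0 -> z1 = 0 /\ z2 = 0.
  move=> e; have i12 : i1 z1 = i2 (- z2).
    by apply/eqP; rewrite linearN /= -addr_eq0 e.
  have i1z : i1 z1 = 0.
    apply/eqP; rewrite -memv0 -cap memv_cap -iV1 mem_limg /= i12 -iV2.
    exact: mem_limg.
  split; first exact: (iffLR (lker0_eqP _) i10).
  by apply: (iffLR (lker0_eqP _) i20); move: e; rewrite i1z add0r.
pose pi1 := daddv_pi V1 V2; pose pi2 := daddv_pi V2 V1.
have piE z1 z2 : pi1 (i1 z1 + i2 z2) = i1 z1 /\ pi2 (i1 z1 + i2 z2) = i2 z2.
  have := daddv_pi_add cap (w := i1 z1 + i2 z2).
  rewrite sum memvf => /(_ isT).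
  have : pi1 (i1 z1 + i2 z2) \in limg i1 by rewrite iV1 memv_pi.
  have : pi2 (i1 z1 + i2 z2) \in limg i2 by rewrite iV2 memv_pi.
  rewrite -/pi1 -/pi2 => /limgP[y2 ->] /limgP[y1 ->] e.
  have [] := uniq (y1 - z1) (y2 - z2).
    by rewrite !linearB /= addrACA e -opprD subrr.
  by move=> /eqP; rewrite subr_eq0 => /eqP -> /eqP; rewrite subr_eq0 => /eqP ->.
have p1P : pi1 \in mhom M M.
  apply/mhomP=> a x; have [z1 [z2 ->]] := dec x.
  rewrite [mact M a (_ + _)]linearD /= -(mhomE _ _ i1P) -(mhomE _ _ i2P).
  by rewrite !(proj1 (piE _ _)) (mhomE _ _ i1P).
have p2P : pi2 \in mhom M M.
  apply/mhomP=> a x; have [z1 [z2 ->]] := dec x.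
  rewrite [mact M a (_ + _)]linearD /= -(mhomE _ _ i1P) -(mhomE _ _ i2P).
  by rewrite !(proj2 (piE _ _)) (mhomE _ _ i2P).
have [x|r1 r1P r1E] := factor_inj (conj i1P i10) p1P.
  by apply/limgP; rewrite iV1 memv_pi.
have [x|r2 r2P r2E] := factor_inj (conj i2P i20) p2P.
  by apply/limgP; rewrite iV2 memv_pi.
have rE z1 z2 : r1 (i1 z1 + i2 z2) = z1 /\ r2 (i1 z1 + i2 z2) = z2.
  split; first by apply: (lker_sub_inj i10); rewrite -r1E (proj1 (piE _ _)).
  by apply: (lker_sub_inj i20); rewrite -r2E (proj2 (piE _ _)).
pose Y b := if b then Z1 else Z2.
have [|[] Z0] := Mdec Y; last 2 first.
- left; apply/eqP; rewrite -subv0 -iV1; apply/subvP=> _ /limgP[z ->].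
  by rewrite [z]Z0 linear0 mem0v.
- right; apply/eqP; rewrite -subv0 -iV2; apply/subvP=> _ /limgP[z ->].
  by rewrite [z]Z0 linear0 mem0v.
pose inj b : 'Hom(Y b, M) := match b with true => i1 | false => i2 end.
pose proj b : 'Hom(M, Y b) := match b with true => r1 | false => r2 end.
have r11 z : r1 (i1 z) = z by have := proj1 (rE z 0); rewrite linear0 addr0.
have r21 z : r2 (i1 z) = 0 by have := proj2 (rE z 0); rewrite linear0 addr0.
have r12 z : r1 (i2 z) = 0 by have := proj1 (rE 0 z); rewrite linear0 add0r.
have r22 z : r2 (i2 z) = z by have := proj2 (rE 0 z); rewrite linear0 add0r.
exists inj, proj; split=> [[]|[]|[] []|] //.
- by apply/lfunP=> z; rewrite comp_lfunE id_lfunE; apply: r11.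
- by apply/lfunP=> z; rewrite comp_lfunE id_lfunE; apply: r22.
- by move=> _; apply/lfunP=> z; rewrite comp_lfunE zero_lfunE; apply: r21.
- by move=> _; apply/lfunP=> z; rewrite comp_lfunE zero_lfunE; apply: r12.
apply/lfunP=> x; rewrite big_bool /= add_lfunE !comp_lfunE id_lfunE.
by have [z1 [z2 ->]] := dec x; have [-> ->] := rE z1 z2.
Qed.

Section Indecomposable.
Variable M : fmod A.
Hypothesis indecM : indecomposable M.

(** One of the two Fitting summands of M for h must vanish. *)
Lemma indec_inj_or_nil (h : 'End(M)) : h \in mhom M M ->
  lker h = 0%VS \/ exists n, forall x, iter n h x = 0.
Proof.
move=> hP; have [n [g [gP gE gg0 ggE]]] := fitting hP.
have h0 m : iter m h 0 = 0 by elim: m => //= m ->; rewrite linear0.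
have [|||| |] := @indec_split M (limg g) (lker g) indecM.
- by move=> a x; apply: limg_stable.
- by move=> a x /lkerP gx; apply/lkerP; rewrite mhomE // gx linear0.
- apply/eqP; rewrite -subv0; apply/subvP=> x; rewrite memv_cap memv0.
  by move=> /andP[/limgP[y ->] /lkerP/gg0 ->].
- apply/vspaceP=> x; rewrite memvf; have [y gy] := ggE x.
  rewrite -[x](subrK (g y)) addrC; apply: memv_add; first exact: mem_limg.
  by apply/lkerP; rewrite linearB /= gy subrr.
- move=> g0; right; exists n.+1 => x; rewrite -gE; apply/eqP.
  by rewrite -memv0 -g0 mem_limg.
move=> g0; left; apply/lker0_eqP=> x hx; apply: (iffLR (lker0_eqP _) g0).
by rewrite gE iterSr hx.
Qed.

(* Hom(M, Y) is a right module over the local algebra End(M), whose radical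
   consists of the f with nonzero kernel: e lies in its socle. *)
Lemma socle_mhom Y (e0 : 'Hom(M, Y)) : e0 \in mhom M Y -> e0 <> 0 ->
  exists e : 'Hom(M, Y), [/\ e \in mhom M Y, e <> 0 &
    forall f x, f \in mhom M M -> lker f <> 0%VS -> e (f x) = 0].
Proof.
move=> e0P e0n.
(* [d e] is the dimension of the cyclic End(M)-submodule generated by e. A nonzero e with least
   [d e] generates a simple submodule. *)
pose d (e : 'Hom(M, Y)) := \dim (linfun (comp_lfun e) @: mhom M M)%VS.
have ex : exists n, `[< exists e, [/\ e \in mhom M Y, e <> 0 & d e = n] >].
  by exists (d e0); apply/asboolP; exists e0.
case: (ex_minnP ex) => n /asboolP[e [eP en <-]] dmin; exists e; split=> // f x fP f0.
suff ef0 : (e \o f)%VF = 0 by rewrite -comp_lfunE ef0 zero_lfunE.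
apply: contrapT => efn; have efP : (e \o f)%VF \in mhom M Y by apply: mhom_comp.
have sub : (linfun (comp_lfun (e \o f)%VF) @: mhom M M <=
            linfun (comp_lfun e) @: mhom M M)%VS.
  apply/subvP=> _ /memv_imgP[g gP ->]; rewrite lfunE /= -comp_lfunA.
  rewrite -[(e \o _)%VF](lfunE (comp_lfun e)) memv_img //.
  exact: mhom_comp.
have : e \in (linfun (comp_lfun (e \o f)%VF) @: mhom M M)%VS.
  have /eqP -> : (linfun (comp_lfun (e \o f)%VF) @: mhom M M)%VS ==
                 (linfun (comp_lfun e) @: mhom M M)%VS.
    by rewrite eqEdim sub; apply: dmin; apply/asboolP; exists (e \o f)%VF.
  rewrite -{1}[e]comp_lfun1r -(lfunE (comp_lfun e)) memv_img //; exact: mhom1.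
case/memv_imgP=> g gP; rewrite lfunE /= => eE.
(* Now e = e f g. If f g were injective, f would be an automorphism; so f g is nilpotent, and
   iterating the identity gives e = 0. *)
have fgP : (f \o g)%VF \in mhom M M by apply: mhom_comp.
have [fg0|[m nil]] := indec_inj_or_nil fgP.
  apply/f0/end_surj_inj/limg_fullP=> y.
  have /limg_fullP/(_ y)[z <-] := iffRL (end_surj_inj _) fg0.
  by exists (g z); rewrite comp_lfunE.
apply: en; apply/lfunP=> y; rewrite zero_lfunE -(linear0 e) -(nil y).
elim: m {nil} => //= m ->.
by rewrite {1}eE !comp_lfunE.
Qed.

(** Serves to refute that M is a sum of images of radical endomorphisms: e would vanish on all of
    M. *)
Lemma socle_end : exists e : 'End(M), [/\ e \in mhom M M, e <> 0 &
  forall f x, f \in mhom M M -> lker f <> 0%VS -> e (f x) = 0].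
Proof.
apply: (socle_mhom (mhom1 M)) => e; case: indecM => M0 _; apply: M0 => m.
by rewrite -[m]id_lfunE e zero_lfunE.
Qed.
End Indecomposable.
End Endomorphisms.

(** * Rigid presentations *)

Section Projective.
Variables (K : fieldType) (A : falgType K) (W : subcat A).
Hypothesis wideW : wide W.
Implicit Types (X Y Z P : fmod A).

Lemma projective_lift P X Y (g : 'Hom(X, Y)) (f : 'Hom(P, Y)) :
  projective_in W P -> W X -> W Y -> surjective_hom g -> f \in mhom P Y ->
  exists2 h, h \in mhom P X & forall p, f p = g (h p).
Proof.
move=> [_ pP] WX WY gs fP; have [h hP <-] := pP X Y g f WX WY gs fP.
by exists h => // p; rewrite comp_lfunE.
Qed.

(** Corestrict g to its image, which lies in W. *)
Lemma projective_lift_image P X Y (g : 'Hom(X, Y)) (f : 'Hom(P, Y)) :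
  projective_in W P -> W X -> W Y -> g \in mhom X Y -> f \in mhom P Y ->
  (forall p, exists x, f p = g x) ->
  exists2 h, h \in mhom P X & forall p, f p = g (h p).
Proof.
move=> pP WX WY gP fP fg.
have [Z [i [iI iV]]] : exists (Z : fmod A) (i : 'Hom(Z, Y)),
    injective_hom i /\ limg i = limg g.
  by apply: submodule_exists => a y; apply: limg_stable.
have WZ : W Z by apply: wide_image iV WX WY.
have [x|g' g'P gE] := factor_inj iI gP.
  by apply/limgP; rewrite iV mem_limg.
have [p|f' f'P fE] := factor_inj iI fP.
  by have [x ->] := fg p; apply/limgP; rewrite iV mem_limg.
have g's : surjective_hom g'.
  apply/surj_homP; split=> // z; have /limgP[x ix] : i z \in limg g.
    by rewrite -iV mem_limg.
  by exists x; case: iI => _ i0; apply: (lker_sub_inj i0); rewrite -gE.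
have [h hP hE] := projective_lift pP WX WZ g's f'P.
by exists h => // p; rewrite fE hE gE.
Qed.
End Projective.

(* Minimality is stated as it is used: chain endomorphisms of the presentation
   that cover an automorphism of M are automorphisms. *)
Record rigid_presentation (K : fieldType) (A : falgType K) (W : subcat A)
    (M Q1 Q0 : fmod A) (q1 : 'Hom(Q1, Q0)) (q0 : 'Hom(Q0, M)) : Prop := {
  rp_M : W M;
  rp_Q1 : projective_in W Q1;
  rp_Q0 : projective_in W Q0;
  rp_q1 : q1 \in mhom Q1 Q0;
  rp_q0 : surjective_hom q0;
  rp_exact : limg q1 = lker q0;
  rp_minimal : forall (a : 'End(M)) (s : 'End(Q0)) (t : 'End(Q1)),
    a \in mhom M M -> s \in mhom Q0 Q0 -> t \in mhom Q1 Q1 ->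
    (forall x, q0 (s x) = a (q0 x)) -> (forall x, q1 (t x) = s (q1 x)) ->
    lker a = 0%VS -> lker s = 0%VS /\ lker t = 0%VS;
  rp_rigid : forall f, f \in mhom Q1 M ->
    exists2 h, h \in mhom Q0 M & forall x, f x = h (q1 x)
}.

Section Presentation.
Variables (K : fieldType) (A : falgType K) (W : subcat A).
Hypothesis wideW : wide W.
Variables (M Q1 Q0 : fmod A) (q1 : 'Hom(Q1, Q0)) (q0 : 'Hom(Q0, M)).
Hypothesis pres : rigid_presentation W q1 q0.
Implicit Types (X Y Z : fmod A).

(* By the Auslander-Reiten formulas, this is lperp W (tau W M) for a minimal
   projective presentation of M. *)
Definition extorth : subcat A := fun X => W X /\
  forall f, f \in mhom Q1 X ->
    exists2 h, h \in mhom Q0 X & forall x, f x = h (q1 x).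

Let WM := rp_M pres.
Let pQ1 := rp_Q1 pres.
Let pQ0 := rp_Q0 pres.
Let q1P := rp_q1 pres.
Let q0s := rp_q0 pres.
Let q1V := rp_exact pres.
Let q0P : q0 \in mhom Q0 M. Proof. by case: q0s. Qed.

Lemma q0q1 x : q0 (q1 x) = 0.
Proof. by apply/lkerP; rewrite -q1V mem_limg. Qed.

Lemma q0_ker x : q0 x = 0 -> exists y, x = q1 y.
Proof. by move/lkerP; rewrite -q1V => /limgP. Qed.

(** For an extension, lift the factorisation over Z along g, using that Q0 is projective; the error
    term lands in X, where it factors again. For a quotient, first lift the map from Q1, which is
    projective as well. *)
Lemma extorth_tors : tors W extorth.
Proof.
apply: tors_intro => // [X []//|X Y Z f g fg [WX HX] [WZ HZ]||Z Z0].
- split; first exact: (wide_ext wideW fg WX WZ).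
  move=> h hP; have [fi gs fgV] := fg; have [gP _] := gs; have [fP _] := fi.
  have WY : W Y by apply: (wide_ext wideW fg WX WZ).
  have [k kP kE] := HZ _ (mhom_comp hP gP).
  have [l lP lE] := projective_lift pQ0 WY WZ gs kP.
  have dP : h - (l \o q1)%VF \in mhom Q1 Y by rewrite memvB // mhom_comp.
  have dE x : (h - (l \o q1)%VF) x = h x - l (q1 x).
    by rewrite add_lfunE opp_lfunE comp_lfunE.
  have [x|d d'P d'E] := factor_inj fi dP.
    apply/limgP; rewrite fgV; apply/lkerP.
    by rewrite dE linearB /= -lE -kE comp_lfunE subrr.
  have [m mP mE] := HX _ d'P.
  exists (l + (f \o m)%VF); first by rewrite memvD // mhom_comp.
  move=> x; rewrite add_lfunE comp_lfunE -mE -d'E dE addrC.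
  by rewrite subrK.
- move=> X Y f fs [WX HX] WY; split=> // h hP; have [fP _] := fs.
  have [k kP kE] := projective_lift pQ1 WX WY fs hP.
  have [l lP lE] := HX _ kP; exists (f \o l)%VF; first exact: mhom_comp.
  by move=> x; rewrite kE lE comp_lfunE.
split; first exact: (wide_zero wideW WM Z0).
by move=> h hP; exists 0 => [|x]; rewrite ?mem0v // [h x]Z0 [RHS]Z0.
Qed.

(** This is the vanishing of Ext^1(M, X). Lift f q0 to Q0 -> Y, correct the lift by a map Q0 -> X so
    that it kills the image of q1, and descend to M. *)
Lemma ext_projective X Y Z (i : 'Hom(X, Y)) (g : 'Hom(Y, Z)) (f : 'Hom(M, Z)) :
  short_exact i g -> extorth X -> W Z -> f \in mhom M Z ->
  exists2 h, h \in mhom M Y & forall m, f m = g (h m).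
Proof.
move=> ig [WX HX] WZ fP; have [ii gs igV] := ig.
have WY : W Y by apply: (wide_ext wideW ig WX WZ).
have [gP _] := gs; have [iP _] := ii.
have [k kP kE] := projective_lift pQ0 WY WZ gs (mhom_comp q0P fP).
have [x|d dP dE] := factor_inj ii (mhom_comp q1P kP).
  apply/limgP; rewrite igV; apply/lkerP.
  by rewrite comp_lfunE -kE comp_lfunE q0q1 linear0.
have [l lP lE] := HX _ dP.
have eP : k - (i \o l)%VF \in mhom Q0 Y by rewrite memvB // mhom_comp.
have eE x : (k - (i \o l)%VF) x = k x - i (l x).
  by rewrite add_lfunE opp_lfunE comp_lfunE.
have [x|h hP hE] := factor_surj q0s eP.
  by move=> /q0_ker[y ->]; rewrite eE -lE -dE comp_lfunE subrr.
exists h => // m; have /surj_homP[_ /(_ m)[x <-]] := q0s.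
rewrite -hE eE linearB /= -kE comp_lfunE.
suff -> : g (i (l x)) = 0 by rewrite subr0.
by apply/lkerP; rewrite -igV mem_limg.
Qed.

Lemma extorth_M : extorth M.
Proof. by split; [exact: rp_M pres | exact: rp_rigid pres]. Qed.

Lemma Gen_extorth X : Gen W M X -> extorth X.
Proof. exact: (Gen_sub wideW WM extorth_tors extorth_M). Qed.

(** Only extensions need an argument: maps M -> Z lift to Y by [ext_projective], so the trace of M
    in Y covers Z and contains X. *)
Lemma Gen_tors : tors W (Gen W M).
Proof.
apply: tors_intro => // [X []//|X Y Z f g fg GX GZ||Z Z0]; last 2 first.
- exact: Gen_quotient.
- apply/GenP; split; first exact: (wide_zero wideW WM Z0).
  by apply/vspaceP=> z; rewrite memvf [z]Z0 mem0v.
have [/GenP[WX tX] /GenP[WZ tZ]] := (GX, GZ).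
have WY : W Y by apply: (wide_ext wideW fg WX WZ).
have [[fP f0] /surj_homP[gP gs] fgV] := fg.
apply/GenP; split=> //; apply/vspaceP=> y; rewrite memvf.
have sX x : f x \in trace M Y.
  have : x \in trace M X by rewrite tX memvf.
  rewrite memv_preim; apply/subvP: x; apply: trace_sub => h m hP.
  by rewrite -memv_preim -comp_lfunE mem_trace // mhom_comp.
have [y' y'P gyy'] : exists2 y', y' \in trace M Y & g y = g y'.
  have : g y \in (g @: trace M Y)%VS; last by case/memv_imgP=> y'; exists y'.
  have : g y \in trace M Z by rewrite tZ memvf.
  apply/subvP: (g y); apply: trace_sub => h m hP.
  have [k kP ->] := ext_projective fg (Gen_extorth GX) WZ hP.
  by rewrite memv_img // mem_trace.
rewrite -[y](subrK y'); apply: memvD => //.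
have /limgP[x ->] : y - y' \in limg f; last exact: sX.
by rewrite fgV; apply/lkerP; rewrite linearB /= gyy' subrr.
Qed.

(** T is the trace of M in X; it lies in W as the image of a power of M. A map M -> F lifts to X,
    where it lands in the trace, so it is zero. *)
Lemma torsion_pair X : W X -> exists (T F : fmod A) (i : 'Hom(T, X))
  (q : 'Hom(X, F)), [/\ short_exact i q, Gen W M T & rperp W M F].
Proof.
move=> WX; have st a x : x \in trace M X -> mact X a x \in trace M X.
  rewrite memv_preim; move: x; apply/subvP/trace_sub => f m fP.
  by rewrite -memv_preim -mhomE // mem_trace.
have [T [i [ii iV]]] := submodule_exists st.
have [D DM] := power_exists M (\dim (mhom M X)).
have WD : W D by apply: (wide_dirsum wideW WM _ DM).
have [inj [proj [homs p1 p0 sum1]]] := dirsumE DM.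
pose b (j : 'I_(\dim (mhom M X))) := (vbasis (mhom M X))`_j.
pose f := \sum_j (b j \o proj j)%VF.
have fP : f \in mhom D X.
  apply: memv_suml => j _; apply: mhom_comp; last exact: vbasis_mhom.
  by case: (homs j).
have fV : limg f = trace M X.
  apply/eqP; rewrite eqEsubv; apply/andP; split.
    apply/subvP=> _ /limgP[d ->]; rewrite sum_lfunE; apply: memv_suml => j _.
    by rewrite comp_lfunE mem_trace // vbasis_mhom.
  apply/subv_sumP=> j _; apply/subvP=> _ /limgP[m ->]; apply/limgP.
  exists (inj j m); rewrite sum_lfunE (bigD1 j) //= big1 ?addr0.
    by rewrite comp_lfunE p1.
  by move=> k kj; rewrite comp_lfunE p0 ?linear0 // eq_sym.
have iP : i \in mhom T X by case: ii.
have WT : W T by apply: (wide_image wideW fP ii _ WD WX); rewrite iV.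
have GT : Gen W M T.
  apply/GenP; split=> //; apply/vspaceP=> t; rewrite memvf.
  have : i t \in (i @: trace M T)%VS.
    have : i t \in trace M X by rewrite -iV mem_limg.
    apply/subvP: (i t); apply: trace_sub => h m hP.
    have [m'|k kP ->] := factor_inj ii hP; last by rewrite memv_img // mem_trace.
    by apply/limgP; rewrite iV mem_trace.
  case/memv_imgP=> t' t'P itt'; case: ii => _ i0.
  by rewrite (lker_sub_inj i0 itt').
have [F [q [qs qV]]] := cokernel_exists iP.
have ex : short_exact i q by split.
have WF : W F by apply: (wide_cokernel wideW iP (q := q)); first split.
exists T, F, i, q; split=> //; split=> //.
apply/mhom0P=> h hP m.
have [k kP ->] := ext_projective ex (Gen_extorth GT) WF hP.
by apply/lkerP; rewrite qV iV mem_trace.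
Qed.
End Presentation.

(** * Bongartz completion *)

Section Bongartz.
Variables (K : fieldType) (A : falgType K) (W : subcat A).
Hypothesis wideW : wide W.
Variables (M Q1 Q0 : fmod A) (q1 : 'Hom(Q1, Q0)) (q0 : 'Hom(Q0, M)).
Hypothesis pres : rigid_presentation W q1 q0.
Implicit Types (X Y Z : fmod A).

Let q1P := rp_q1 pres.
Let WQ1 : W Q1. Proof. by case: (rp_Q1 pres). Qed.
Let WQ0 : W Q0. Proof. by case: (rp_Q0 pres). Qed.
Let q0P : q0 \in mhom Q0 M. Proof. by case: (rp_q0 pres). Qed.

(* The classes of the phi_i generate Hom(Q1, Y) / Hom(Q0, Y) q1 over the chain
   endomorphisms of the presentation. *)
Definition ext_span Y k (phi : 'I_k -> 'Hom(Q1, Y)) :=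
  (forall i, phi i \in mhom Q1 Y) /\
  forall psi, psi \in mhom Q1 Y ->
    exists (t : 'I_k -> 'End(Q1)) (s : 'I_k -> 'End(Q0)) (h : 'Hom(Q0, Y)),
    [/\ forall i, [/\ t i \in mhom Q1 Q1, s i \in mhom Q0 Q0 &
                      forall x, q1 (t i x) = s i (q1 x)],
        h \in mhom Q0 Y &
        forall x, psi x = \sum_i phi i (t i x) + h (q1 x)].

(** Scalars are chain endomorphisms, so a K-basis of Hom(Q1, Y) will do. *)
Lemma ext_span_exists Y : exists k (phi : 'I_k -> 'Hom(Q1, Y)), ext_span phi.
Proof.
exists (\dim (mhom Q1 Y)), (fun i => (vbasis (mhom Q1 Y))`_i); split=> [i|psi psiP].
  exact: vbasis_mhom.
pose c i := coord (vbasis (mhom Q1 Y)) i psi.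
exists (fun i => c i *: \1%VF), (fun i => c i *: \1%VF), 0.
split=> [i||x]; last 1 first.
- rewrite {1}(coord_vbasis psiP) sum_lfunE zero_lfunE addr0.
  by apply: eq_bigr => i _; rewrite !scale_lfunE id_lfunE linearZ.
- by split=> [||x]; rewrite ?memvZ ?mhom1 // !scale_lfunE !id_lfunE linearZ.
exact: mem0v.
Qed.

Lemma ext_span_reduce Y k (phi : 'I_k.+1 -> 'Hom(Q1, Y)) (i : 'I_k.+1)
    (w : 'I_k.+1 -> 'End(Q1)) (z : 'I_k.+1 -> 'End(Q0)) (s0 : 'Hom(Q0, Y)) :
  ext_span phi ->
  (forall j, [/\ w j \in mhom Q1 Q1, z j \in mhom Q0 Q0 &
                 forall x, q1 (w j x) = - z j (q1 x)]) ->
  s0 \in mhom Q0 Y -> (forall x, s0 (q1 x) = \sum_j phi j (w j x)) ->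
  lker (w i) = 0%VS -> lker (z i) = 0%VS ->
  ext_span (fun j => phi (lift i j)).
Proof.
move=> [phiP span] wz s0P s0E wi zi; split=> // psi /span[t [s [h [ts hP psiE]]]].
have [wiP ziP wzi] := wz i; have [tiP siP tsi] := ts i.
have [v [vP wv vw]] : exists v : 'End(Q1),
    [/\ v \in mhom Q1 Q1, cancel (w i) v & cancel v (w i)].
  by apply: bij_inv; split=> //; apply/end_surj_inj.
have [y [yP zy yz]] : exists y : 'End(Q0),
    [/\ y \in mhom Q0 Q0, cancel (z i) y & cancel y (z i)].
  by apply: bij_inv; split=> //; apply/end_surj_inj.
have q1v x : q1 (v x) = - y (q1 x).
  by rewrite -{2}[x]vw wzi linearN /= zy opprK.
exists (fun j => t (lift i j) - (w (lift i j) \o (v \o t i)))%VF.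
exists (fun j => s (lift i j) - (z (lift i j) \o (y \o s i)))%VF.
exists (h - (s0 \o (y \o s i)))%VF; split=> [j||x].
- have [wP zP wzj] := wz (lift i j); have [tP sP tsj] := ts (lift i j).
  split=> [||x]; try by rewrite memvB // !mhom_comp.
  rewrite !add_lfunE !opp_lfunE !comp_lfunE linearB /= tsj wzj q1v tsi.
  by rewrite opprK [z _ _]linearN.
- by rewrite memvB // !mhom_comp.
rewrite psiE (bigD1_ord i) //= add_lfunE opp_lfunE !comp_lfunE.
have -> : phi i (t i x) = s0 (q1 (v (t i x)))
    - \sum_j phi (lift i j) (w (lift i j) (v (t i x))).
  by rewrite s0E (bigD1_ord i) //= vw addrK.
rewrite q1v tsi linearN /=.
under [in RHS]eq_bigr => j _ do
  rewrite add_lfunE opp_lfunE !comp_lfunE linearB /=.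
rewrite sumrB -[LHS]addrA [- _ - _]addrC addrACA; congr (_ + _); exact: addrC.
Qed.

(* Bongartz completion of Y: the pushout of the k-th power of the presentation
   along generators phi_1, .., phi_k of Hom(Q1, Y) / Hom(Q0, Y) q1. Minimality
   of k makes all maps M -> U -> M^k radical. *)
Lemma bongartz Y : W Y -> extorth W q1 Y \/
  exists k (N U : fmod A) (inj : 'I_k.+1 -> 'Hom(M, N))
    (proj : 'I_k.+1 -> 'Hom(N, M)) (al : 'Hom(Y, U)) (be : 'Hom(U, N)),
  [/\ [/\ forall i, inj i \in mhom M N /\ proj i \in mhom N M,
          forall i m, proj i (inj i m) = m,
          forall i j m, i != j -> proj j (inj i m) = 0 &
          forall x, x = \sum_i inj i (proj i x)],
      [/\ al \in mhom Y U, surjective_hom be, forall y, be (al y) = 0 &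
          forall u, be u = 0 -> exists y, u = al y],
      extorth W q1 U /\ W N,
      forall X f, extorth W q1 X -> f \in mhom Y X ->
        exists2 g, g \in mhom U X & forall y, g (al y) = f y &
      forall s i, s \in mhom M U -> lker (proj i \o (be \o s))%VF <> 0%VS].
Proof.
move=> WY.
have ex : exists k, `[< exists phi : 'I_k -> 'Hom(Q1, Y), ext_span phi >].
  by have [k phiP] := ext_span_exists Y; exists k; apply/asboolP.
case: (ex_minnP ex) => -[|k] /asboolP[phi [phiP span]] kmin.
  left; split=> // f /span[t [s [h [_ hP fE]]]]; exists h => // x.
  by rewrite fE big_ord0 add0r.
right; have WM := rp_M pres.
have [P1 P1d] := power_exists Q1 k.+1; have [P0 P0d] := power_exists Q0 k.+1.
have [N Nd] := power_exists M k.+1.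
have WP1 : W P1 by apply: (wide_dirsum wideW WM _ P1d).
have WP0 : W P0 by apply: (wide_dirsum wideW WM _ P0d).
have WN : W N by apply: (wide_dirsum wideW WM _ Nd).
have [j1 [r1 [h1 rj1 rj10 s1]]] := dirsumE P1d.
have [j0 [r0 [h0 rj0 rj00 s0]]] := dirsumE P0d.
have [inj [proj [hN pN pN0 sN]]] := dirsumE Nd.
have j1P i : j1 i \in mhom Q1 P1 by case: (h1 i).
have r1P i : r1 i \in mhom P1 Q1 by case: (h1 i).
have j0P i : j0 i \in mhom Q0 P0 by case: (h0 i).
have r0P i : r0 i \in mhom P0 Q0 by case: (h0 i).
have injP i : inj i \in mhom M N by case: (hN i).
have projP i : proj i \in mhom N M by case: (hN i).
pose Phi := \sum_i (phi i \o r1 i)%VF.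
have PhiP : Phi \in mhom P1 Y by apply: memv_suml => i _; apply: mhom_comp.
have PhiE x : Phi x = \sum_i phi i (r1 i x).
  by rewrite sum_lfunE; apply: eq_bigr => i _; rewrite comp_lfunE.
pose D := \sum_i (j0 i \o (q1 \o r1 i))%VF.
have DP : D \in mhom P1 P0.
  by apply: memv_suml => i _; apply: mhom_comp => //; apply: mhom_comp.
have DE x i : r0 i (D x) = q1 (r1 i x).
  rewrite sum_lfunE linear_sum (bigD1 i) //= big1 ?addr0 => [|j ji].
    by rewrite !comp_lfunE rj0.
  by rewrite !comp_lfunE rj00.
pose C := \sum_i (inj i \o (q0 \o r0 i))%VF.
have CP : C \in mhom P0 N.
  by apply: memv_suml => i _; apply: mhom_comp => //; apply: mhom_comp.
have CE x i : proj i (C x) = q0 (r0 i x).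
  rewrite sum_lfunE linear_sum (bigD1 i) //= big1 ?addr0 => [|j ji].
    by rewrite !comp_lfunE pN.
  by rewrite !comp_lfunE pN0.
have CD x : C (D x) = 0.
  rewrite [LHS]sN big1 // => i _.
  by rewrite CE DE (q0q1 pres) linear0.
have Cker z : C z = 0 -> exists w, z = D w.
  move=> Cz; have /choice[w wE] : forall i, exists w, r0 i z = q1 w.
    by move=> i; apply: (q0_ker pres); rewrite -CE Cz linear0.
  exists (\sum_i j1 i (w i)); rewrite [z]s0 [RHS]s0; apply: eq_bigr => i _.
  rewrite DE wE linear_sum (bigD1 i) //= rj1 big1 ?addr0 // => j ji.
  by rewrite rj10.
have [E [i1 [i2 [p1 [p2 [[i1P i2P p1P p2P] pi1 pi2 dec]]]]]] := pair_exists Y P0.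
have WE : W E.
  apply: (wide_ext wideW (f := i1) (g := p2) _ WY WP0); split.
  - apply/inj_homP; split=> // y iy; have [e _] := pi1 y.
    by rewrite -e iy linear0.
  - by apply/surj_homP; split=> // z; exists (i2 z); case: (pi2 z).
  apply/vspaceP=> e; apply/limgP/lkerP=> [[y ->]|pe]; first by case: (pi1 y).
  by exists (p1 e); rewrite {1}[e]dec pe linear0 addr0.
(* The pushout U of Phi and D is the cokernel of R; [al] and [ga] will be its two legs. *)
pose R := (i1 \o Phi)%VF - (i2 \o D)%VF.
have RP : R \in mhom P1 E by rewrite memvB // mhom_comp.
have RE x : R x = i1 (Phi x) - i2 (D x).
  by rewrite add_lfunE opp_lfunE !comp_lfunE.
have [U [pi [pis piV]]] := cokernel_exists RP.
have WU : W U by apply: (wide_cokernel wideW RP (q := pi)); first split.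
have [piP pisE] : _ := iffLR (surj_homP _) pis.
have piR x : pi (R x) = 0 by apply/lkerP; rewrite piV mem_limg.
have [al alP alE] : exists2 al, al \in mhom Y U & forall y, al y = pi (i1 y).
  by exists (pi \o i1)%VF => [|y]; [apply: mhom_comp | rewrite comp_lfunE].
have [ga gaP gaE] : exists2 ga, ga \in mhom P0 U & forall z, ga z = pi (i2 z).
  by exists (pi \o i2)%VF => [|y]; [apply: mhom_comp | rewrite comp_lfunE].
have alga x : al (Phi x) = ga (D x).
  apply/eqP; rewrite -subr_eq0 alE gaE -linearB /= -RE.
  by apply/eqP/piR.
have [e|be beP beE] := factor_surj pis (mhom_comp p2P CP).
  move/lkerP; rewrite piV => /limgP[x ->]; rewrite comp_lfunE RE linearB /=.
  have [_ ->] := pi1 (Phi x); have [_ ->] := pi2 (D x).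
  by rewrite sub0r linearN /= CD oppr0.
have beal y : be (al y) = 0.
  by rewrite alE -beE comp_lfunE; have [_ ->] := pi1 y; rewrite linear0.
have bega z : be (ga z) = C z.
  by rewrite gaE -beE comp_lfunE; have [_ ->] := pi2 z.
have decU u : exists y z, u = al y + ga z.
  have [e <-] := pisE u; exists (p1 e), (p2 e).
  by rewrite alE gaE -linearD -dec.
have alphi i x : al (phi i x) = ga (j0 i (q1 x)).
  have -> : phi i x = Phi (j1 i x).
    rewrite PhiE (bigD1 i) //= rj1 big1 ?addr0 // => j ji.
    by rewrite rj10 ?linear0 // eq_sym.
  rewrite alga; congr (ga _); rewrite [LHS]s0 (bigD1 i) //= DE rj1 big1 ?addr0 //.
  by move=> j ji; rewrite DE rj10 ?linear0 // eq_sym.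
(* After [al], every map Q1 -> Y factors through q1: the generators do by the commuting square of
   the pushout, and chain endomorphisms carry this over to their combinations. *)
have al_factor chi : chi \in mhom Q1 Y ->
    exists2 h, h \in mhom Q0 U & forall x, al (chi x) = h (q1 x).
  move=> /span[t [s [h [ts hP chiE]]]].
  exists (\sum_i (ga \o (j0 i \o s i))%VF + (al \o h)%VF).
    apply: memvD; last exact: mhom_comp.
    apply: memv_suml => i _; have [_ sP _] := ts i.
    by do 2!apply: mhom_comp => //.
  move=> x; rewrite chiE add_lfunE sum_lfunE linearD linear_sum /= comp_lfunE.
  congr (_ + _); apply: eq_bigr => i _; have [_ _ tsi] := ts i.
  by rewrite !comp_lfunE alphi tsi.
exists k, N, U, inj, proj, al, be; split=> //.
- split=> // [|u beu].
    apply/surj_homP; split=> // n.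
    have /choice[w wE] : forall i, exists w, q0 w = proj i n.
      by move=> i; have /surj_homP[_] := rp_q0 pres; apply.
    exists (ga (\sum_i j0 i (w i))); rewrite bega [LHS]sN [RHS]sN.
    apply: eq_bigr => i _; rewrite CE -wE linear_sum (bigD1 i) //= rj0.
    by rewrite big1 ?addr0 // => j ji; rewrite rj00.
  have [y [z uE]] := decU u; move: beu; rewrite uE linearD /= beal add0r bega.
  by move=> /Cker[w ->]; exists (y + Phi w); rewrite linearD /= alga.
- split=> //; split=> // psi psiP.
  have [e eP psiE] := projective_lift (rp_Q1 pres) WE WU pis psiP.
  have [h hP hE] := al_factor _ (mhom_comp eP p1P).
  (* The P0-components of the lift e of psi. For such a component b : Q1 -> Q0, rigidity of M gives
     q0 b = q0 g' q1 for some g' on Q0, so b = g' q1 + q1 c. The second summand goes into U as al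
     phi_i c, to which [al_factor] applies. *)
  have comp i : exists2 g, g \in mhom Q0 U &
      forall x, ga (j0 i (r0 i (p2 (e x)))) = g (q1 x).
    have [b bP bE] : exists2 b, b \in mhom Q1 Q0 &
        forall x, b x = r0 i (p2 (e x)).
      exists (r0 i \o (p2 \o e))%VF => [|x]; last by rewrite !comp_lfunE.
      by do 2!apply: mhom_comp => //.
    have [g gP gE] := rp_rigid pres (mhom_comp bP q0P).
    have [g' g'P g'E] := projective_lift (rp_Q0 pres) WQ0 WM (rp_q0 pres) gP.
    have dP : b - (g' \o q1)%VF \in mhom Q1 Q0 by rewrite memvB // mhom_comp.
    have [x|c cP cE] := projective_lift_image wideW (rp_Q1 pres) WQ1 WQ0 q1P dP.
      apply: (q0_ker pres); rewrite add_lfunE opp_lfunE linearB /= -comp_lfunE gE.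
      by rewrite g'E comp_lfunE subrr.
    have [f fP fE] := al_factor _ (mhom_comp cP (phiP i)).
    exists ((ga \o (j0 i \o g'))%VF + f).
      by rewrite memvD //; do 2!apply: mhom_comp => //.
    move=> x; rewrite -bE -[b x](subrK (g' (q1 x))).
    have -> : b x - g' (q1 x) = q1 (c x).
      by rewrite -cE add_lfunE opp_lfunE comp_lfunE.
    rewrite !linearD /= -alphi addrC add_lfunE !comp_lfunE.
    by congr (_ + _); rewrite -fE comp_lfunE.
  have [g gP gE] : exists2 g : 'I_k.+1 -> 'Hom(Q0, U),
      forall i, g i \in mhom Q0 U &
      forall i x, ga (j0 i (r0 i (p2 (e x)))) = g i (q1 x).
    have /choice[g gPE] : forall i, exists g, g \in mhom Q0 U /\
        forall x, ga (j0 i (r0 i (p2 (e x)))) = g (q1 x).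
      by move=> i; have [g gP gE] := comp i; exists g.
    by exists g => i; case: (gPE i).
  exists (h + \sum_i g i); first by rewrite memvD // memv_suml.
  move=> x; rewrite psiE {1}[e x]dec linearD add_lfunE sum_lfunE /=.
  congr (_ + _); first by rewrite -hE comp_lfunE alE.
  rewrite {1}[p2 (e x)]s0 !linear_sum /=; apply: eq_bigr => i _.
  by rewrite -gE gaE.
(* Factor each f phi_i as g_i q1 and glue f with the g_i over the pushout. *)
- move=> X f [_ HX] fP.
  have /choice[g gP] : forall i, exists g, g \in mhom Q0 X /\
      forall x, (f \o phi i)%VF x = g (q1 x).
    by move=> i; have [g gP gE] := HX _ (mhom_comp (phiP i) fP); exists g.
  pose F := (f \o p1)%VF + \sum_i (g i \o (r0 i \o p2))%VF.
  have FP : F \in mhom E X.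
    rewrite memvD ?mhom_comp // memv_suml // => i _.
    by have [giP _] := gP i; do 2!apply: mhom_comp => //.
  have FE e : F e = f (p1 e) + \sum_i g i (r0 i (p2 e)).
    rewrite add_lfunE sum_lfunE comp_lfunE; congr (_ + _).
    by apply: eq_bigr => i _; rewrite !comp_lfunE.
  have [e|G GP GE] := factor_surj pis FP.
    move/lkerP; rewrite piV => /limgP[x ->]; rewrite FE.
    have -> : p1 (R x) = Phi x.
      rewrite RE linearB /=; have [-> _] := pi1 (Phi x).
      by have [-> _] := pi2 (D x); rewrite subr0.
    have -> : p2 (R x) = - D x.
      rewrite RE linearB /=; have [_ ->] := pi1 (Phi x).
      by have [_ ->] := pi2 (D x); rewrite sub0r.
    rewrite PhiE linear_sum -big_split /= big1 // => i _.
    have [_ giE] := gP i.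
    by rewrite !linearN /= DE -giE comp_lfunE subrr.
  exists G => // y; rewrite alE -GE FE; have [-> ->] := pi1 y.
  by rewrite big1 ?addr0 // => i _; rewrite !linear0.
(* Suppose that a is injective. Lifting s to Q0 -> E and then to Q1 -> P1 gives chain endomorphisms
   (- v_j, z_j); the i-th one covers a, hence is invertible by minimality of the presentation. The
   exchange lemma then removes phi_i, against the minimality of the number of generators. *)
move=> s i sP a0; set a := (proj i \o _)%VF in a0.
have aP : a \in mhom M M by do 2!apply: mhom_comp => //.
have [e eP eE] := projective_lift (rp_Q0 pres) WE WU pis (mhom_comp q0P sP).
have eqP : (e \o q1)%VF \in mhom Q1 E by apply: mhom_comp.
have [x|w wP wE] := projective_lift_image wideW (rp_Q1 pres) WP1 WE RP eqP.
  apply/limgP; rewrite -piV; apply/lkerP.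
  by rewrite comp_lfunE -eE comp_lfunE (q0q1 pres) linear0.
have wE1 x : p1 (e (q1 x)) = Phi (w x).
  rewrite -[e _]comp_lfunE wE RE linearB /=; have [-> _] := pi1 (Phi (w x)).
  by have [-> _] := pi2 (D (w x)); rewrite subr0.
have wE2 x : p2 (e (q1 x)) = - D (w x).
  rewrite -[e _]comp_lfunE wE RE linearB /=; have [_ ->] := pi1 (Phi (w x)).
  by have [_ ->] := pi2 (D (w x)); rewrite sub0r.
pose z j := (r0 j \o (p2 \o e))%VF; pose v j := (r1 j \o w)%VF.
have zP j : z j \in mhom Q0 Q0 by do 2!apply: mhom_comp => //.
have vP j : v j \in mhom Q1 Q1 by apply: mhom_comp.
have vz j x : q1 (v j x) = - z j (q1 x).
  by rewrite !comp_lfunE wE2 linearN opprK /= DE.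
have za x : q0 (z i x) = a (q0 x).
  rewrite [z i x]comp_lfunE -CE comp_lfunE -bega !comp_lfunE -[s _]comp_lfunE eE gaE.
  by congr (proj i _); rewrite {2}[e x]dec !linearD /= -alE beal add0r.
have [zi vi] : lker (z i) = 0%VS /\ lker (- v i) = 0%VS.
  apply: (rp_minimal pres aP (zP i) _ za) => // [|x]; first by rewrite memvN.
  by rewrite opp_lfunE linearN /= vz opprK.
have vi0 : lker (v i) = 0%VS.
  apply/lker0_eqP=> x vx; apply: (iffLR (lker0_eqP _) vi).
  by rewrite opp_lfunE vx oppr0.
suff : (k.+1 <= k)%N by rewrite ltnn.
apply: kmin; apply/asboolP; exists (fun j => phi (lift i j)).
apply: (ext_span_reduce (i := i) (conj phiP span) (w := v) (z := z)
         (s0 := (p1 \o e)%VF)) => //.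
  exact: mhom_comp.
move=> x; rewrite comp_lfunE wE1 PhiE.
by apply: eq_bigr => j _; rewrite comp_lfunE.
Qed.
End Bongartz.

(** * The heart of the interval between Gen M and its tau-orthogonal *)

Lemma incl_anti (U : Type) (x y : U -> Prop) : incl x y -> incl y x -> x = y.
Proof.
by move=> xy yx; apply/funext=> u; apply/propext; split=> ?; [apply: xy|apply: yx].
Qed.

Section Heart.
Variables (K : fieldType) (A : falgType K) (W : subcat A).
Hypothesis wideW : wide W.
Variables (M Q1 Q0 : fmod A) (q1 : 'Hom(Q1, Q0)) (q0 : 'Hom(Q0, M)).
Hypothesis pres : rigid_presentation W q1 q0.
Hypothesis indecM : indecomposable M.
Implicit Types (X Y Z C S : fmod A) (T : subcat A).

Let WM := rp_M pres.
Let TT := extorth W q1.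
Let T0 := Gen W M.
Let F0 := rperp W M.

Let tTT : tors W TT. Proof. exact: extorth_tors pres. Qed.
Let tT0 : tors W T0. Proof. exact: Gen_tors pres. Qed.

(* The tau-perpendicular wide subcategory of M. *)
Definition heart : subcat A := fun X => TT X /\ F0 X.

(** Simple objects of the abelian category [heart], tested on morphisms out of S; images and kernels
    in the heart are those of mod A. *)
Definition heart_simple S := [/\ heart S, ~ zero_mod S &
  forall Y (f : 'Hom(S, Y)), f \in mhom S Y -> heart Y ->
    (forall x, f x = 0) \/ lker f = 0%VS].

Lemma heart_W X : heart X -> W X.
Proof. by case=> _ []. Qed.

Lemma image_exists X Y (f : 'Hom(X, Y)) : f \in mhom X Y -> W X -> W Y ->
  exists (I : fmod A) (i : 'Hom(I, Y)) (p : 'Hom(X, I)),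
  [/\ W I, injective_hom i, surjective_hom p & forall x, f x = i (p x)].
Proof.
move=> fP WX WY; have [|I [i [ii iV]]] := @submodule_exists _ _ Y (limg f).
  by move=> a y; apply: limg_stable.
have [x|p pP pE] := factor_inj ii fP; first by apply/limgP; rewrite iV mem_limg.
exists I, i, p; split=> //; first exact: (wide_image wideW fP ii iV WX WY).
apply/surj_homP; split=> // z; have /limgP[x ix] : i z \in limg f.
  by rewrite -iV mem_limg.
by exists x; case: ii => _ i0; apply: (lker_sub_inj i0); rewrite -pE.
Qed.

Lemma rperp_sub X Y N (i : 'Hom(X, Y)) : injective_hom i -> W X ->
  rperp W N Y -> rperp W N X.
Proof.
move=> /inj_homP[iP i0] WX [_ /mhom0P Y0]; split=> //; apply/mhom0P=> h hP n.
by apply: i0; rewrite -comp_lfunE Y0 // mhom_comp.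
Qed.

Lemma surj_kernel_exact X Y (p : 'Hom(X, Y)) : surjective_hom p ->
  exists (Z : fmod A) (k : 'Hom(Z, X)), short_exact k p.
Proof.
by move=> ps; have [pP _] := ps; have [Z [k [ki kV]]] := kernel_exists pP; exists Z, k.
Qed.

(** The image is a quotient of X, hence in TT, and a submodule of Y, hence in F0. *)
Lemma heart_image X Y (f : 'Hom(X, Y)) : f \in mhom X Y -> heart X -> heart Y ->
  exists (I : fmod A) (i : 'Hom(I, Y)) (p : 'Hom(X, I)),
  [/\ heart I, injective_hom i, surjective_hom p & forall x, f x = i (p x)].
Proof.
move=> fP [TX FX] [TY FY].
have [WX WY] : W X /\ W Y by split; [case: FX | case: FY].
have [I [i [p [WI ii ps fE]]]] := image_exists fP WX WY.
exists I, i, p; split=> //; split; last exact: rperp_sub ii WI FY.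
exact: (tors_quotient tTT ps TX WI).
Qed.

(** Maps M -> C lift to Y, since Ext^1(M, X) = 0. *)
Lemma heart_cokernel X Y C (i : 'Hom(X, Y)) (q : 'Hom(Y, C)) :
  short_exact i q -> heart X -> heart Y -> heart C.
Proof.
move=> iq [TX FX] [TY FY]; have [ii qs _] := iq; have [iP _] := ii.
have [WX WY] : W X /\ W Y by split; [case: FX | case: FY].
have WC : W C.
  by apply: (wide_cokernel wideW iP (q := q)) => //; case: iq; split.
split; first exact: (tors_quotient tTT qs TY WC).
split=> //; apply/mhom0P=> f fP m.
have [k kP ->] := ext_projective wideW pres iq TX WC fP.
by have [_ /mhom0P ->] := FY; rewrite ?linear0.
Qed.

(** For f : Q1 -> Z write k f = h q1. Then p h kills the image of q1 and induces a map M -> Y, which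
    is zero; so h lands in Z. *)
Lemma heart_kernel X Y Z (p : 'Hom(X, Y)) (k : 'Hom(Z, X)) :
  short_exact k p -> heart X -> heart Y -> heart Z.
Proof.
move=> kp [TX FX] [TY FY]; have [ki ps kV] := kp.
have [[kP k0] [pP _]] := (ki, ps).
have [WX WY] : W X /\ W Y by split; [case: FX | case: FY].
have WZ : W Z by apply: (wide_kernel wideW pP (i := k)).
split; last exact: rperp_sub ki WZ FX.
split=> // f fP; have [_ HX] := TX.
have [h hP hE] := HX _ (mhom_comp fP kP).
have phP := mhom_comp hP pP.
have [x|g gP gE] := factor_surj (rp_q0 pres) phP.
  move=> /(q0_ker pres)[y ->]; rewrite comp_lfunE -hE comp_lfunE.
  by apply/lkerP; rewrite -kV mem_limg.
have ph0 x : p (h x) = 0.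
  by rewrite -comp_lfunE gE; have [_ /mhom0P ->] := FY.
have [x|l lP lE] := factor_inj ki hP.
  by apply/limgP; rewrite kV; apply/lkerP.
by exists l => // x; apply: (lker_sub_inj k0); rewrite -lE -hE comp_lfunE.
Qed.

(** A nonzero quotient of X in the heart of least dimension is simple: the image of a nonzero map
    out of it into the heart is another such quotient. *)
Lemma heart_simple_quotient X : heart X -> ~ zero_mod X ->
  exists S (p : 'Hom(X, S)), heart_simple S /\ surjective_hom p.
Proof.
move=> JX X0.
have ex : exists n, `[< exists S (p : 'Hom(X, S)),
    [/\ heart S, ~ zero_mod S, surjective_hom p & \dim {:S} = n] >].
  exists (\dim {:X}); apply/asboolP; exists X, \1%VF; split=> //.
  by apply/surj_homP; split=> [|x]; [apply: mhom1 | exists x; rewrite id_lfunE].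
case: (ex_minnP ex) => n /asboolP[S [p [JS S0 ps <-]]] nmin.
exists S, p; split=> //; split=> // Y f fP JY.
have [f0|f0] := pselect (forall x, f x = 0); [by left | right].
have [I [i [r [JI ii rs fE]]]] := heart_image fP JS JY.
have I0 : ~ zero_mod I.
  by move=> I0; apply: f0 => x; rewrite fE [r x]I0 linear0.
have rpS : surjective_hom (r \o p)%VF.
  have [/surj_homP[rP rS] /surj_homP[pP pS]] := (rs, ps).
  apply/surj_homP; split; first exact: mhom_comp.
  move=> z; have [y <-] := rS z; have [x <-] := pS y.
  by exists x; rewrite comp_lfunE.
have : (\dim {:S} <= \dim {:I})%N.
  by apply: nmin; apply/asboolP; exists I, (r \o p)%VF.
have [_ rV] := rs; have := limg_ker_dim r fullv; rewrite rV capfv => <-.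
rewrite -[X in (_ <= X)%N]add0n leq_add2r leqn0 dimv_eq0 => /eqP r0.
apply/lker0_eqP=> x; rewrite fE => irx.
by apply: (iffLR (lker0_eqP _) r0); case: ii => _ /lker0_eqP; apply.
Qed.

(** Schur's lemma. The cokernel of a nonzero f is in the heart, and the projection onto it is not
    injective, so it is zero. *)
Lemma heart_simple_iso S S' : heart_simple S -> heart_simple S' ->
  mhom S S' <> 0%VS -> isomorphic S S'.
Proof.
move=> [JS S0 sS] [JS' S'0 sS'] hom.
have [f fP [x fx]] : exists2 f, f \in mhom S S' & exists x, f x <> 0.
  apply: contrapT => no; apply: hom; apply/mhom0P=> f fP x.
  by apply: contrapT => fx; apply: no; exists f => //; exists x.
have [f0|f0] := sS _ _ fP JS'; first by case: (fx (f0 x)).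
exists f; split=> //; have [C [q [qs qV]]] := cokernel_exists fP.
have JC : heart C by apply: (heart_cokernel (i := f) (q := q)).
have [qP _] := qs; have [q0'|q0'] := sS' _ _ qP JC.
  split=> //; apply/vspaceP=> y; rewrite memvf -qV; exact/lkerP.
case: fx; apply: (iffLR (lker0_eqP _) q0'); apply/lkerP.
by rewrite qV mem_limg.
Qed.

(** Objects of the heart are iterated extensions of simple ones; the induction splits off a simple
    quotient. *)
Lemma heart_sub_tors T : tors W T -> (forall S, heart_simple S -> T S) ->
  incl heart T.
Proof.
move=> tT ST X; have [n] := ubnP (\dim {:X}).
elim: n => // n IHn in X *; rewrite ltnS => dX JX.
have [X0|X0] := pselect (zero_mod X); first exact: (tors_zero wideW tT WM X0).
have [S [p [sS ps]]] := heart_simple_quotient JX X0.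
have [Z [k kp]] := surj_kernel_exact ps.
have [JS S0 _] := sS.
apply: (tors_ext tT kp); last exact: ST.
apply: IHn (heart_kernel kp JX JS); apply: leq_trans dX.
have [[_ k0] [_ pV] kV] := kp; have := limg_ker_dim p fullv.
rewrite capfv pV -kV limg_dim_eq ?k0 ?capfv // => <-.
rewrite -addn1 leq_add2l lt0n dimv_eq0; apply/eqP=> S00; apply: S0 => s.
by apply/eqP; rewrite -memv0 -S00 memvf.
Qed.

(** The torsion-free part F of C is in the heart, so S -> C -> F is zero or injective; it cannot be
    injective because q is not. *)
Lemma heart_simple_proper_quotient S C (q : 'Hom(S, C)) : heart_simple S ->
  surjective_hom q -> lker q <> 0%VS -> W C -> T0 C.
Proof.
move=> [[TS FS] S0 sS] qs qn WC; have [T [F [i [p [ip GT FF]]]]] :=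
  torsion_pair wideW pres WC.
have [ii ps iV] := ip; have [[qP _] [pP _]] := (qs, ps).
have JF : heart F.
  split=> //; apply: (tors_quotient tTT ps); last by case: FF.
  exact: (tors_quotient tTT qs TS WC).
have [z|z] := sS _ _ (mhom_comp qP pP) JF.
  apply: (tors_ext tT0 ip GT); apply: (tors_zero wideW tT0 WM) => x.
  have /surj_homP[_ /(_ x)[c <-]] := ps; have /surj_homP[_ /(_ c)[s <-]] := qs.
  by rewrite -comp_lfunE z.
case: qn; apply/lker0_eqP=> s qs0; apply: (iffLR (lker0_eqP _) z).
by rewrite comp_lfunE qs0 linear0.
Qed.

(** Let U be the Bongartz completion of the torsion-free part F of X. It is in T, being an extension
    of a power of M by a quotient of F, and its torsion-free quotient G is in the heart. If G were
    zero, M would generate U, although U maps onto M and all composites M -> U -> M are radical. *)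
Lemma tors_heart_nonzero T X : tors W T -> incl T0 T -> T X -> ~ T0 X ->
  exists Y, [/\ T Y, heart Y & ~ zero_mod Y].
Proof.
move=> tT T0T TX nX; have WX := tors_sub tT TX.
have [T1 [F [i [p [ip GT FF]]]]] := torsion_pair wideW pres WX.
have [ii ps iV] := ip; have WF : W F by case: FF.
have TF : T F := tors_quotient tT ps TX WF.
have F0n : ~ zero_mod F.
  move=> Z; apply: nX; apply: (tors_ext tT0 ip GT).
  exact: (tors_zero wideW tT0 WM).
case: (bongartz wideW pres WF) => [TTF|]; first by exists F.
move=> [k [N [U [inj [pr [al [be H]]]]]]].
have [[homs pi pi0 sN] [alP bes beal bek] [TTU WN] _ rad] := H.
have WU : W U by case: TTU.
have [beP beS] := iffLR (surj_homP _) bes.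
have TN : T N.
  apply/T0T/GenP; split=> //.
  apply/vspaceP=> x; rewrite memvf [x]sN; apply: memv_suml => j _.
  by apply: mem_trace; case: (homs j).
have TU : T U.
  have [I [j [r [WI ji rs alE]]]] := image_exists alP WF WU.
  apply: (tors_ext tT (f := j) (g := be) _ _ TN).
    split=> //; apply/vspaceP=> u; apply/limgP/lkerP=> [[z ->]|/bek[y ->]].
      by have /surj_homP[_ /(_ z)[y <-]] := rs; rewrite -alE beal.
    by exists (r y); rewrite alE.
  exact: (tors_quotient tT rs TF WI).
have [T2 [G [i2 [p2 [ip2 GT2 FG]]]]] := torsion_pair wideW pres WU.
have [_ p2s _] := ip2; have WG : W G by case: FG.
have TG : T G := tors_quotient tT p2s TU WG.
have TTG : TT G := tors_quotient tTT p2s TTU WG.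
exists G; split=> // G0.
have [_ tU] : W U /\ trace M U = fullv.
  apply/GenP; apply: (tors_ext tT0 ip2 GT2); exact: (tors_zero wideW tT0 WM).
have [e [eP en eI]] := socle_end indecM.
apply: en; apply/lfunP=> m; rewrite zero_lfunE.
have [u <-] : exists u, pr ord0 (be u) = m.
  by have [u uE] := beS (inj ord0 m); exists u; rewrite uE pi.
have prP : pr ord0 \in mhom N M by case: (homs ord0).
apply/lkerP; have : u \in trace M U by rewrite tU memvf.
have : (trace M U <= lker (e \o (pr ord0 \o be)))%VS.
  apply: trace_sub => g x gP; apply/lkerP; rewrite !comp_lfunE.
  have := eI (pr ord0 \o (be \o g))%VF x; rewrite !comp_lfunE; apply.
    by do 2!apply: mhom_comp => //.
  exact: rad.
by move=> /subvP sub /sub /lkerP; rewrite !comp_lfunE => /lkerP.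
Qed.

Lemma tors_heart_simple T X : tors W T -> incl T0 T -> T X -> ~ T0 X ->
  exists2 S, heart_simple S & T S.
Proof.
move=> tT T0T TX nX; have [Y [TY JY Y0]] := tors_heart_nonzero tT T0T TX nX.
have [S [p [sS ps]]] := heart_simple_quotient JY Y0.
exists S => //; apply: (tors_quotient tT ps TY).
by case: sS => /heart_W.
Qed.
End Heart.

(** * The canonical meet representation of Gen M *)

Section Lattice.
Variables (K : fieldType) (A : falgType K) (W : subcat A).
Hypothesis wideW : wide W.
Variables (M Q1 Q0 : fmod A) (q1 : 'Hom(Q1, Q0)) (q0 : 'Hom(Q0, M)).
Hypothesis pres : rigid_presentation W q1 q0.
Hypothesis indecM : indecomposable M.
Implicit Types (X Y Z C S : fmod A) (T : subcat A).

Let WM := rp_M pres.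
Let TT := extorth W q1.
Let T0 := Gen W M.
Let simple := heart_simple W M q1.

Let tTT : tors W TT. Proof. exact: extorth_tors pres. Qed.
Let tT0 : tors W T0. Proof. exact: Gen_tors pres. Qed.
Let T0TT : incl T0 TT. Proof. by move=> X; apply: Gen_extorth pres _. Qed.

Let simple_W S : simple S -> W S. Proof. by case=> /heart_W. Qed.

Let t_lperp S : tors W (lperp W S). Proof. exact: lperp_tors WM. Qed.

Let t_gen (P : subcat A) : tors W (Tgen W P). Proof. exact: Tgen_tors WM. Qed.

Lemma tors_cap T T' : tors W T -> tors W T' -> tors W (fun X => T X /\ T' X).
Proof.
move=> tT tT'; apply: tors_intro => // [X [/(tors_sub tT)]//|||].
- move=> X Y Z f g fg [TX TX'] [TZ TZ'].
  by split; [apply: (tors_ext tT fg) | apply: (tors_ext tT' fg)].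
- move=> X Y f fs [TX TX'] WY.
  by split; [apply: (tors_quotient tT fs) | apply: (tors_quotient tT' fs)].
move=> Z Z0; split; [exact: (tors_zero wideW tT WM) | exact: (tors_zero wideW tT' WM)].
Qed.

Let T0_lperp S : simple S -> incl T0 (lperp W S).
Proof.
by move=> [[_ [_ MS]] _ _]; apply: (Gen_sub wideW WM (t_lperp S)).
Qed.

Lemma not_lperp_self X : ~ zero_mod X -> ~ lperp W X X.
Proof.
move=> X0 [_ /mhom0P XX]; apply: X0 => x.
by rewrite -[x]id_lfunE XX ?mhom1.
Qed.

Let simple_not_lperp S : simple S -> ~ lperp W S S.
Proof. by move=> [_ S0 _]; apply: not_lperp_self. Qed.

Let simple_iso S S' : simple S -> simple S' -> ~ lperp W S' S -> isomorphic S S'.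
Proof.
move=> sS sS' nS; apply: (heart_simple_iso wideW pres sS sS') => hom.
by apply: nS; split=> //; apply: simple_W.
Qed.

Let lperp_eq_iso S S' : simple S -> simple S' -> incl (lperp W S) (lperp W S') ->
  isomorphic S' S.
Proof.
by move=> sS sS' sub; apply: simple_iso => // /sub; apply: simple_not_lperp.
Qed.

Let iso_lperp S S' : isomorphic S S' -> incl (lperp W S) (lperp W S').
Proof.
move=> /isoP[f [g [fP gP fK gK]]] X [WX /mhom0P X0]; split=> //.
apply/mhom0P=> h hP x; rewrite -[h x]gK -[g _]comp_lfunE X0 ?linear0 //.
exact: mhom_comp.
Qed.

(* Every proper quotient of S lies in T0, so a nonzero map to S from T >= T0
   forces S into T. *)
Let sub_lperp S T : simple S -> tors W T -> incl T0 T -> ~ T S ->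
  incl T (lperp W S).
Proof.
move=> sS tT T0T nS X TX; have WX := tors_sub tT TX; have WS := simple_W sS.
split=> //; apply/mhom0P=> f fP; apply: contrapT => fn; apply: nS.
have [I [i [p [WI ii ps fE]]]] := image_exists wideW fP WX WS.
have TI : T I := tors_quotient tT ps TX WI.
have iP : i \in mhom I S by case: ii.
have [C [q [qs qV]]] := cokernel_exists iP.
have WC : W C by apply: (wide_cokernel wideW iP (q := q)); first split.
apply: (tors_ext tT (f := i) (g := q)) => //.
apply: T0T; apply: (heart_simple_proper_quotient wideW pres sS qs) => //.
rewrite qV => i0; apply: fn => x; rewrite fE.
by apply/eqP; rewrite -memv0 -i0 mem_limg.
Qed.

Let not_T0_simple T X : tors W T -> incl T0 T -> T X -> ~ T0 X ->
  exists2 S, simple S & T S.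
Proof. exact: (tors_heart_simple wideW pres indecM). Qed.

Let simple_not_T0 S : simple S -> ~ T0 S.
Proof.
by move=> [[_ FS] S0 _] TS; apply: S0; apply: Gen_rperp TS FS.
Qed.

(** A torsion class strictly between contains a simple S' of the heart. If S' were not isomorphic to
    S, then [lperp W S'] would contain T0 and S, hence the class they generate, hence S' itself. *)
Let simple_cover S : simple S ->
  covered_by (tors W) T0 (Tgen W (fun X => T0 X \/ X = S)).
Proof.
move=> sS; set P := fun X => _.
have PW X : P X -> W X by case=> [/(tors_sub tT0)|->] //; apply: simple_W.
have TS : Tgen W P S by apply: Tgen_sub => //; right.
split=> //; first split=> [X TX|e]; first by apply: Tgen_sub => //; left.
  by apply: (simple_not_T0 sS); move: TS; rewrite -e.
move=> T tT T0T TP; have [TT0|] := pselect (incl T T0).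
  by left; apply: incl_anti.
move=> /existsNP[X /not_implyP[TX nX]]; right; apply: incl_anti => //.
have [S' sS' TS'] := not_T0_simple tT T0T TX nX.
have iso : isomorphic S S'.
  apply: simple_iso => // SS'; apply: (simple_not_lperp sS').
  have [_] := TP _ TS'; apply; first exact: t_lperp.
  by move=> Y [/(T0_lperp sS')|->].
apply: Tgen_min => // Y [/T0T//|->].
exact: (tors_iso tT (iso_sym iso)).
Qed.

(** A cover T of T0 meets TT in T0 or in T. The first is impossible: T contains a nonzero object of
    the heart, and T0 does not. Conversely, an upper bound of the covers contains the simples, hence
    the heart, and every object of TT is an extension of one in the heart by one in T0. *)
Lemma pop_up_extorth : is_pop_up (tors W) T0 TT.
Proof.
split=> // [T [->//|[_ tT [T0T nT] cov]]|T tT Tcov].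
  have tcap := tors_cap tT tTT.
  have [||e|<- X []//] := cov _ tcap; last 1 first.
  - case: nT; apply: incl_anti => // X TX; apply: contrapT => nX.
    have [Y [TY JY Y0]] := tors_heart_nonzero wideW pres indecM tT T0T TX nX.
    have T0Y : T0 Y by rewrite -e; split=> //; case: JY.
    by apply: Y0; apply: (Gen_rperp T0Y); case: JY.
  - by move=> X T0X; split; [apply: T0T | apply: T0TT].
  by move=> X [].
have T0T : incl T0 T by apply: Tcov; left.
have heartT : incl (heart W M q1) T.
  apply: (heart_sub_tors wideW pres tT) => S sS.
  apply: (Tcov _ (or_intror (simple_cover sS))); apply: Tgen_sub; last by right.
  by move=> X [/(tors_sub tT0)|->] //; apply: simple_W.
move=> X TTX; have WX := tors_sub tTT TTX.
have [Y [F [i [p [ip GY FF]]]]] := torsion_pair wideW pres WX.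
apply: (tors_ext tT ip (T0T _ GY)); apply: heartT; split=> //.
have [_ ps _] := ip; apply: (tors_quotient tTT ps TTX); by case: FF.
Qed.

Let CMR m := exists2 S, simple S & m = lperp W S.

(** If T lies below every [lperp W S], then so does the torsion class generated by T0 and T; it
    contains no simple of the heart and equals T0. For the refinement property, some b in B omits S,
    and then [sub_lperp] puts b below [lperp W S]. *)
Lemma CMR_Gen : is_CMR (tors W) T0 CMR.
Proof.
split=> [_ [S sS ->]//|_ _ [S sS ->] [S' sS' ->] sub||B tB meetB _ [S sS ->]].
- apply: incl_anti => //; apply: iso_lperp; exact: lperp_eq_iso.
- split=> // [_ [S sS ->]|T tT low]; first exact: T0_lperp.
  move=> X TX; apply: contrapT => nX.
  pose P Y := T0 Y \/ T Y.
  have PW Y : P Y -> W Y by case=> [/(tors_sub tT0)|/(tors_sub tT)].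
  have [|||S sS [_ SP]] := @not_T0_simple (Tgen W P) X _ _ _ nX => //.
  - by move=> Y TY; apply: Tgen_sub => //; left.
  - by apply: Tgen_sub => //; right.
  apply: (simple_not_lperp sS); apply: SP => // Y [/(T0_lperp sS)//|].
  by apply: low; exists S.
have [_ lowB glb] := meetB.
have [b Bb nS] : exists2 b, B b & ~ b S.
  apply: contrapT => no; apply: (simple_not_T0 sS).
  (* The intersection of B is a torsion class below the meet T0; if no b omitted S, it would contain
     S. *)
  pose P := fun X => W X /\ forall b, B b -> b X.
  have tP : tors W P.
    apply: tors_intro => // [X []//|X Y Z f g fg [WX BX] [WZ BZ]||Z Z0].
    - split; first exact: (wide_ext wideW fg WX WZ).
      by move=> b Bb; apply: (tors_ext (tB _ Bb) fg); [apply: BX|apply: BZ].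
    - move=> X Y f fs [WX BX] WY; split=> // b Bb.
      exact: (tors_quotient (tB _ Bb) fs (BX _ Bb)).
    split; first exact: (wide_zero wideW WM Z0).
    by move=> b Bb; apply: (tors_zero wideW (tB _ Bb) WM).
  apply: (glb _ tP) => [b Bb X [_]|]; first exact.
  split=> [|b Bb]; first exact: simple_W.
  by apply: contrapT => nb; apply: no; exists b.
by exists b => //; apply: sub_lperp => //; [apply: tB | apply: lowB].
Qed.

(** The value has to depend on m alone and not on a chosen S. Simples with the same [lperp] are
    isomorphic, so taking all of them generates the same torsion class. *)
Let kd m := Tgen W (fun S => simple S /\ m = lperp W S).

Let kd_W m S : simple S /\ m = lperp W S -> W S.
Proof. by case=> /simple_W. Qed.

(** By [sub_lperp], every torsion class strictly above m contains S, and [kd m] is the least torsion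
    class containing S. So their join m' with m is the only cover of m. If m and T have join m',
    some X in T maps nontrivially to S, and the image of this map turns out to be all of S. *)
Lemma kappa_d_simple S : simple S -> is_kappa_d (tors W) (lperp W S) (kd (lperp W S)).
Proof.
move=> sS; set m := lperp W S; have WS := simple_W sS.
have T0m : incl T0 m := T0_lperp sS.
have nmS : ~ m S := simple_not_lperp sS.
have kdS : kd m S by apply: Tgen_sub => [X|]; [apply: kd_W | split].
have strict T : tors W T -> incl m T -> T <> m -> T S.
  move=> tT mT nTm; apply: contrapT => nTS; apply: nTm; apply: incl_anti => //.
  by apply: sub_lperp => // X /T0m; apply: mT.
have tm : tors W m := t_lperp S.
have kd_min T : tors W T -> T S -> incl (kd m) T.
  move=> tT TS; apply: Tgen_min => // S' [sS' e].
  apply: (tors_iso tT _ TS); apply: (lperp_eq_iso sS' sS).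
  by rewrite -/m e.
split.
  split=> // X tX [_ low glb]; have [x Xx nS] : exists2 x, X x & ~ x S.
    apply: contrapT => no; apply: nmS.
    apply: (glb (kd m) (t_gen _)) => // x Xx; apply: kd_min; first exact: tX.
    by apply: contrapT => nx; apply: no; exists x.
  suff <- : x = m by [].
  apply: contrapT => xm; apply: nS; apply: strict => //; [exact: tX | exact: low].
pose U := fun x => x = m \/ x = kd m.
have tU x : U x -> tors W x by case=> ->; [exact: tm | exact: t_gen].
have joinU := Tgen_join wideW WM tU.
set m' := Tgen W _ in joinU; exists m'.
have [tm' upU minU] := joinU.
have mm' : incl m m' by apply: upU; left.
have m'S : m' S by apply: (upU (kd m)) => //; right.
split=> //; [|exact: t_gen|].
  split=> //; first by split=> // e; apply: nmS; rewrite e.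
  move=> T tT mT Tm'; have [->|Tm] := pselect (T = m); [by left | right].
  apply: incl_anti => //; apply: minU => // _ [->//|->].
  by apply: kd_min => //; apply: strict.
move=> T tT [_ upT minT]; apply: (kd_min T tT).
have nTm : ~ incl T m.
  by move=> Tm; apply: nmS; apply: (minT m) m'S => // _ [] ->.
have [X TX nX] : exists2 X, T X & ~ m X.
  by move/existsNP: nTm => [X /not_implyP[TX nX]]; exists X.
have WX := tors_sub tT TX.
have [f fP fn] : exists2 f, f \in mhom X S & ~ (forall x, f x = 0).
  apply: contrapT => no; apply: nX; split=> //; apply/mhom0P=> f fP.
  by apply: contrapT => fx; apply: no; exists f.
have [I [i [p [WI ii ps fE]]]] := image_exists wideW fP WX WS.
have TI : T I := tors_quotient tT ps TX WI.
have m'I : m' I by apply: upT TI; right.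
have [iP i0] := ii.
have I0 : ~ zero_mod I by move=> I0; apply: fn => x; rewrite fE [p x]I0 linear0.
(* If I were proper, S -> I would vanish since S is a brick, and then m' would
   lie in lperp I. *)
have [iV|niV] := pselect (limg i = fullv).
  by apply: (tors_iso tT _ TI); exists i; split.
case: (not_lperp_self I0).
have : incl m' (lperp W I).
  apply: (minU _ (t_lperp I)) => _ [->|->] X'.
    move=> [WX' /mhom0P X'S]; split=> //; apply/mhom0P=> h hP x.
    apply: (lker_sub_inj i0); rewrite -comp_lfunE X'S ?linear0 //.
    exact: mhom_comp.
  move: X'; apply: kd_min => //; split=> //; apply/mhom0P=> h hP x.
  have [[JS _ sSS] ihP] := (sS, mhom_comp hP iP).
  have [ih|ih] := sSS _ _ ihP JS.
    by apply: (lker_sub_inj i0); rewrite -comp_lfunE ih linear0.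
  case: niV; apply/limg_fullP => y.
  have /limg_fullP/(_ y)[z <-] := iffRL (end_surj_inj _) ih.
  by exists (h z); rewrite comp_lfunE.
exact.
Qed.

Lemma kappabar_heart : is_kappabar_d (tors W) T0 (Tgen W simple).
Proof.
exists CMR, kd; split; first exact: CMR_Gen.
  by move=> _ [S sS ->]; apply: kappa_d_simple.
split=> // [_ [_ [S sS ->] ->]|T tT up].
  apply: Tgen_min => // S' [sS' _]; apply: Tgen_sub => // X; exact: simple_W.
apply: Tgen_min => // S sS; apply: (up (kd (lperp W S))).
  by exists (lperp W S) => //; exists S.
by apply: Tgen_sub => [X|]; [apply: kd_W | split].
Qed.

Lemma heart_Tgen : incl (heart W M q1) (Tgen W simple).
Proof.
apply: (heart_sub_tors wideW pres) => // S sS.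
by apply: Tgen_sub => // X; apply: simple_W.
Qed.

(** A section r of q0 gives the chain endomorphism (0, r q0) covering the identity of M. By
    minimality 0 is injective on Q1, that is, Q1 = 0. *)
Lemma projective_extorth : projective_in W M -> TT = W.
Proof.
move=> pM; apply: subcat_ext => X; split=> [|WX]; first exact: tors_sub.
split=> // f fP; have [WQ0 _] := rp_Q0 pres.
have [r rP rE] := projective_lift pM WQ0 WM (rp_q0 pres) (mhom1 M).
have q0P : q0 \in mhom Q0 M by case: (rp_q0 pres).
have sP : (r \o q0)%VF \in mhom Q0 Q0 by apply: mhom_comp.
have qs x : q0 ((r \o q0)%VF x) = (\1%VF : 'End(M)) (q0 x).
  by rewrite comp_lfunE -rE.
have qt x : q1 ((0 : 'End(Q1)) x) = (r \o q0)%VF (q1 x).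
  by rewrite comp_lfunE (q0q1 pres) zero_lfunE !linear0.
have [|_ t0] := rp_minimal pres (mhom1 M) sP (mem0v _) qs qt.
  by apply/lker0_eqP=> x; rewrite id_lfunE.
exists 0 => [|x]; first exact: mem0v.
rewrite zero_lfunE (iffLR (lker0_eqP _) t0 x) ?linear0 //.
by rewrite zero_lfunE.
Qed.

Lemma projective_kappabar : projective_in W M ->
  is_kappabar_d (tors W) T0 (rperp W M).
Proof.
move=> pM; suff -> : rperp W M = Tgen W simple by apply: kappabar_heart.
have tF : tors W (rperp W M).
  apply: tors_intro => // [X []//|X Y Z f g [fi gs fgV]||Z Z0].
  - move=> [WX /mhom0P HX] [WZ /mhom0P HZ]; split; first by apply: (wide_ext wideW (f := f) (g := g)).
    apply/mhom0P=> h hP m; have [gP _] := gs.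
    have [y|k kP kE] := factor_inj fi hP; last by rewrite kE HX // linear0.
    by apply/limgP; rewrite fgV; apply/lkerP; rewrite -comp_lfunE HZ // mhom_comp.
  - move=> X Y f fs [WX /mhom0P HX] WY; split=> //; apply/mhom0P=> h hP m.
    by have [k kP ->] := projective_lift pM WX WY fs hP; rewrite HX // linear0.
  split; first exact: (wide_zero wideW WM Z0).
  by apply/mhom0P=> h hP m; apply: Z0.
apply: incl_anti; last by apply: Tgen_min => // S [[_]].
move=> X FX; apply: heart_Tgen; split=> //.
by rewrite -/TT (projective_extorth pM); case: FX.
Qed.

(* A surjection U -> M with U in TT that induces no automorphism of M: every
   nonzero quotient Y of M then receives a nonzero map from the heart. *)
Lemma nonprojective_Gen : ~ projective_in W M -> Tgen W simple M.
Proof.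
move=> nP; have [WQ0 _] := rp_Q0 pres.
have q0P : q0 \in mhom Q0 M by case: (rp_q0 pres).
have [U [p [TTU ps rad]]] : exists (U : fmod A) (p : 'Hom(U, M)),
    [/\ TT U, surjective_hom p & forall s, s \in mhom M U -> lker (p \o s)%VF <> 0%VS].
  case: (bongartz wideW pres WQ0) => [TTQ0|].
    exists Q0, q0; split=> //; first exact: (rp_q0 pres).
    (* If q0 s were invertible, M would be a retract of Q0 and hence projective in W. *)
    move=> s sP inj; apply: nP; split=> // X Y g f WX WY gs fP.
    have [a [aP aK Ka]] : exists a : 'End(M), [/\ a \in mhom M M,
        cancel (q0 \o s)%VF a & cancel a (q0 \o s)%VF].
      apply: bij_inv; split=> //; try exact: mhom_comp.
      exact/end_surj_inj.
    have faP : (f \o (a \o q0))%VF \in mhom Q0 Y by do 2!apply: mhom_comp => //.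
    have [h hP hE] := projective_lift (rp_Q0 pres) WX WY gs faP.
    exists (h \o s)%VF; first exact: mhom_comp.
    apply/lfunP=> m; rewrite !comp_lfunE -hE !comp_lfunE.
    by rewrite -[q0 _]comp_lfunE aK.
  move=> [k [N [U [inj [pr [al [be H]]]]]]].
  have [[homs pi pi0 sN] [alP bes beal bek] [TTU WN] approx rad] := H.
  have WU : W U by case: TTU.
  have [beP beS] := iffLR (surj_homP _) bes.
  have injP i : inj i \in mhom M N by case: (homs i).
  have prP i : pr i \in mhom N M by case: (homs i).
  have [p pP pE] := approx _ _ (extorth_M pres) q0P.
  exists U, p; split=> // [|s sP psi].
    apply/surj_homP; split=> // m; have /surj_homP[_ /(_ m)[x <-]] := rp_q0 pres.
    by exists (al x).
  have [e [eP en eI]] := socle_end indecM.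
  (* Lift [inj ord0 \o q0] to Q0 -> U and extend it along [al] to an endomorphism g' of U. Then p
     and [pr ord0 \o be \o g'] agree on Y = Q0, so they differ by some h be. Both terms of p s =
     pr_0 be g' s + h be s are sums of radical endomorphisms, so e would kill the image of p s,
     which is M. *)
  have [g gP gE] := projective_lift (rp_Q0 pres) WU WN bes (mhom_comp q0P (injP ord0)).
  have [g' g'P g'E] := approx _ _ TTU gP.
  have dP : p - (pr ord0 \o (be \o g'))%VF \in mhom U M.
    by rewrite memvB //; do 2!apply: mhom_comp => //.
  have dE u : (p - (pr ord0 \o (be \o g'))%VF) u = p u - pr ord0 (be (g' u)).
    by rewrite add_lfunE opp_lfunE !comp_lfunE.
  have [u|h hP hE] := factor_surj bes dP.
    move=> /bek[x ->]; rewrite dE pE g'E -gE comp_lfunE pi.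
    by rewrite subrr.
  apply: en; apply/lfunP=> m; rewrite zero_lfunE.
  have psP : (p \o s)%VF \in mhom M M by apply: mhom_comp.
  have /limg_fullP/(_ m)[x <-] := iffRL (end_surj_inj _) psi.
  have -> : (p \o s)%VF x = pr ord0 (be (g' (s x))) + h (be (s x)).
    by rewrite -hE dE comp_lfunE addrC subrK.
  rewrite linearD /= [be (s x)]sN !linear_sum /= big1 ?addr0 => [|i _].
    have := eI _ x (mhom_comp (mhom_comp (mhom_comp sP g'P) beP) (prP ord0)).
    rewrite !comp_lfunE; apply; have := rad (g' \o s)%VF ord0.
    by rewrite !comp_lfunA; apply; apply: mhom_comp.
  have aP : (h \o (inj i \o (pr i \o (be \o s))))%VF \in mhom M M.
    by do 4!apply: mhom_comp => //.
  have := eI _ x aP; rewrite !comp_lfunE; apply => inj0.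
  apply: (rad s i sP); apply/lker0_eqP=> y y0.
  apply: (iffLR (lker0_eqP _) inj0).
  by rewrite 2!comp_lfunE y0 !linear0.
apply: contrapT => nM.
(* Take Y of least dimension among the quotients of M outside T(J). If a map from T(J) to Y had
   nonzero image, its cokernel would be a smaller quotient, hence in T(J), and Y would be an
   extension of two objects of T(J). *)
have [Y [q [qs WY nY Yq]]] : exists (Y : fmod A) (q : 'Hom(M, Y)),
    [/\ surjective_hom q, W Y, ~ Tgen W simple Y &
      forall X (f : 'Hom(X, Y)), f \in mhom X Y -> Tgen W simple X ->
        forall x, f x = 0].
  have ex : exists n, `[< exists (Y : fmod A) (q : 'Hom(M, Y)),
      [/\ surjective_hom q, W Y, ~ Tgen W simple Y & \dim {:Y} = n] >].
    exists (\dim {:M}); apply/asboolP; exists M, \1%VF; split=> //.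
    by apply/surj_homP; split=> [|x]; [apply: mhom1 | exists x; rewrite id_lfunE].
  case: (ex_minnP ex) => n /asboolP[Y [q [qs WY nY <-]]] nmin.
  exists Y, q; split=> // X f fP TX; apply: contrapT => fn; apply: nY.
  have WX : W X by case: TX.
  have [I [i [r [WI ii rs fE]]]] := image_exists wideW fP WX WY.
  have iP : i \in mhom I Y by case: ii.
  have [C [c [cs cV]]] := cokernel_exists iP.
  have WC : W C by apply: (wide_cokernel wideW iP (q := c)); first split.
  apply: (tors_ext (t_gen simple) (f := i) (g := c)) => //.
    exact: (tors_quotient (t_gen simple) rs TX WI).
  apply: contrapT => nC; apply: fn => x.
  have cqs : surjective_hom (c \o q)%VF.
    have [/surj_homP[cP cS] /surj_homP[qP qS]] := (cs, qs).
    apply/surj_homP; split; first exact: mhom_comp.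
    by move=> z; have [y <-] := cS z; have [m <-] := qS y; exists m; rewrite comp_lfunE.
  have : (\dim {:Y} <= \dim {:C})%N.
    by apply: nmin; apply/asboolP; exists C, (c \o q)%VF.
  have [_ cF] := cs; have := limg_ker_dim c fullv; rewrite cF capfv => <-.
  rewrite -[X in (_ <= X)%N]add0n leq_add2r leqn0 dimv_eq0 cV => /eqP i0.
  by rewrite fE; apply/eqP; rewrite -memv0 -i0 mem_limg.
have [qP qS] := iffLR (surj_homP _) qs.
have qn : q <> 0.
  move=> q00; apply: nY; apply: (tors_zero wideW (t_gen simple) WM) => y.
  by have [m <-] := qS y; rewrite q00 zero_lfunE.
(* Since all M -> U -> M are radical, e p kills the trace of M in U and factors through the
   torsion-free quotient F, which is in the heart. But F has no nonzero map to Y. *)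
have [e [eP en eI]] := socle_mhom indecM qP qn.
have WU : W U by case: TTU.
have [T [F [i [c [ic GT FF]]]]] := torsion_pair wideW pres WU.
have [[iP i0] cs cV] := ic; have [pP pS] := iffLR (surj_homP _) ps.
have WF : W F by case: FF.
have JF : Tgen W simple F.
  by apply: heart_Tgen; split=> //; apply: (tors_quotient tTT cs).
have [u|h hP hE] := factor_surj cs (mhom_comp pP eP).
  move/lkerP; rewrite -cV => /limgP[t ->]; rewrite -comp_lfunE.
  have /GenP[_ tT] := GT; apply/lkerP.
  have : t \in trace M T by rewrite tT memvf.
  apply/subvP: t; apply: trace_sub => g m gP; apply/lkerP; rewrite !comp_lfunE.
  have := eI _ m (mhom_comp (mhom_comp gP iP) pP); rewrite !comp_lfunE.
  by apply; apply: rad; apply: mhom_comp.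
apply: en; apply/lfunP=> m; have [u <-] := pS m.
by rewrite zero_lfunE -comp_lfunE hE (Yq _ _ hP JF).
Qed.

Lemma nonprojective_kappabar : ~ projective_in W M ->
  is_kappabar_d (tors W) T0 TT.
Proof.
move=> nP; suff -> : TT = Tgen W simple by apply: kappabar_heart.
have GM := nonprojective_Gen nP.
apply: incl_anti; last by apply: Tgen_min => // S [[]].
move=> X TTX; have [Y [F [i [p [ip GY FF]]]]] :=
  torsion_pair wideW pres (tors_sub tTT TTX).
apply: (tors_ext (t_gen simple) ip).
  exact: (Gen_sub wideW WM (t_gen simple) GM).
have [_ ps _] := ip; apply: heart_Tgen; split=> //.
by apply: (tors_quotient tTT ps TTX); case: FF.
Qed.
End Lattice.

(** * Minimal presentations, transpose and Nakayama functor *)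

Lemma functional_exists (K : fieldType) (U : vectType K) (V : {vspace U}) x :
  x \notin V -> exists phi : 'Hom(U, K^o),
    (forall v, v \in V -> phi v = 0) /\ phi x <> 0.
Proof.
move=> xV; have [Z [q [_ qV]]] := quotient_space V.
have qx : q x != 0 by apply: contraNneq xV => qx; rewrite -qV; apply/lkerP.
pose b := vbasis {:Z}.
have [i ci] : exists i, coord b i (q x) != 0.
  apply/existsP; rewrite -negb_forall; apply: contra qx => /forallP c0.
  rewrite (coord_vbasis (memvf (q x))) big1 // => i _.
  by rewrite (eqP (c0 i)) scale0r.
exists (linfun (coord b i : Z -> K^o) \o q)%VF; split=> [v vV|].
  rewrite comp_lfunE; have -> : q v = 0 by apply/lkerP; rewrite qV.
  by rewrite linear0.
by rewrite comp_lfunE lfunE; apply/eqP.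
Qed.

Section ModA.
Variables (K : fieldType) (A : falgType K).
Implicit Types (X Y Z P Q : fmod A).

Definition projective P := projective_in (fun _ : fmod A => True) P.

Definition mact_at X (x : X) (a : A) : X := mact X a x.

Fact mact_at_linear X (x : X) : linear (mact_at x).
Proof. by move=> k a b; apply: mactP. Qed.
HB.instance Definition _ X x := GRing.isLinear.Build K A X _ (mact_at x)
  (@mact_at_linear X x).

Definition act_vec X (x : X) : 'Hom(regular_mod A, X) := linfun (mact_at x).

Lemma act_vecE X (x : X) a : act_vec x a = mact X a x.
Proof. by rewrite lfunE. Qed.

Lemma act_vecP X (x : X) : act_vec x \in mhom (regular_mod A) X.
Proof.
by apply/mhomP=> a b; rewrite !act_vecE -mactA; congr (mact X _ x); rewrite /= lfunE.
Qed.

Fact act_vec_linear X : linear (@act_vec X).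
Proof.
move=> k x y; apply/lfunP=> a.
by rewrite add_lfunE scale_lfunE !act_vecE linearP.
Qed.
HB.instance Definition _ X := GRing.isLinear.Build K X 'Hom(regular_mod A, X) _
  (@act_vec X) (@act_vec_linear X).

Lemma regular_hom X (f : 'Hom(regular_mod A, X)) a :
  f \in mhom (regular_mod A) X -> f a = mact X a (f 1).
Proof. by move=> fP; rewrite -(mhomE _ _ fP) /= lfunE /= mulr1. Qed.

Lemma regular_projective : projective (regular_mod A).
Proof.
split=> // X Y g f _ _ /surj_homP[gP gs] fP.
have [x gx] := gs (f 1); exists (act_vec x); first exact: act_vecP.
apply/lfunP=> a; rewrite comp_lfunE act_vecE (mhomE _ _ gP) gx.
by rewrite -regular_hom.
Qed.

Lemma dirsum_projective (I : finType) (Y : I -> fmod A) P :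
  is_dirsum Y P -> (forall i, projective (Y i)) -> projective P.
Proof.
move=> /dirsumE[inj [proj [homs pi pi0 sE]]] pY; split=> // X Z g f _ _ gs fP.
have lift i : exists h, h \in mhom (Y i) X /\ (g \o h)%VF = (f \o inj i)%VF.
  have [ijP _] := homs i; have [_ pYi] := pY i.
  by have [h hP hE] := pYi X Z g _ Logic.I Logic.I gs (mhom_comp ijP fP); exists h.
pose h i := projT1 (cid (lift i)).
have hE i : h i \in mhom (Y i) X /\ (g \o h i)%VF = (f \o inj i)%VF.
  exact: (projT2 (cid (lift i))).
exists (\sum_i (h i \o proj i))%VF.
  apply: memv_suml => i _; have [hP _] := hE i; have [_ prP] := homs i.
  exact: mhom_comp.
apply/lfunP=> p; rewrite comp_lfunE sum_lfunE linear_sum /= [in RHS](sE p) linear_sum.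
apply: eq_bigr => i _; have [_ hi] := hE i.
by rewrite comp_lfunE -[g _]comp_lfunE hi comp_lfunE.
Qed.

Lemma retract_projective P Q (i : 'Hom(P, Q)) (r : 'Hom(Q, P)) :
  i \in mhom P Q -> r \in mhom Q P -> cancel i r -> projective Q -> projective P.
Proof.
move=> iP rP iK [_ pQ]; split=> // X Y g f _ _ gs fP.
have [h hP hE] := pQ X Y g _ Logic.I Logic.I gs (mhom_comp rP fP).
exists (h \o i)%VF; first exact: mhom_comp.
by rewrite comp_lfunA hE; apply/lfunP=> p; rewrite !comp_lfunE iK.
Qed.

Lemma iso_projective P Q : isomorphic P Q -> projective Q -> projective P.
Proof.
by move=> /isoP[f [g [fP gP fK _]]]; apply: retract_projective fP gP fK.
Qed.

Lemma zero_projective P : zero_mod P -> projective P.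
Proof.
move=> P0; split=> // X Y g f _ _ gs fP; exists 0; first exact: mem0v.
by apply/lfunP=> p; rewrite [p]P0 !linear0.
Qed.

Lemma free_cover X : exists n (P : fmod A) (p : 'Hom(P, X)),
  is_dirsum (fun _ : 'I_n => regular_mod A) P /\ surjective_hom p.
Proof.
have [P Pd] := power_exists (regular_mod A) (\dim {:X}).
have [inj [proj [homs pi pi0 sE]]] := dirsumE Pd.
pose b := vbasis {:X}.
exists (\dim {:X}), P, (\sum_(i < \dim {:X}) (act_vec b`_i \o proj i))%VF; split=> //.
apply/surj_homP; split.
  apply: memv_suml => i _; have [_ prP] := homs i.
  by apply: mhom_comp => //; apply: act_vecP.
move=> x; exists (\sum_(i < \dim {:X}) inj i (coord b i x *: 1)).
rewrite sum_lfunE [RHS](coord_vbasis (memvf x)); apply: eq_bigr => i _.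
rewrite comp_lfunE linear_sum (bigD1 i) //= pi big1 ?addr0 => [|j ji].
  by rewrite act_vecE mactZ mact1E.
by rewrite pi0.
Qed.

(** Take a surjection p from a projective P of least dimension. If p g is onto, p lifts through it,
    giving h = g h0 with p h = p. The Fitting image of h is a retract of P that still maps onto X,
    so by minimality it is P, and h and g are onto. *)
Lemma projective_cover_exists X : exists (P : fmod A) (p : 'Hom(P, X)),
  projective_cover p.
Proof.
have ex : exists n, `[< exists (P : fmod A) (p : 'Hom(P, X)),
    [/\ projective P, surjective_hom p & \dim {:P} = n] >].
  have [n [P [p [Pd ps]]]] := free_cover X.
  exists (\dim {:P}); apply/asboolP; exists P, p; split=> //.
  by apply: dirsum_projective Pd _ => i; apply: regular_projective.
case: (ex_minnP ex) => n /asboolP[P [p [projP ps <-]]] nmin.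
exists P, p; split=> // Y g gP pgs.
have [pP _] := iffLR (surj_homP _) ps.
have [_ lift] := projP.
have [h0 h0P h0E] := lift _ _ _ p Logic.I Logic.I pgs pP.
pose h := (g \o h0)%VF.
have hP : h \in mhom P P by apply: mhom_comp.
have ph x : p (h x) = p x by rewrite -[in RHS]h0E !comp_lfunE.
have [m [e [eP eE ee0 eee]]] := fitting hP.
have pe x : p (e x) = p x.
  by rewrite eE; elim: (m.+1) => //= j IHj; rewrite ph.
have [Q [i [[iP i0] iV]]] : exists (Q : fmod A) (i : 'Hom(Q, P)),
    injective_hom i /\ limg i = limg e.
  by apply: submodule_exists => a x; apply: limg_stable.
have [x|r rP rE] := factor_inj (conj iP i0) eP.
  by apply/limgP; rewrite iV mem_limg.
have riP : (r \o i)%VF \in mhom Q Q by apply: mhom_comp.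
have ri0 : lker (r \o i)%VF = 0%VS.
  apply/lker0_eqP=> z; rewrite comp_lfunE => rz.
  have /limgP[x ix] : i z \in limg e by rewrite -iV mem_limg.
  apply: (iffLR (lker0_eqP _) i0); rewrite ix; apply: ee0.
  by rewrite -ix rE rz linear0.
have [u [uP uK _]] : exists u : 'End(Q),
    [/\ u \in mhom Q Q, cancel (r \o i)%VF u & cancel u (r \o i)%VF].
  by apply: bij_inv; split=> //; apply/end_surj_inj.
have projQ : projective Q.
  apply: (retract_projective (i := i) (r := (u \o r)%VF)) projP => //.
    exact: mhom_comp.
  by move=> z; rewrite comp_lfunE -[r _]comp_lfunE uK.
have pis : surjective_hom (p \o i)%VF.
  apply/surj_homP; split; first exact: mhom_comp.
  have [_ pS] := iffLR (surj_homP _) ps.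
  by move=> x; have [y <-] := pS x; exists (r y); rewrite comp_lfunE -rE pe.
have dQ : (\dim {:P} <= \dim {:Q})%N.
  by apply: nmin; apply/asboolP; exists Q, (p \o i)%VF.
have /eqP iF : limg i == fullv.
  rewrite eqEdim subvf /=; apply: leq_trans dQ _.
  by rewrite limg_dim_eq // i0 capv0.
apply/surj_homP; split=> // x.
have /limgP[y ->] : x \in limg e by rewrite -iV iF memvf.
by exists (h0 (iter m h y)); rewrite eE iterS [RHS]comp_lfunE.
Qed.

Lemma minimal_presentation_exists X : exists (P1 P0 : fmod A)
  (p1 : 'Hom(P1, P0)) (p0 : 'Hom(P0, X)), minimal_presentation p1 p0.
Proof.
have [P0 [p0 c0]] := projective_cover_exists X.
have [_ [p0P _] _] := c0.
have [Z [i iker]] := kernel_exists p0P.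
have [P1 [q c1]] := projective_cover_exists Z.
by exists P1, P0, (i \o q)%VF, p0; split=> //; exists Z, i, q.
Qed.

Lemma minimal_presentation_mhom (P1 P0 X : fmod A)
    (p1 : 'Hom(P1, P0)) (p0 : 'Hom(P0, X)) : minimal_presentation p1 p0 ->
  [/\ projective P1, projective P0, p1 \in mhom P1 P0, surjective_hom p0 &
      limg p1 = lker p0].
Proof.
move=> [[pP0 p0s _] [Z [i [q [[[iP _] iV] [pP1 qs _] ->]]]]].
have [qP qF] := qs; split=> //; first exact: mhom_comp.
by rewrite -iV limg_comp qF.
Qed.

(** As p0 is essential, s is onto. Then s maps the kernel of p0 onto itself, so q t is onto, and t
    is onto because q is essential. *)
Lemma minimal_presentation_aut (P1 P0 X : fmod A)
    (p1 : 'Hom(P1, P0)) (p0 : 'Hom(P0, X))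
    (a : 'End(X)) (s : 'End(P0)) (t : 'End(P1)) : minimal_presentation p1 p0 ->
  s \in mhom P0 P0 -> t \in mhom P1 P1 ->
  (forall x, p0 (s x) = a (p0 x)) -> (forall x, p1 (t x) = s (p1 x)) ->
  lker a = 0%VS -> lker s = 0%VS /\ lker t = 0%VS.
Proof.
move=> [[_ p0s ess0] [Z [i [q [[[iP i0] iV] [_ qs ess1] ->]]]]] sP tP sE tE a0.
have [p0P p0S] := iffLR (surj_homP _) p0s.
have [qP qS] := iffLR (surj_homP _) qs.
have aF : limg a = fullv by apply/end_surj_inj.
have [_ sF] : surjective_hom s.
  apply: ess0 => //; apply/surj_homP; split; first exact: mhom_comp.
  move=> x; have /limg_fullP/(_ x)[y <-] := aF; have [z <-] := p0S y.
  by exists z; rewrite comp_lfunE sE.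
have s0 : lker s = 0%VS by apply/end_surj_inj.
split=> //; apply/end_surj_inj.
suff [_] : surjective_hom t by [].
apply: ess1 => //; apply/surj_homP; split; first exact: mhom_comp.
move=> z; have /limg_fullP/(_ (i z))[x sx] := sF.
have : x \in lker p0.
  apply/lkerP; apply: (iffLR (lker0_eqP _) a0); rewrite -sE sx.
  by apply/lkerP; rewrite -iV mem_limg.
rewrite -iV => /limgP[z' xE]; have [w qw] := qS z'.
exists w; apply: (lker_sub_inj i0); rewrite comp_lfunE -[i _]comp_lfunE tE.
by rewrite comp_lfunE qw -xE sx.
Qed.

(** Split a free cover of P and read off coordinates. *)
Lemma dual_basis P : projective P -> 
  exists n (u : 'I_n -> 'Hom(P, regular_mod A)) (d : 'I_n -> P),
  (forall i, u i \in mhom P (regular_mod A)) /\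
  forall p, p = \sum_i mact P (u i p) (d i).
Proof.
move=> [_ projP]; have [n [F [f [Fd fs]]]] := free_cover P.
have [inj [proj [homs pi pi0 sE]]] := dirsumE Fd.
have [s sP sK] := projP F P f \1%VF Logic.I Logic.I fs (mhom1 P).
have [fP _] := fs.
exists n, (fun i => (proj i \o s)%VF), (fun i => f (inj i 1)); split=> [i|p].
  by apply: mhom_comp => //; case: (homs i).
rewrite -{1}[p]id_lfunE -sK comp_lfunE {1}[s p]sE linear_sum.
apply: eq_bigr => i _; rewrite comp_lfunE -(mhomE _ _ fP).
have [ijP _] := homs i.
by rewrite (regular_hom _ ijP).
Qed.

(** * The factorisation criterion for Hom(X, D Tr) = 0 *)

Section Criterion.
Variables (P1 P0 X : fmod A) (p1 : 'Hom(P1, P0)) (N : rmod A) (q : 'Hom(star P1, N)).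
Hypotheses (projP1 : projective P1) (projP0 : projective P0).
Hypotheses (p1P : p1 \in mhom P1 P0) (qP : right_hom q) (qF : limg q = fullv).
Hypothesis qV : lker q = limg (star_map p1).

Let qK n : q (q^-1%VF n) = n.
Proof. by apply: limg_lfunVK; rewrite qF memvf. Qed.

Let starP P (u : star P) : vsval u \in mhom P (regular_mod A).
Proof. exact: subvsP. Qed.

Let dualE (phi : dual N) a n : mact (dual N) a phi n = phi (ract N a n).
Proof. by rewrite [mact _ _ _]precompE comp_lfunE. Qed.

(** The image of the tensor of u and x under the canonical map from P1^t ⊗ X to Hom(P1, X), so that
    no tensor product has to be built. *)
Let tens (u : star P1) (x : X) : 'Hom(P1, X) := (act_vec x \o vsval u)%VF.

Let tensE u x p : tens u x p = mact X (vsval u p) x.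
Proof. by rewrite comp_lfunE act_vecE. Qed.

Let tensP u x : tens u x \in mhom P1 X.
Proof. exact: mhom_comp (starP u) (act_vecP x). Qed.

Let factors := forall f, f \in mhom P1 X ->
  exists2 h, h \in mhom P0 X & forall x, f x = h (p1 x).

(* With dual bases (u_i, d_i) of P1 and (v_j, e_j) of P0, a balanced form F on
   X x P1^t is determined by g |-> sum_i F(g(d_i), u_i) on Hom(P1, X). *)
Let factors_hom0 : factors -> mhom X (dual N) = 0%VS.
Proof.
move=> fac; apply/mhom0P=> f fP x; apply/lfunP=> n; rewrite zero_lfunE -[n]qK.
move: (q^-1%VF n) => u {n}.
have [n [b [d [bP bE]]]] := dual_basis projP1.
have [m [c [e [cP cE]]]] := dual_basis projP0.
pose b' i : star P1 := vsproj _ (b i); pose c' j : star P0 := vsproj _ (c j).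
have b'E i : vsval (b' i) = b i by apply: vsprojK.
have c'E i : vsval (c' i) = c i by apply: vsprojK.
have key u' x' : f x' (q u') = \sum_i f (mact X (vsval u' (d i)) x') (q (b' i)).
  have uE : u' = \sum_i ract (star P1) (vsval u' (d i)) (b' i).
    apply: val_inj; apply/lfunP=> p; rewrite /= linear_sum sum_lfunE.
    rewrite {1}[p]bE linear_sum; apply: eq_bigr => i _.
    rewrite /= star_actE b'E; have /mhomP -> := starP u'.
    by rewrite /= lfunE.
  rewrite {1}uE !linear_sum; apply: eq_bigr => i _ /=.
  by rewrite qP -dualE -(mhomE _ _ fP).
have [h hP hE] := fac _ (tensP u x).
rewrite key.
transitivity (\sum_j f (h (e j)) (q (star_map p1 (c' j)))); last first.
  rewrite big1 // => j _.
  have -> : q (star_map p1 (c' j)) = 0 by apply/lkerP; rewrite qV mem_limg.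
  by rewrite linear0.
under [RHS]eq_bigr => j _ do rewrite key.
rewrite exchange_big /=; apply: eq_bigr => i _.
rewrite -sum_lfunE -linear_sum; congr (f _ _).
rewrite -tensE hE [p1 (d i)]cE linear_sum; apply: eq_bigr => j _.
by rewrite /= (mhomE _ _ hP) star_mapE // c'E.
Qed.

(** If phi does not factor, a functional Phi separates it from the maps that do. Then x |-> (u |->
    Phi (tens u x)) induces a homomorphism X -> D N, which is zero by hypothesis. But phi is a sum
    of tensors by the dual basis of P1, so Phi phi = 0, a contradiction. *)
Let hom0_factors : mhom X (dual N) = 0%VS -> factors.
Proof.
move=> /mhom0P hom0 phi phiP.
have [phiV|phiV] := boolP (phi \in (precomp X p1 @: mhom P0 X)%VS).
  have /memv_imgP[h hP ->] := phiV; exists h => // x.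
  by rewrite precompE comp_lfunE.
have [Phi [Phi0 []]] := functional_exists phiV.
pose G x : 'Hom(star P1, K^o) := linfun (fun u : star P1 => Phi (tens u x)).
have GE x u : G x u = Phi (tens u x).
  have lin : linear (fun u : star P1 => Phi (tens u x)).
    by move=> k u1 u2; rewrite /tens !linearP.
  pose L := GRing.isLinear.Build K (star P1) K^o _ _ lin.
  pose g : {linear star P1 -> K^o} := HB.pack (fun u : star P1 => Phi (tens u x)) L.
  exact: (lfunE g u).
have Gker x u u' : q u = q u' -> G x u = G x u'.
  move=> quu'; have : u - u' \in lker q by apply/lkerP; rewrite linearB /= quu' subrr.
  rewrite qV => /limgP[v uE]; apply/eqP; rewrite -subr_eq0 -linearB /= uE GE.
  apply/eqP/Phi0; apply/memv_imgP; exists (act_vec x \o vsval v)%VF.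
    exact: mhom_comp (starP v) (act_vecP x).
  rewrite precompE; apply/lfunP=> p.
  by rewrite tensE !comp_lfunE act_vecE star_mapE.
pose F (x : X) : dual N := (G x \o q^-1)%VF.
have FE x u : F x (q u) = Phi (tens u x).
  by rewrite comp_lfunE -GE; apply: Gker; rewrite qK.
have Flin : linear F.
  move=> k x y; apply/lfunP=> n; rewrite -[n]qK add_lfunE scale_lfunE !FE.
  rewrite -linearP; congr (Phi _); apply/lfunP=> p.
  by rewrite add_lfunE scale_lfunE !tensE linearP.
pose L := GRing.isLinear.Build K X (dual N) _ F Flin.
pose f : {linear X -> dual N} := HB.pack F L.
have fP : linfun f \in mhom X (dual N).
  apply: mhom_linfun => a x; apply/lfunP=> n; rewrite -[n]qK dualE /= -qP !FE.
  congr (Phi _); apply/lfunP=> p.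
  by rewrite !tensE star_actE mactA.
have [n [b [d [bP bE]]]] := dual_basis projP1.
pose b' i : star P1 := vsproj _ (b i).
have b'E i : vsval (b' i) = b i by apply: vsprojK.
have -> : phi = \sum_i tens (b' i) (phi (d i)).
  apply/lfunP=> p; rewrite sum_lfunE {1}[p]bE linear_sum; apply: eq_bigr => i _.
  by rewrite /= (mhomE _ _ phiP) tensE b'E.
rewrite linear_sum big1 // => i _; rewrite /= -FE.
have := hom0 _ fP (phi (d i)); rewrite lfunE /= => ->.
by rewrite zero_lfunE.
Qed.

(** Conceptually, Hom(X, D N) is dual to N ⊗ X, the cokernel of Hom(P0, X) -> Hom(P1, X). *)
Lemma mhom_dual_eq0 : mhom X (dual N) = 0%VS <-> factors.
Proof. by split; [exact: hom0_factors | exact: factors_hom0]. Qed.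
End Criterion.

(** The criterion for P1 = P, P0 = 0 and N = P^t, where only the zero map factors. *)
Lemma mhom_nakayama_eq0 P X : projective P ->
  mhom X (nakayama P) = 0%VS <-> mhom P X = 0%VS.
Proof.
move=> projP; have [Z Z0] := zero_mod_exists A.
have [||||to fro] := @mhom_dual_eq0 P Z X 0 (star P) \1%VF projP (zero_projective Z0).
- exact: mem0v.
- by move=> a x; rewrite !id_lfunE.
- by apply/limg_fullP=> x; exists x; rewrite id_lfunE.
- apply/vspaceP=> u; apply/lkerP/limgP=> [|[v ->]].
    by rewrite id_lfunE => ->; exists 0; rewrite linear0.
  rewrite id_lfunE; apply: val_inj; apply/lfunP=> p.
  by rewrite star_mapE ?mem0v // !zero_lfunE linear0.
split=> [/to fac|PX].
  apply/mhom0P=> f fP p; have [h _ ->] := fac _ fP.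
  by rewrite zero_lfunE linear0.
apply: fro => f; rewrite PX memv0 => /eqP ->; exists 0 => [|x]; first exact: mem0v.
by rewrite !zero_lfunE.
Qed.

Lemma transpose_exists X : exists N : rmod A, is_transpose X N.
Proof.
have [P1 [P0 [p1 [p0 pres]]]] := minimal_presentation_exists X.
have [_ _ p1P _ _] := minimal_presentation_mhom pres.
pose V := limg (star_map p1).
have [Z [q [qF qV]]] := quotient_space V.
have qK z : q (q^-1%VF z) = z by apply: limg_lfunVK; rewrite qF memvf.
pose S := star P1.
have V_stable a u : u \in V -> ract S a u \in V.
  move=> /limgP[v ->]; apply/limgP; exists (ract (star P0) a v).
  apply: val_inj; apply/lfunP=> p.
  by rewrite /= star_actE !star_mapE // star_actE.
pose act a : 'End(Z) := (q \o (ract S a \o q^-1))%VF.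
have qact a x : act a (q x) = q (ract S a x).
  rewrite !comp_lfunE; apply/eqP; rewrite -subr_eq0 -!linearB; apply/eqP/lkerP.
  by rewrite qV V_stable // -qV; apply/lkerP; rewrite linearB /= qK subrr.
have act_linear : linear act.
  move=> k a b; apply/lfunP=> z; rewrite -[z]qK add_lfunE scale_lfunE !qact.
  by rewrite ract_linear add_lfunE scale_lfunE linearP.
have act1 : act 1 = \1%VF.
  by apply/lfunP=> z; rewrite -[z]qK qact ract1 !id_lfunE.
have actM a b : act (a * b) = (act b \o act a)%VF.
  by apply/lfunP=> z; rewrite -[z]qK comp_lfunE !qact ractM comp_lfunE.
exists (Rmod act_linear act1 actM), P1, P0, p1, p0, q.
split=> // a x; exact/esym/qact.
Qed.
End ModA.

(** * Transport along an equivalence *)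

Section Equivalence.
Variables (K : fieldType) (A B : falgType K) (W : subcat A).
Hypothesis wideW : wide W.
Variable E : mod_equivalence B W.
Implicit Types (X Y Z Q M T : fmod A).

Local Notation emor f := (emor E f).

Let faithful X Y (f g : 'Hom(X, Y)) : W X -> W Y ->
  f \in mhom X Y -> g \in mhom X Y -> emor f = emor g -> f = g.
Proof. exact: emor_faithful. Qed.

Let full X Y (h : 'Hom(E X, E Y)) : W X -> W Y -> h \in mhom (E X) (E Y) ->
  exists2 f, f \in mhom X Y & emor f = h.
Proof. exact: emor_full. Qed.

Lemma emorE X Y Z (f : 'Hom(X, Y)) (g : 'Hom(Y, Z)) x :
  W X -> W Y -> W Z -> f \in mhom X Y -> g \in mhom Y Z ->
  emor (g \o f)%VF x = emor g (emor f x).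
Proof. by move=> *; rewrite emor_comp // comp_lfunE. Qed.

Lemma emor_eq0 X Y (f : 'Hom(X, Y)) : W X -> W Y -> f \in mhom X Y ->
  emor f = 0 <-> f = 0.
Proof.
move=> WX WY fP; have e0 : emor (0 : 'Hom(X, Y)) = 0.
  have := @emor_linear _ _ _ _ E X Y (-1) 0 0 WX WY (mem0v _) (mem0v _).
  by rewrite scaler0 addr0 scaleN1r addNr.
split=> [ef|->] //; apply: (faithful WX WY fP (mem0v _)).
by rewrite ef e0.
Qed.

Lemma iso_lift (N : fmod B) : exists2 X, W X & exists (f : 'Hom(E X, N))
  (g : 'Hom(N, E X)), [/\ f \in mhom _ _, g \in mhom _ _, cancel f g & cancel g f].
Proof. by have [X WX /isoP XN] := eob_dense E N; exists X. Qed.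

(** Surjectivity means that the projection onto the cokernel is zero. Cokernels in mod A of maps in
    W stay in W, and the equivalence preserves and reflects zero maps. [emor_inj] is dual. *)
Lemma emor_surj X Y (f : 'Hom(X, Y)) : W X -> W Y -> f \in mhom X Y ->
  surjective_hom (emor f) <-> surjective_hom f.
Proof.
move=> WX WY fP; have eP := emor_hom E WX WY fP; split=> fs.
  have [C [q [qs qV]]] := cokernel_exists fP; have [qP qS] := iffLR (surj_homP _) qs.
  have WC : W C by apply: (wide_cokernel wideW fP (q := q)).
  have q0 : q = 0.
    apply/(emor_eq0 WY WC qP)/lfunP=> y; have [_ /(_ y)[x <-]] := iffLR (surj_homP _) fs.
    rewrite -emorE // zero_lfunE.
    suff -> : (q \o f)%VF = 0.
      have -> : emor (0 : 'Hom(X, C)) = 0 by apply/emor_eq0; rewrite ?mem0v.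
      by rewrite zero_lfunE.
    apply/lfunP=> z; rewrite comp_lfunE zero_lfunE.
    by apply/lkerP; rewrite qV mem_limg.
  split=> //; apply/vspaceP=> y; rewrite memvf -qV.
  by apply/lkerP; rewrite q0 zero_lfunE.
have [C [q [qs qV]]] := cokernel_exists eP; have [qP _] := qs.
have [C' WC' [u [v [uP vP uK vK]]]] := iso_lift C.
have [g gP gE] := full WY WC' (mhom_comp qP vP).
have g0 : g = 0.
  apply/lfunP=> y; have [_ /(_ y)[x <-]] := iffLR (surj_homP _) fs.
  rewrite -comp_lfunE zero_lfunE.
  suff -> : (g \o f)%VF = 0 by rewrite zero_lfunE.
  apply/(emor_eq0 WX WC'); first exact: mhom_comp.
  apply/lfunP=> z; rewrite emorE // gE comp_lfunE zero_lfunE.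
  suff -> : q (emor f z) = 0 by rewrite linear0.
  by apply/lkerP; rewrite qV mem_limg.
split=> //; apply/vspaceP=> y; rewrite memvf -qV; apply/lkerP.
rewrite -[q y]vK -[v _]comp_lfunE -gE.
by rewrite (iffRL (emor_eq0 WY WC' gP) g0) zero_lfunE linear0.
Qed.

Lemma emor_inj X Y (f : 'Hom(X, Y)) : W X -> W Y -> f \in mhom X Y ->
  lker (emor f) = 0%VS <-> lker f = 0%VS.
Proof.
move=> WX WY fP; have eP := emor_hom E WX WY fP; split=> f0.
  have [C [q qk]] := kernel_exists fP; have [[qP qi] qV] := qk.
  have WC : W C by apply: (wide_kernel wideW fP qk).
  have q0 : q = 0.
    apply/(emor_eq0 WC WX qP)/lfunP=> y; rewrite zero_lfunE.
    apply: (iffLR (lker0_eqP _) f0); rewrite -emorE //.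
    suff -> : (f \o q)%VF = 0.
      have -> : emor (0 : 'Hom(C, Y)) = 0 by apply/emor_eq0; rewrite ?mem0v.
      by rewrite zero_lfunE.
    apply/lfunP=> z; rewrite comp_lfunE zero_lfunE.
    by apply/lkerP; rewrite -qV mem_limg.
  apply/eqP; rewrite -subv0 -qV; apply/subvP=> _ /limgP[z ->].
  by rewrite q0 zero_lfunE mem0v.
have [C [q [[qP qi] qV]]] := kernel_exists eP.
have [C' WC' [u [v [uP vP uK vK]]]] := iso_lift C.
have [g gP gE] := full WC' WX (mhom_comp uP qP).
have g0 : g = 0.
  apply/lfunP=> y; rewrite zero_lfunE; apply: (iffLR (lker0_eqP _) f0).
  rewrite -comp_lfunE; suff -> : (f \o g)%VF = 0 by rewrite zero_lfunE.
  apply/(emor_eq0 WC' WY); first exact: mhom_comp.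
  apply/lfunP=> z; rewrite emorE // gE comp_lfunE zero_lfunE.
  by apply/lkerP; rewrite -qV mem_limg.
apply/eqP; rewrite -subv0 -qV; apply/subvP=> _ /limgP[z ->].
rewrite -[z]vK -comp_lfunE -gE.
by rewrite (iffRL (emor_eq0 WC' WX gP) g0) zero_lfunE mem0v.
Qed.

Lemma mhom_emor_eq0 X Y : W X -> W Y ->
  mhom (E X) (E Y) = 0%VS <-> mhom X Y = 0%VS.
Proof.
move=> WX WY; split=> h0; apply/mhom0P=> f fP x.
  suff -> : f = 0 by rewrite zero_lfunE.
  apply/(emor_eq0 WX WY fP)/lfunP=> y.
  by rewrite (iffLR (mhom0P _ _) h0) ?zero_lfunE //; apply: emor_hom.
have [g gP <-] := full WX WY fP.
have -> : g = 0 by apply/eqP; rewrite -memv0 -h0.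
by rewrite (iffRL (emor_eq0 WX WY (mem0v _))) ?zero_lfunE.
Qed.

Lemma mhom_iso_eq0 (N Y Y' : fmod B) : isomorphic Y Y' ->
  mhom N Y = 0%VS <-> mhom N Y' = 0%VS.
Proof.
have imp (Z Z' : fmod B) : isomorphic Z Z' -> mhom N Z = 0%VS -> mhom N Z' = 0%VS.
  move=> /isoP[f [g [fP gP fK gK]]] /mhom0P N0; apply/mhom0P=> h hP n.
  by rewrite -[h n]gK -[g _]comp_lfunE N0 ?linear0 // mhom_comp.
by move=> YY'; split; apply: imp; last exact: iso_sym.
Qed.

Lemma emor_projective Q : W Q -> projective (E Q) <-> projective_in W Q.
Proof.
move=> WQ; split=> [[_ pQ]|[_ pQ]]; split=> //.
  move=> X Y g f WX WY gs fP; have [gP _] := gs.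
  have [||h hP hE] := pQ _ _ (emor g) (emor f) Logic.I Logic.I.
  - exact/emor_surj.
  - exact: emor_hom.
  have [k kP kE] := full WQ WX hP; exists k => //.
  apply: (faithful WQ WY); rewrite ?mhom_comp //.
  by rewrite emor_comp // kE hE.
move=> X Y g f _ _ gs fP.
have [gP gS] := iffLR (surj_homP _) gs.
have [X' WX' [ux [vx [uxP vxP uxK vxK]]]] := iso_lift X.
have [Y' WY' [uy [vy [uyP vyP uyK vyK]]]] := iso_lift Y.
have [g' g'P g'E] := full WX' WY' (mhom_comp (mhom_comp uxP gP) vyP).
have [f' f'P f'E] := full WQ WY' (mhom_comp fP vyP).
have g's : surjective_hom g'.
  apply/(emor_surj WX' WY' g'P); rewrite g'E; apply/surj_homP; split.
    by do 2!apply: mhom_comp => //.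
  move=> y; have [x gx] := gS (uy y); exists (vx x).
  by rewrite !comp_lfunE vxK gx uyK.
have [h hP hE] := pQ _ _ g' f' WX' WY' g's f'P.
exists (ux \o emor h)%VF; first by apply: mhom_comp => //; apply: emor_hom.
apply/lfunP=> y; apply: (can_inj vyK); rewrite -[vy (f y)]comp_lfunE -f'E -hE.
by rewrite emorE // g'E !comp_lfunE.
Qed.

Lemma nakayama_mhom M N X : W M -> W N -> W X -> projective_in W M ->
  isomorphic (E N) (nakayama (E M)) -> mhom X N = 0%VS <-> mhom M X = 0%VS.
Proof.
move=> WM WN WX pM iso; have pEM : projective (E M) by apply/emor_projective.
by rewrite -!mhom_emor_eq0 // (mhom_iso_eq0 _ iso) mhom_nakayama_eq0.
Qed.

(* The presentation is that of E M, pulled back to W. *)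
Lemma AR_translate_presentation M T : W M -> W T -> is_AR_translate (E M) (E T) ->
  exists (Q1 Q0 : fmod A) (q1 : 'Hom(Q1, Q0)) (q0 : 'Hom(Q0, M)),
    lperp W T = extorth W q1 /\
    (mhom M T = 0%VS -> rigid_presentation W q1 q0).
Proof.
move=> WM WT [N [P1 [P0 [p1 [p0 [q [mpres qP qF qV]]]]]] isoT].
have [pP1 pP0 p1P p0s pex] := minimal_presentation_mhom mpres.
have [p0P p0S] := iffLR (surj_homP _) p0s.
have [Q1 WQ1 [u1 [v1 [u1P v1P u1K v1K]]]] := iso_lift P1.
have [Q0 WQ0 [u0 [v0 [u0P v0P u0K v0K]]]] := iso_lift P0.
have [q1 q1P q1E] := full WQ1 WQ0 (mhom_comp (mhom_comp u1P p1P) v0P).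
have [q0 q0P q0E] := full WQ0 WM (mhom_comp u0P p0P).
have e1 x : emor q1 x = v0 (p1 (u1 x)) by rewrite q1E !comp_lfunE.
have e0 x : emor q0 x = p0 (u0 x) by rewrite q0E !comp_lfunE.
have orth : lperp W T = extorth W q1.
  apply: subcat_ext => X.
  suff eqv : W X -> (mhom X T = 0%VS <-> forall f, f \in mhom Q1 X ->
      exists2 h, h \in mhom Q0 X & forall x, f x = h (q1 x)).
    by split=> -[WX H]; split=> //; apply/eqv.
  move=> WX; rewrite -mhom_emor_eq0 // (mhom_iso_eq0 _ isoT).
  rewrite (mhom_dual_eq0 _ pP1 pP0 p1P qP qF qV); split=> fac f fP.
    have eP := emor_hom E WQ1 WX fP.
    have [h hP hE] := fac _ (mhom_comp v1P eP).
    have [k kP kE] := full WQ0 WX (mhom_comp u0P hP).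
    exists k => // x; rewrite -comp_lfunE; congr (fun_of_lfun _ x).
    apply: (faithful WQ1 WX fP); first exact: mhom_comp.
    apply/lfunP=> y; rewrite emorE // kE comp_lfunE e1 v0K -hE comp_lfunE.
    by rewrite u1K.
  have [k kP kE] := full WQ1 WX (mhom_comp u1P fP).
  have [h hP hE] := fac _ kP.
  exists (emor h \o v0)%VF; first by apply: mhom_comp => //; apply: emor_hom.
  move=> x; rewrite comp_lfunE -[x]v1K -[f _]comp_lfunE -kE.
  have -> : k = (h \o q1)%VF by apply/lfunP=> y; rewrite comp_lfunE.
  by rewrite emorE // e1 v1K.
exists Q1, Q0, q1, q0; split=> // MT.
have MQ : extorth W q1 M by rewrite -orth.
have q0s : surjective_hom q0.
  apply/(emor_surj WQ0 WM q0P)/surj_homP; split; first exact: emor_hom.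
  by move=> y; have [x <-] := p0S y; exists (v0 x); rewrite e0 v0K.
have p01 x : p0 (p1 x) = 0 by apply/lkerP; rewrite -pex mem_limg.
have q01 x : q0 (q1 x) = 0.
  rewrite -comp_lfunE; suff -> : (q0 \o q1)%VF = 0 by rewrite zero_lfunE.
  apply/(emor_eq0 WQ1 WM); first exact: mhom_comp.
  by apply/lfunP=> y; rewrite emorE // e1 e0 v0K p01 zero_lfunE.
split=> //; last by case: MQ.
- by apply/(emor_projective WQ1); apply: iso_projective pP1; apply/isoP; exists u1, v1.
- by apply/(emor_projective WQ0); apply: iso_projective pP0; apply/isoP; exists u0, v0.
(* Exactness at Q0: the corestriction r of q1 to the kernel of q0 is onto because its image under E
   is, by a chase in the presentation of E M. *)
- have [Z [i ik]] := kernel_exists q0P; have [[iP i0] iV] := ik.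
  have WZ : W Z by apply: (wide_kernel wideW q0P ik).
  have [x|r rP rE] := factor_inj (conj iP i0) q1P.
    by apply/limgP; rewrite iV; apply/lkerP.
  suff [_ rF] : surjective_hom r.
    rewrite -iV; have -> : q1 = (i \o r)%VF by apply/lfunP=> x; rewrite comp_lfunE.
    by rewrite limg_comp rF.
  apply/(emor_surj WQ1 WZ rP)/surj_homP; split; first exact: emor_hom.
  move=> z; have : u0 (emor i z) \in lker p0.
    apply/lkerP; rewrite -e0 -emorE //.
    suff -> : (q0 \o i)%VF = 0.
      by rewrite (iffRL (emor_eq0 WZ WM (mem0v _))) ?zero_lfunE.
    apply/lfunP=> y; rewrite comp_lfunE zero_lfunE.
    by apply/lkerP; rewrite -iV mem_limg.
  rewrite -pex => /limgP[w wE]; exists (v1 w).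
  apply: (lker_sub_inj (iffRL (emor_inj WZ WQ0 iP) i0)).
  rewrite -emorE //; have -> : (i \o r)%VF = q1.
    by apply/lfunP=> x; rewrite comp_lfunE -rE.
  by rewrite e1 v1K -wE u0K.
move=> a s t aP sP tP sE tE a0.
have esP := emor_hom E WQ0 WQ0 sP; have etP := emor_hom E WQ1 WQ1 tP.
(* Conjugating with u and v turns s and t into chain endomorphisms of the minimal presentation over
   B. *)
have sE' x : p0 ((u0 \o (emor s \o v0))%VF x) = emor a (p0 x).
  rewrite !comp_lfunE -e0 -emorE // -{2}[x]v0K -e0 -emorE //.
  by congr (emor _ _); apply/lfunP=> y; rewrite !comp_lfunE.
have tE' x : p1 ((u1 \o (emor t \o v1))%VF x) = (u0 \o (emor s \o v0))%VF (p1 x).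
  rewrite !comp_lfunE -{2}[x]v1K; apply: (can_inj v0K); rewrite u0K.
  rewrite -!e1 -!emorE //.
  by congr (emor _ _); apply/lfunP=> y; rewrite !comp_lfunE.
have [] := minimal_presentation_aut mpres _ _ sE' tE'.
- by do 2!apply: mhom_comp => //.
- by do 2!apply: mhom_comp => //.
- exact/emor_inj.
move=> s0 t0; split.
  apply/(emor_inj WQ0 WQ0 sP)/lker0_eqP=> x sx; rewrite -[x]u0K.
  rewrite (iffLR (lker0_eqP _) s0 (u0 x)) ?linear0 //.
  by rewrite !comp_lfunE u0K sx linear0.
apply/(emor_inj WQ1 WQ1 tP)/lker0_eqP=> x tx; rewrite -[x]u1K.
rewrite (iffLR (lker0_eqP _) t0 (u1 x)) ?linear0 //.
by rewrite !comp_lfunE u1K tx linear0.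
Qed.
End Equivalence.

(** * Functorially finite wide subcategories are module categories *)

Section OppositeEndomorphisms.
Variables (K : fieldType) (A : falgType K) (P : fmod A).

(** The hypothesis is a parameter of the type because the algebra instances below have to know that
    1 is nonzero. *)
Definition endop & ~ zero_mod P := subvs_of (mhom P P).

Variable P_nz : ~ zero_mod P.
Local Notation B := (endop P_nz).

HB.instance Definition _ := Vector.copy B (subvs_of (mhom P P)).

Fact endop_valD (f g : B) : vsval (f + g) = vsval f + vsval g.
Proof. by []. Qed.

Fact endop_valZ k (f : B) : vsval (k *: f) = k *: vsval f.
Proof. by []. Qed.

(** The reversed order makes Hom(P, X) a left module under precomposition. *)
Definition endop_mul (f g : B) : B := vsproj (mhom P P) (vsval g \o vsval f)%VF.
Definition endop_one : B := vsproj (mhom P P) \1%VF.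

Fact endop_mulE (f g : B) : vsval (endop_mul f g) = (vsval g \o vsval f)%VF.
Proof. by rewrite vsprojK // mhom_comp // subvsP. Qed.

Fact endop_oneE : vsval endop_one = \1%VF.
Proof. by rewrite vsprojK // mhom1. Qed.

Fact endop_mulA : associative endop_mul.
Proof. by move=> f g h; apply: val_inj; rewrite /= !endop_mulE comp_lfunA. Qed.

Fact endop_mul1l : left_id endop_one endop_mul.
Proof. by move=> f; apply: val_inj; rewrite /= endop_mulE endop_oneE comp_lfun1r. Qed.

Fact endop_mul1r : right_id endop_one endop_mul.
Proof. by move=> f; apply: val_inj; rewrite /= endop_mulE endop_oneE comp_lfun1l. Qed.

Fact endop_mulDl : left_distributive endop_mul +%R.
Proof.
move=> f g h; apply: val_inj.
by rewrite /= [RHS]endop_valD !endop_mulE endop_valD comp_lfunDr.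
Qed.

Fact endop_mulDr : right_distributive endop_mul +%R.
Proof.
move=> f g h; apply: val_inj.
by rewrite /= [RHS]endop_valD !endop_mulE endop_valD comp_lfunDl.
Qed.

Fact endop_one_neq0 : endop_one != 0 :> B.
Proof.
apply/eqP=> /(congr1 (@vsval _ _ _)); rewrite endop_oneE => e.
by apply: P_nz => x; rewrite -[x]id_lfunE e zero_lfunE.
Qed.

HB.instance Definition _ := GRing.Zmodule_isNzRing.Build B
  endop_mulA endop_mul1l endop_mul1r endop_mulDl endop_mulDr endop_one_neq0.

Fact endop_scaleAl (k : K) (f g : B) : k *: (f * g) = (k *: f) * g.
Proof.
by apply: val_inj; rewrite /= [LHS]endop_valZ !endop_mulE endop_valZ comp_lfunZr.
Qed.
HB.instance Definition _ := GRing.Lmodule_isLalgebra.Build K B endop_scaleAl.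

Fact endop_scaleAr (k : K) (f g : B) : k *: (f * g) = f * (k *: g).
Proof.
by apply: val_inj; rewrite /= [LHS]endop_valZ !endop_mulE endop_valZ comp_lfunZl.
Qed.
HB.instance Definition _ := GRing.Lalgebra_isAlgebra.Build K B endop_scaleAr.
HB.instance Definition _ := Algebra_isFalgebra.Build K B.

Section HomFrom.
Variable X : fmod A.
Local Notation H := (subvs_of (mhom P X)).

Definition hact_fun (b : B) (f : H) : H := vsproj (mhom P X) (vsval f \o vsval b)%VF.

Fact hact_funE b f : vsval (hact_fun b f) = (vsval f \o vsval b)%VF.
Proof. by rewrite vsprojK // mhom_comp // subvsP. Qed.

Fact hact_fun_linear b : linear (hact_fun b).
Proof.
move=> k f g; apply: val_inj; rewrite /= !hact_funE linearP.
by rewrite comp_lfunDl -comp_lfunZl.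
Qed.
HB.instance Definition _ b := GRing.isLinear.Build K H H _ (hact_fun b)
  (hact_fun_linear b).

Definition hact (b : B) : 'End(H) := linfun (hact_fun b).

Fact hactE b (f : H) : vsval (hact b f) = (vsval f \o vsval b)%VF.
Proof. by rewrite lfunE /= hact_funE. Qed.

Fact hact_linear : linear hact.
Proof.
move=> k a b; apply/lfunP=> f; apply: val_inj; rewrite add_lfunE scale_lfunE /=.
by rewrite !hactE endop_valD endop_valZ comp_lfunDr comp_lfunZr.
Qed.

Fact hact1 : hact 1 = \1%VF.
Proof.
apply/lfunP=> f; apply: val_inj; rewrite /= hactE id_lfunE endop_oneE.
by rewrite comp_lfun1r.
Qed.

Fact hactM a b : hact (a * b) = (hact a \o hact b)%VF.
Proof.
apply/lfunP=> f; apply: val_inj; rewrite /= hactE comp_lfunE !hactE endop_mulE.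
by rewrite comp_lfunA.
Qed.

Definition homfrom : fmod B := Fmod hact_linear hact1 hactM.
End HomFrom.

Section HomFromMap.
Variables (X Y : fmod A) (f : 'Hom(X, Y)).

Definition homfrom_map_fun (g : homfrom X) : homfrom Y :=
  vsproj (mhom P Y) (f \o vsval g)%VF.

Fact homfrom_map_linear : linear homfrom_map_fun.
Proof.
move=> k g h; rewrite /homfrom_map_fun.
have -> : (f \o vsval (k *: g + h) = k *: (f \o vsval g) + (f \o vsval h))%VF.
  by rewrite comp_lfunZr -comp_lfunDr.
exact: vsproj_is_linear.
Qed.
HB.instance Definition _ := GRing.isLinear.Build K (homfrom X) (homfrom Y) _
  homfrom_map_fun homfrom_map_linear.

Definition homfrom_map : 'Hom(homfrom X, homfrom Y) := linfun homfrom_map_fun.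

Fact homfrom_mapE (g : homfrom X) : f \in mhom X Y ->
  vsval (homfrom_map g) = (f \o vsval g)%VF.
Proof. by move=> fP; rewrite lfunE /= vsprojK // mhom_comp // subvsP. Qed.
End HomFromMap.
End OppositeEndomorphisms.

(** * The equivalence Hom(P, -) for a reflection P of A *)

Section Reflection.
Variables (K : fieldType) (A : falgType K) (W : subcat A).
Hypothesis wideW : wide W.
Implicit Types (X Y Z : fmod A).

(* A left W-approximation of A of minimal dimension is a reflection of A into
   W, hence represents the forgetful functor on W. *)
Lemma reflection_exists (X0 : fmod A) : W X0 -> functorially_finite W ->
  exists (P : fmod A) (p : P), [/\ W P,
    forall Z z, W Z -> exists2 h : 'Hom(P, Z), h \in mhom P Z & h p = z &
    forall Z (h : 'Hom(P, Z)), W Z -> h \in mhom P Z -> h p = 0 -> h = 0].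
Proof.
move=> WX0 ffW.
have ex : exists n, `[< exists (Y : fmod A) (f : 'Hom(regular_mod A, Y)),
    left_approximation W f /\ \dim {:Y} = n >].
  have [_ [Y [f fa]]] := ffW (regular_mod A).
  by exists (\dim {:Y}); apply/asboolP; exists Y, f.
case: (ex_minnP ex) => n /asboolP[P [f [[WP fP fa] <-]]] nmin.
exists P, (f 1); split=> // [Z z WZ|Z h WZ hP hp].
  have [h hP hE] := fa Z (act_vec z) WZ (act_vecP z); exists h => //.
  by rewrite -comp_lfunE -hE act_vecE mact1E.
(* If h kills f 1, then f lands in the kernel Q of h, and its corestriction is again a left
   approximation. By minimality Q = P, so h = 0. *)
have [Q [i ik]] := kernel_exists hP; have [[iP i0] iV] := ik.
have WQ : W Q by apply: (wide_kernel wideW hP ik).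
have [a|g gP gE] := factor_inj (conj iP i0) fP.
  apply/limgP; rewrite iV; apply/lkerP.
  by rewrite (regular_hom _ fP) (mhomE _ _ hP) hp linear0.
have dQ : (\dim {:P} <= \dim {:Q})%N.
  apply: nmin; apply/asboolP; exists Q, g; split=> //; split=> // Z' k WZ' kP.
  have [l lP ->] := fa _ _ WZ' kP; exists (l \o i)%VF; first exact: mhom_comp.
  by apply/lfunP=> a; rewrite !comp_lfunE gE.
have /eqP iF : limg i == fullv.
  rewrite eqEdim subvf /=; apply: leq_trans dQ _.
  by rewrite limg_dim_eq // i0 capv0.
apply/lfunP=> x; rewrite zero_lfunE; apply/lkerP.
by rewrite -iV iF memvf.
Qed.

Section Equivalence.
Variables (P : fmod A) (p : P).
Hypothesis P_nz : ~ zero_mod P.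
Hypothesis WP : W P.
Hypothesis reflE : forall Z z, W Z ->
  exists2 h : 'Hom(P, Z), h \in mhom P Z & h p = z.
Hypothesis refl_uniq : forall Z (h : 'Hom(P, Z)), W Z -> h \in mhom P Z ->
  h p = 0 -> h = 0.
Local Notation B := (endop P_nz).
Local Notation E := (homfrom P_nz).

Let subP Z (h : E Z) : vsval h \in mhom P Z. Proof. exact: subvsP. Qed.

Let uniq Z (g h : E Z) : W Z -> vsval g p = vsval h p -> g = h.
Proof.
move=> WZ gh; apply: val_inj; apply/eqP; rewrite -subr_eq0 /=; apply/eqP.
apply: refl_uniq => //; first by apply: memvB; apply: subP.
by rewrite add_lfunE opp_lfunE gh subrr.
Qed.

Let exE Z z : W Z -> exists h : E Z, vsval h p = z.
Proof.
by move=> WZ; have [h hP hz] := reflE z WZ; exists (vsproj (mhom P Z) h); rewrite vsprojK.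
Qed.

Let actE Z b (h : E Z) : vsval (mact (E Z) b h) = (vsval h \o vsval b)%VF.
Proof. exact: hactE. Qed.

Let mapE X Y (f : 'Hom(X, Y)) (g : E X) x : f \in mhom X Y ->
  vsval (homfrom_map P_nz f g) x = f (vsval g x).
Proof. by move=> fP; rewrite homfrom_mapE // comp_lfunE. Qed.

(** Evaluation at p is a bijection from Hom(P, Z) to Z for Z in W; its inverse transports maps back
    from mod B. *)
Let ev Z : 'Hom(E Z, Z) := linfun (fun h : subvs_of (mhom P Z) => vsval h p).

Let evE Z (h : E Z) : ev Z h = vsval h p.
Proof.
have lin : linear (fun h : subvs_of (mhom P Z) => vsval h p).
  by move=> k f g; rewrite linearP add_lfunE scale_lfunE.
pose L := GRing.isLinear.Build K (subvs_of (mhom P Z)) Z _ _ lin.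
pose g : {linear subvs_of (mhom P Z) -> Z} :=
  HB.pack (fun h : subvs_of (mhom P Z) => vsval h p) L.
exact: (lfunE g h).
Qed.

Let evK Z z : W Z -> vsval ((ev Z)^-1%VF z : E Z) p = z.
Proof.
move=> WZ; rewrite -evE; apply: limg_lfunVK; apply/limgP.
by have [h <-] := exE z WZ; exists h; rewrite evE.
Qed.

Let map_hom X Y (f : 'Hom(X, Y)) : W X -> W Y -> f \in mhom X Y ->
  homfrom_map P_nz f \in mhom (E X) (E Y).
Proof.
move=> WX WY fP; apply/mhomP=> b h; apply: val_inj; apply/lfunP=> x.
by rewrite /= mapE // !actE !comp_lfunE mapE.
Qed.

Let map_linear X Y k (f g : 'Hom(X, Y)) : W X -> W Y ->
  f \in mhom X Y -> g \in mhom X Y ->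
  homfrom_map P_nz (k *: f + g) = k *: homfrom_map P_nz f + homfrom_map P_nz g.
Proof.
move=> WX WY fP gP; apply/lfunP=> h; apply: val_inj; apply/lfunP=> x.
rewrite /= mapE ?memvD ?memvZ // add_lfunE scale_lfunE.
by rewrite add_lfunE scale_lfunE /= add_lfunE scale_lfunE !mapE.
Qed.

Let map_id X : W X -> homfrom_map P_nz (\1%VF : 'Hom(X, X)) = \1%VF.
Proof.
move=> WX; apply/lfunP=> h; apply: val_inj; apply/lfunP=> x.
by rewrite /= mapE ?mhom1 // !id_lfunE.
Qed.

Let map_comp X Y Z (f : 'Hom(X, Y)) (g : 'Hom(Y, Z)) : W X -> W Y -> W Z ->
  f \in mhom X Y -> g \in mhom Y Z ->
  homfrom_map P_nz (g \o f)%VF = (homfrom_map P_nz g \o homfrom_map P_nz f)%VF.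
Proof.
move=> WX WY WZ fP gP; apply/lfunP=> h; apply: val_inj; apply/lfunP=> x.
by rewrite /= mapE ?mhom_comp // !comp_lfunE !mapE.
Qed.

Let map_faithful X Y (f g : 'Hom(X, Y)) : W X -> W Y ->
  f \in mhom X Y -> g \in mhom X Y ->
  homfrom_map P_nz f = homfrom_map P_nz g -> f = g.
Proof.
move=> WX WY fP gP fg; apply/lfunP=> x; have [h <-] := exE x WX.
by rewrite -!mapE // fg.
Qed.

(* Right multiplications on P make B-linear maps compatible with A. *)
Let map_full X Y (h : 'Hom(E X, E Y)) : W X -> W Y -> h \in mhom (E X) (E Y) ->
  exists2 f, f \in mhom X Y & homfrom_map P_nz f = h.
Proof.
move=> WX WY hP; pose f := (ev Y \o (h \o (ev X)^-1))%VF.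
have fE x : f x = vsval (h ((ev X)^-1%VF x)) p by rewrite !comp_lfunE evE.
have fP : f \in mhom X Y.
  apply/mhomP=> a x; rewrite !fE; set phi := (ev X)^-1%VF x.
  (* The endomorphism r of P with r p = a p represents the action of a, so B-linearity of h at r
     yields A-linearity of f at a. *)
  have [r rp] := exE (mact P a p) WP.
  have -> : (ev X)^-1%VF (mact X a x) = mact (E X) (r : B) phi.
    by apply: uniq => //; rewrite evK // actE comp_lfunE rp (mhomE _ _ (subP _)) evK.
  by rewrite (mhomE _ _ hP) actE comp_lfunE rp (mhomE _ _ (subP _)).
exists f => //; apply/lfunP=> g; apply: uniq => //; rewrite mapE // fE.
by congr (vsval (h _) p); apply: uniq; rewrite // evK.
Qed.

Let cover (N : fmod B) : exists2 D, W D & exists f : 'Hom(E D, N), surjective_hom f.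
Proof.
have [D Dd] := power_exists P (\dim {:N}).
have WD : W D by apply: (wide_dirsum wideW WP _ Dd).
have [inj [proj [homs pi pi0 sE]]] := dirsumE Dd.
have injP i : inj i \in mhom P D by case: (homs i).
have projP i : proj i \in mhom D P by case: (homs i).
pose d := vbasis {:N}.
(* The carriers of [E P] and of the regular B-module agree by conversion, so [act_vec] also serves
   as a map from [E P]. *)
pose g (i : 'I_(\dim {:N})) : 'Hom(E P, N) := act_vec d`_i : 'Hom(regular_mod B, N).
have gE i b : g i b = mact N (b : B) d`_i by apply: act_vecE.
have gP i : g i \in mhom (E P) N.
  apply/mhomP=> a b; rewrite !gE -mactA; congr (mact N _ _).
  by apply: val_inj; rewrite /= actE endop_mulE.
exists D => //; exists (\sum_i (g i \o homfrom_map P_nz (proj i)))%VF.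
apply/surj_homP; split.
  by apply: memv_suml => i _; apply: mhom_comp (map_hom WD WP (projP i)) (gP i).
move=> n; have idP : \1%VF \in mhom P P := mhom1 P.
exists (\sum_i homfrom_map P_nz (inj i) (coord d i n *: (1 : B))).
rewrite sum_lfunE [RHS](coord_vbasis (memvf n)); apply: eq_bigr => i _.
rewrite comp_lfunE linear_sum (bigD1 i) //= big1 ?addr0 => [|j ji].
  have -> : homfrom_map P_nz (proj i) (homfrom_map P_nz (inj i)
      (coord d i n *: (1 : B))) = coord d i n *: (1 : B).
    by apply: uniq => //; rewrite !mapE // pi.
  by rewrite gE mactZ mact1E.
by apply: uniq => //; rewrite !mapE // pi0 // zero_lfunE.
Qed.

(** Present N by E D' -> E D -> N -> 0. By fullness the first map comes from some g : D' -> D, and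
    the cokernel X of g satisfies E X = N, since evaluation at p reduces exactness under E to
    exactness in W. *)
Let dense (N : fmod B) : exists2 X, W X & isomorphic (E X) N.
Proof.
have [D WD [f fs]] := cover N; have [fP fS] := iffLR (surj_homP _) fs.
have [N' [k [[kP k0] kV]]] := kernel_exists fP.
have [D' WD' [f' f's]] := cover N'; have [f'P f'S] := iffLR (surj_homP _) f's.
have [g gP gE] := map_full WD' WD (mhom_comp f'P kP).
have gf h : f h = 0 <-> exists h', h = homfrom_map P_nz g h'.
  rewrite gE; split=> [/lkerP|[h' ->]]; last first.
    by apply/lkerP; rewrite -kV comp_lfunE mem_limg.
  rewrite -kV => /limgP[n ->]; have [h' <-] := f'S n.
  by exists h'; rewrite comp_lfunE.
have [X [q [qs qV]]] := cokernel_exists gP; have [qP qS] := iffLR (surj_homP _) qs.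
have WX : W X by apply: (wide_cokernel wideW gP (q := q)).
have eqs : surjective_hom (homfrom_map P_nz q).
  apply/surj_homP; split; first exact: map_hom.
  move=> h; have [d qd] := qS (vsval h p); have [h' h'p] := exE d WD.
  by exists h'; apply: uniq => //; rewrite mapE // h'p.
have eqker h : homfrom_map P_nz q h = 0 <-> f h = 0.
  rewrite gf; split=> [e0|[h' ->]].
    have : vsval h p \in lker q.
      by apply/lkerP; rewrite -mapE // e0 zero_lfunE.
    rewrite qV => /limgP[d' dE]; have [h' h'p] := exE d' WD'.
    by exists h'; apply: uniq => //; rewrite mapE // h'p.
  apply: uniq => //; rewrite !mapE // zero_lfunE; apply/lkerP.
  by rewrite qV mem_limg.
exists X => //; have [h /eqker//|u uP uE] := factor_surj eqs fP.
exists u; split.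
  apply/inj_homP; split=> // y uy; have [_ /(_ y)[h hy]] := iffLR (surj_homP _) eqs.
  by rewrite -hy; apply/eqker; rewrite uE hy.
by apply/surj_homP; split=> // n; have [h <-] := fS n; exists (homfrom_map P_nz q h).
Qed.

Definition reflection_equivalence : mod_equivalence B W :=
  ModEquivalence map_hom map_linear map_id map_comp map_faithful map_full dense.
End Equivalence.

Lemma equivalence_exists (M : fmod A) : W M -> ~ zero_mod M ->
  functorially_finite W -> exists B : falgType K, inhabited (mod_equivalence B W).
Proof.
move=> WM Mn ffW; have [P [p [WP ex un]]] := reflection_exists WM ffW.
have Pn : ~ zero_mod P.
  move=> P0; apply: Mn => m; have [h _ <-] := ex _ m WM.
  by rewrite [p]P0 linear0.
by exists (endop Pn); constructor; apply: reflection_equivalence ex un.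
Qed.
End Reflection.

Lemma pick_modP (K : fieldType) (A : falgType K) (M : fmod A) (P : subcat A) :
  (exists X, P X) -> P (pick_mod M P).
Proof.
by move=> ex; rewrite /pick_mod; case: pselect => // e; apply: (projT2 (cid e)).
Qed.

Theorem corollary8p5 (K : fieldType) (A : falgType K)
    (W : subcat A) (M : fmod A) :
  basic_algebra A ->
  wide W -> functorially_finite W ->
  W M -> indecomposable M -> tau_rigid W M ->
  exactly_one
    [/\ projective_in W M,
        is_kappabar_d (tors W) (Gen W M) (rperp W M),
        rperp W M = lperp W (taubar W M),
        is_pop_up (tors W) (Gen W M) W &
        W = lperp W (tau W M)]
    [/\ ~ projective_in W M,
        is_pop_up (tors W) (Gen W M) (lperp W (tau W M)) &
        is_kappabar_d (tors W) (Gen W M) (lperp W (tau W M))].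
Proof.
move=> _ wideW ffW WM indecM rigidM.
have [B [E]] := equivalence_exists wideW WM (proj1 indecM) ffW.
(* The chosen tau is not the default value: D Tr of E M comes from W by density. The representative
   that is picked brings its own equivalence E', which need not be E. *)
have [WT [B' [E' AR]]] : is_tau W M (tau W M).
  apply: pick_modP; have [N MN] := transpose_exists (E M).
  by have [T WT TN] := eob_dense E (dual N); exists T; split=> //; exists B, E, N.
have [Q1 [Q0 [q1 [q0 [orth /(_ rigidM) pres]]]]] :=
  AR_translate_presentation wideW WM WT AR.
have pop := pop_up_extorth wideW pres indecM.
have [pM|nP] := pselect (projective_in W M); [left | right].
  have WE := projective_extorth wideW pres pM.
  split; last by case.
  split=> //; rewrite ?orth ?WE //.
  - exact: projective_kappabar pres indecM pM.
  - rewrite /taubar asboolT //.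
    (* Likewise nu is a genuine value, with an equivalence of its own. *)
    have [WN [B'' [E'' isoN]]] : is_nu W M (nu W M).
      apply: pick_modP; have [N WN NM] := eob_dense E (nakayama (E M)).
      by exists N; split=> //; exists B, E.
    apply: subcat_ext => X; split=> -[WX X0]; split=> //.
      exact/(nakayama_mhom wideW WM WN WX pM isoN).
    exact/(nakayama_mhom wideW WM WN WX pM isoN).
  by rewrite WE in pop.
split; first by case.
by split=> //; rewrite orth //; apply: nonprojective_kappabar pres indecM nP.
Qed.
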